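(* For every cake-division instance with $n$ agents whose social graph is a tree, there exists a discrete cake-cutting protocol in the Robertson–Webb query model that computes a locally envy-free allocation using at most $n^{(1+o(1))n}$ queries.
   Context: The cake is $[0,1]$. Each agent $a_i$ has a valuation $v_i$ on finite unions of subintervals of $[0,1]$ that is non-negative, additive on disjoint pieces, non-atomic (for any $[x,y]$ and $\lambda\in[0,1]$ there is $y'$ with $v_i(x,y')=\lambda v_i(x,y)$), and normalized ($v_i(0,1)=1$). An allocation is a collection $\{A_1,\dots,A_n\}$ of pairwise disjoint pieces (each a finite union of intervals) whose union is $[0,1]$, with $A_i$ given to $a_i$. Given an undirected social graph $G$ on the agents, an allocation is locally envy-free if $v_i(A_i)\ge v_i(A_j)$ for every edge $(i,j)$ of $G$. In the Robertson–Webb query model the protocol accesses valuations only through cut queries $\texttt{cut}_i(x,\tau)$ (returns $y$ with $v_i(x,y)=\tau$) and evaluation queries $\texttt{eval}_i(x,y)$ (returns $v_i(x,y)$); the query complexity counts these queries. *)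

(* Defs.v *)
From Stdlib Require Import Reals Lra Lia List Arith Relations.
Import ListNotations.
Open Scope R_scope.

(** * Valuations
    A valuation is given by its values on intervals: [v x y] = v_i([x,y])
    for 0 <= x <= y <= 1.  Values on finite unions of (non-overlapping)
    intervals are obtained by additivity. *)
Definition valuation (v : R -> R -> R) : Prop :=
  (forall x y, 0 <= x <= y -> y <= 1 -> 0 <= v x y) /\
  (forall x y z, 0 <= x -> x <= y -> y <= z -> z <= 1 -> v x z = v x y + v y z) /\
  (forall x y lam, 0 <= x -> x <= y -> y <= 1 -> 0 <= lam <= 1 ->
     exists y', x <= y' <= y /\ v x y' = lam * v x y) /\
  v 0 1 = 1.

Definition valuation_profile (n : nat) (vs : nat -> R -> R -> R) : Prop :=
  forall i, (i < n)%nat -> valuation (vs i).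

Definition simple_graph (n : nat) (E : nat -> nat -> Prop) : Prop :=
  (forall i j, E i j -> (i < n)%nat /\ (j < n)%nat) /\
  (forall i j, E i j -> E j i) /\
  (forall i, ~ E i i).

Definition connected (n : nat) (E : nat -> nat -> Prop) : Prop :=
  forall i j, (i < n)%nat -> (j < n)%nat -> clos_refl_trans nat E i j.

Fixpoint is_walk (E : nat -> nat -> Prop) (l : list nat) : Prop :=
  match l with
  | a :: ((b :: _) as t) => E a b /\ is_walk E t
  | _ => True
  end.

Definition has_cycle (E : nat -> nat -> Prop) : Prop :=
  exists l : list nat, (3 <= length l)%nat /\ NoDup l /\ is_walk E l /\
    E (last l 0%nat) (hd 0%nat l).

Definition is_tree (n : nat) (E : nat -> nat -> Prop) : Prop :=
  simple_graph n E /\ connected n E /\ ~ has_cycle E.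

(** * Allocations
    An allocation of [0,1] into finite unions of intervals is described by
    cut points 0 = x_0 <= x_1 <= ... <= x_m = 1 and, for each segment
    [x_k, x_{k+1}], the agent that owns it.  Agent [j]'s piece A_j is the
    union of the segments it owns. *)
Record alloc := mkAlloc { cuts : list R; owners : list nat }.

Definition valid_alloc (n : nat) (A : alloc) : Prop :=
  length (cuts A) = S (length (owners A)) /\
  nth 0 (cuts A) 0 = 0 /\
  nth (length (owners A)) (cuts A) 0 = 1 /\
  (forall k, (k < length (owners A))%nat ->
     nth k (cuts A) 0 <= nth (S k) (cuts A) 0) /\
  (forall k, (k < length (owners A))%nat -> (nth k (owners A) 0 < n)%nat).

Definition piece_value (v : R -> R -> R) (A : alloc) (j : nat) : R :=
  fold_right Rplus 0
    (map (fun k => if Nat.eqb (nth k (owners A) 0%nat) j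
                   then v (nth k (cuts A) 0) (nth (S k) (cuts A) 0) else 0)
         (seq 0 (length (owners A)))).

Definition locally_envy_free (n : nat) (E : nat -> nat -> Prop)
  (vs : nat -> R -> R -> R) (A : alloc) : Prop :=
  forall i j, (i < n)%nat -> (j < n)%nat -> E i j ->
    piece_value (vs i) A j <= piece_value (vs i) A i.

Inductive protocol : Type :=
| Output : alloc -> protocol
| CutQ : nat -> R -> R -> (R -> protocol) -> protocol
| EvalQ : nat -> R -> R -> (R -> protocol) -> protocol.

(** [succeeds n E vs P k]: on the instance [vs], every execution of [P]
    (against any admissible answers to cut queries) issues only well-formed
    queries, uses at most [k] queries, and outputs a valid locally envy-free
    allocation. *)
Inductive succeeds (n : nat) (E : nat -> nat -> Prop) (vs : nat -> R -> R -> R)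
  : protocol -> nat -> Prop :=
| succ_output A k :
    valid_alloc n A -> locally_envy_free n E vs A ->
    succeeds n E vs (Output A) k
| succ_cut i x t f k :
    (i < n)%nat -> 0 <= x <= 1 -> 0 <= t <= vs i x 1 ->
    (forall y, x <= y <= 1 -> vs i x y = t -> succeeds n E vs (f y) k) ->
    succeeds n E vs (CutQ i x t f) (S k)
| succ_eval i x y f k :
    (i < n)%nat -> 0 <= x -> x <= y -> y <= 1 ->
    succeeds n E vs (f (vs i x y)) k ->
    succeeds n E vs (EvalQ i x y f) (S k).

(* Main.v *)
(* The agents play a cutting game in which every piece is known by its value to everybody; a cut is one cut query
   followed by one evaluation per agent.  Root the tree.  The root cuts the cake into n pieces that are equal to
   her, and a served agent hands to each child a packet with as many pieces as the child's subtree has agents, all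
   equal to the child; every child then keeps one piece and hands on the others, trimmed.  The trimmings form the
   residue, and one round of this is envy-free along the edges and proportional for the root.

   It remains to get an agent [a] whose advantage over a neighbour [b] exceeds a 2^(-poly n) fraction of what the
   residue is worth to her.  Then further rounds rooted at [a] shrink the residue until it is worth less to her than
   that advantage, and the component of [b] can divide the rest recursively.  The subtrees are served one by one.
   If serving an agent of a subtree with s agents leaves her parent with packets of uneven pieces, repeat the
   preceding stage s times and pool the packets: serial dictatorship on the rounds shows that in some round the
   parent's least valued piece can be forced on the child, the losses being made up by gains in the other rounds.
   This gives an advantage to the parent.  If instead the values of the residue to two neighbours disagree strongly,
   the two components of the tree trade parts of the residue, by recursion.  A stage multiplies the number of cuts
   by s, so all stages cost O(n!) cuts, and C(n) <= 3 C(n-1) + 2 n! + poly n cuts suffice altogether. *)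

(* The obstacle is that every service of an agent creates new trimmings, which may dwarf the residue
   against which an advantage was found. [outcome_after] therefore keeps three alternatives alive.
   If the new trimmings are light for the agent concerned, the old alternative survives with its
   bound [M] doubled. If they are heavy for her, this is carried along the tree path to the agent
   just served, one of whose new packets is then heavy, unless two neighbours on the way disagree.
   Each service also halves the ratio demanded of a disagreement. A ratio of 2^(2n+2) at the end
   thus needs about 2^(3n) at the start, and its power along a path of at most 2n steps makes [M]
   about 2^(6 n^2). Only the logarithm of [M] enters the cost, as the number of halvings of the
   residue, so all of this stays polynomial; the factorial comes from the repetitions of stages
   alone. At the end C^n = n^(n ln C / ln n), so a bound C^n n^n has the required form and constants
   may be wasteful. *)
Require Import Defs.
From Stdlib Require Import Reals Lra Lia List Arith Permutation Classical ClassicalEpsilon Relations.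
Import ListNotations.

(** * Trees *)

Inductive tree : Type := Node : nat -> list tree -> tree.
Definition root (t : tree) : nat := match t with Node a _ => a end.
Fixpoint nodes (t : tree) : list nat := match t with Node a ts => a :: flat_map nodes ts end.
Fixpoint edges (t : tree) : list (nat * nat) :=
  match t with Node a ts => map (fun t => (a, root t)) ts ++ flat_map edges ts end.
Definition sz (t : tree) := length (nodes t).
Definition adj (t : tree) (a b : nat) := In (a, b) (edges t) \/ In (b, a) (edges t).

Lemma tree_ind' (P : tree -> Prop) :
  (forall a ts, (forall t, In t ts -> P t) -> P (Node a ts)) -> forall t, P t.
Proof.
  intros H. fix IH 1. intros [a ts]; apply H.
  induction ts as [|t ts IHts]; intros t' [].
  - subst t'; apply IH.
  - apply IHts; assumption.
Qed.

Lemma root_in_nodes t : In (root t) (nodes t).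
Proof. destruct t; simpl; auto. Qed.

Lemma sz_pos t : (1 <= sz t)%nat.
Proof. destruct t; unfold sz; simpl; lia. Qed.

Lemma in_edges_node a ts p y : In (p, y) (edges (Node a ts)) <->
  (p = a /\ exists t, In t ts /\ y = root t) \/ (exists t, In t ts /\ In (p, y) (edges t)).
Proof.
  simpl. rewrite in_app_iff, in_map_iff, in_flat_map. split.
  - intros [[t [Ht Hin]]|H]; [left; injection Ht as <- <-; eauto | auto].
  - intros [[-> [t [Ht ->]]]|H]; [left; eauto | auto].
Qed.

Lemma edges_nodes t p y : In (p, y) (edges t) -> In p (nodes t) /\ exists a ts, t = Node a ts /\ In y (flat_map nodes ts).
Proof.
  revert p y; induction t as [a ts IH] using tree_ind'; intros p y H.
  apply in_edges_node in H. destruct H as [[-> [t [Ht ->]]]|[t [Ht H]]].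
  - split; [simpl; auto|]. exists a, ts; split; [reflexivity|]. apply in_flat_map; exists t; split; [exact Ht | apply root_in_nodes].
  - destruct (IH t Ht _ _ H) as [Hp [b [us [-> Hy]]]]. split.
    + simpl; right; apply in_flat_map; eauto.
    + exists a, ts; split; [reflexivity|]. apply in_flat_map; exists (Node b us); split; [exact Ht | simpl; auto].
Qed.

Lemma adj_nodes t a b : adj t a b -> In a (nodes t) /\ In b (nodes t).
Proof.
  assert (forall p y, In (p, y) (edges t) -> In p (nodes t) /\ In y (nodes t)) as H.
  { intros p y H; destruct (edges_nodes _ _ _ H) as [Hp [c [ts [-> Hy]]]]; split; [exact Hp | simpl; auto]. }
  intros [Hab|Hab]; apply H in Hab; tauto.
Qed.

Lemma adj_sym t a b : adj t a b -> adj t b a.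
Proof. unfold adj; tauto. Qed.

Lemma adj_node a ts u v : adj (Node a ts) u v <->
  (u = a /\ exists t, In t ts /\ v = root t) \/ (v = a /\ exists t, In t ts /\ u = root t) \/
  (exists t, In t ts /\ adj t u v).
Proof.
  unfold adj. rewrite !in_edges_node. split.
  - intros [[H|[t [H1 H2]]]|[H|[t [H1 H2]]]];
      [auto | right; right; exists t; auto | auto | right; right; exists t; auto].
  - intros [H|[H|[t [H1 [H2|H2]]]]];
      [auto | auto | left; right; exists t; auto | right; right; exists t; auto].
Qed.

Lemma NoDup_app_iff {X} (l l' : list X) :
  NoDup (l ++ l') <-> NoDup l /\ NoDup l' /\ (forall x, In x l -> ~ In x l').
Proof.
  split.
  - intros H; split; [eapply NoDup_app_remove_r; eauto|]. split; [eapply NoDup_app_remove_l; eauto|].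
    intros x Hx Hx'. apply in_split in Hx. destruct Hx as [l1 [l2 ->]].
    rewrite <- app_assoc in H; simpl in H. apply NoDup_remove_2 in H. apply H.
    rewrite !in_app_iff; auto.
  - intros [H1 [H2 H3]]; apply NoDup_app; assumption.
Qed.

Lemma NoDup_flat_map_eq {X Y} (f : X -> list Y) l x t t' : NoDup (flat_map f l) ->
  In t l -> In t' l -> In x (f t) -> In x (f t') -> t = t'.
Proof.
  induction l as [|s l IH]; intros HN Ht Ht' Hx Hx'; [destruct Ht|].
  simpl in HN. apply NoDup_app_iff in HN. destruct HN as [_ [HN2 HN3]].
  destruct Ht as [<-|Ht], Ht' as [<-|Ht']; auto.
  - exfalso; apply (HN3 x Hx). apply in_flat_map; eauto.
  - exfalso; apply (HN3 x Hx'). apply in_flat_map; eauto.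
Qed.

Lemma NoDup_flat_map_in {X Y} (f : X -> list Y) l t : NoDup (flat_map f l) -> In t l -> NoDup (f t).
Proof.
  induction l as [|s l IH]; intros HN Ht; [destruct Ht|].
  simpl in HN. apply NoDup_app_iff in HN. destruct HN as [HN1 [HN2 _]].
  destruct Ht as [<-|Ht]; auto.
Qed.

Lemma NoDup_kid a ts t : NoDup (nodes (Node a ts)) -> In t ts -> NoDup (nodes t).
Proof. intros HN; inversion HN; subst; intros; eapply NoDup_flat_map_in; eauto. Qed.

Lemma edge_not_root t p : NoDup (nodes t) -> ~ In (p, root t) (edges t).
Proof.
  intros HN H. destruct (edges_nodes _ _ _ H) as [_ [a [ts [-> Hy]]]]. inversion HN; contradiction.
Qed.

Lemma edge_irrefl t p : NoDup (nodes t) -> ~ In (p, p) (edges t).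
Proof.
  induction t as [a ts IH] using tree_ind'; intros HN H.
  pose proof H as H'. apply in_edges_node in H'. destruct H' as [[-> _]|[t [Ht H']]].
  - apply (edge_not_root _ _ HN) in H; exact H.
  - apply (IH t Ht); [eapply NoDup_kid; eauto | exact H'].
Qed.

Lemma unique_parent t p q y : NoDup (nodes t) -> In (p, y) (edges t) -> In (q, y) (edges t) -> p = q.
Proof.
  revert p q y; induction t as [a ts IH] using tree_ind'; intros p q y HN Hp Hq.
  assert (HNk : NoDup (flat_map nodes ts)) by (inversion HN; assumption).
  assert (Hcase : forall s s', In s ts -> In s' ts -> In (q, root s) (edges s') -> False).
  { intros s s' Hs Hs' H.
    assert (s = s') as ->.
    { apply (NoDup_flat_map_eq nodes ts (root s)); auto; [apply root_in_nodes|].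
      apply (adj_nodes s' q); left; exact H. }
    apply edge_not_root in H; [exact H | eapply NoDup_kid; eauto]. }
  assert (Hcase' : forall s s', In s ts -> In s' ts -> In (p, root s) (edges s') -> False).
  { intros s s' Hs Hs' H.
    assert (s = s') as ->.
    { apply (NoDup_flat_map_eq nodes ts (root s)); auto; [apply root_in_nodes|].
      apply (adj_nodes s' p); left; exact H. }
    apply edge_not_root in H; [exact H | eapply NoDup_kid; eauto]. }
  apply in_edges_node in Hp; apply in_edges_node in Hq.
  destruct Hp as [[-> [s [Hs ->]]]|[s [Hs Hp]]], Hq as [[-> [s' [Hs' Hr]]]|[s' [Hs' Hq]]].
  - reflexivity.
  - exfalso; eauto.
  - subst y; exfalso; eauto.
  - assert (s = s') as <-.
    { apply (NoDup_flat_map_eq nodes ts y); auto.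
      - apply (adj_nodes s p); left; exact Hp.
      - apply (adj_nodes s' q); left; exact Hq. }
    apply (IH s Hs p q y); auto. eapply NoDup_kid; eauto.
Qed.

Inductive sub (T : tree) : tree -> Prop :=
| sub_refl : sub T T
| sub_kid a ts t : sub T (Node a ts) -> In t ts -> sub T t.

Lemma sub_in T t : sub T t -> t = T \/ exists a ts s, T = Node a ts /\ In s ts /\ sub s t.
Proof.
  induction 1 as [|a ts t H IH Ht]; [auto|].
  right. destruct IH as [<-|[b [us [s [-> [Hs H']]]]]].
  - exists a, ts, t; repeat split; [exact Ht | constructor].
  - exists b, us, s; repeat split; [exact Hs|]. econstructor; eauto.
Qed.

Lemma sub_trans T t s : sub T t -> sub t s -> sub T s.
Proof. intros H; induction 1; [assumption | econstructor; eauto]. Qed.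

Lemma sub_nodes T t : sub T t -> incl (nodes t) (nodes T).
Proof.
  induction 1 as [|a ts t H IH Ht]; [apply incl_refl|].
  intros x Hx; apply IH; simpl; right; apply in_flat_map; eauto.
Qed.

Lemma sub_NoDup T t : NoDup (nodes T) -> sub T t -> NoDup (nodes t).
Proof. intros HN; induction 1 as [|a ts t H IH Ht]; [exact HN | eapply NoDup_kid; eauto]. Qed.

Lemma sub_sz T t : NoDup (nodes T) -> sub T t -> (sz t <= sz T)%nat.
Proof. intros HN H. apply NoDup_incl_length; [eapply sub_NoDup; eauto | apply sub_nodes, H]. Qed.

Lemma sub_edge T a ts t : sub T (Node a ts) -> In t ts -> In (a, root t) (edges T).
Proof.
  intros H Ht. assert (Hin : incl (edges (Node a ts)) (edges T)).
  { induction H as [|b us t' H IH Ht']; [apply incl_refl|].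
    intros x Hx; apply IH; simpl; apply in_app_iff; right; apply in_flat_map; eauto. }
  apply Hin; simpl; apply in_app_iff; left; apply in_map_iff; eauto.
Qed.

Lemma sub_root_eq T t s : NoDup (nodes T) -> sub T t -> sub T s -> root t = root s -> t = s.
Proof.
  revert t s; induction T as [a ts IH] using tree_ind'; intros t s HN Ht Hs Heq.
  assert (HNk : NoDup (flat_map nodes ts)) by (inversion HN; assumption).
  assert (Hnr : forall k t, In k ts -> sub k t -> root t <> a).
  { intros k t' Hk Hsub Hr. inversion HN as [|? ? Hnin]; subst. apply Hnin, in_flat_map. exists k; split; [exact Hk|].
    apply (sub_nodes _ _ Hsub), root_in_nodes. }
  apply sub_in in Ht; apply sub_in in Hs.
  destruct Ht as [->|[b [us [k [Hb [Hk Ht]]]]]], Hs as [->|[b' [us' [k' [Hb' [Hk' Hs]]]]]].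
  - reflexivity.
  - injection Hb' as <- <-. exfalso; apply (Hnr _ _ Hk' Hs); symmetry; exact Heq.
  - injection Hb as <- <-. exfalso; apply (Hnr _ _ Hk Ht); exact Heq.
  - injection Hb as <- <-; injection Hb' as <- <-.
    assert (k = k') as <-.
    { apply (NoDup_flat_map_eq nodes ts (root t)); auto.
      - apply (sub_nodes _ _ Ht), root_in_nodes.
      - rewrite Heq; apply (sub_nodes _ _ Hs), root_in_nodes. }
    apply (IH k Hk); auto. eapply NoDup_kid; eauto.
Qed.

Lemma edge_sub T a y : In (a, y) (edges T) -> exists ts t, sub T (Node a ts) /\ In t ts /\ y = root t.
Proof.
  induction T as [b us IH] using tree_ind'; intros H.
  apply in_edges_node in H. destruct H as [[-> [t [Ht ->]]]|[t [Ht H]]].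
  - exists us, t; repeat split; [constructor | exact Ht].
  - destruct (IH t Ht H) as [ts [s [Hsub Hs]]]. exists ts, s; split; [|exact Hs].
    apply sub_trans with t; [econstructor; [constructor | exact Ht] | exact Hsub].
Qed.

Lemma sub_edge_inv T a ts y : NoDup (nodes T) -> sub T (Node a ts) -> In (a, y) (edges T) ->
  exists t, In t ts /\ y = root t.
Proof.
  intros HN Hsub H. destruct (edge_sub _ _ _ H) as [us [t [Hsub' [Ht ->]]]].
  assert (Node a ts = Node a us) as Heq by (apply (sub_root_eq T); auto).
  injection Heq as <-; eauto.
Qed.

Inductive chain (T : tree) : nat -> nat -> nat -> Prop :=
| chain_nil a : chain T 0 a a
| chain_cons k a b c : adj T a b -> chain T k b c -> chain T (S k) a c.

Lemma chain_app T k l a b c : chain T k a b -> chain T l b c -> chain T (k + l) a c.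
Proof. induction 1; intros; simpl; [assumption | econstructor; eauto]. Qed.

Lemma chain_rev T k a b : chain T k a b -> chain T k b a.
Proof.
  induction 1 as [a|k a b c Hab H IH]; [constructor|].
  replace (S k) with (k + 1)%nat by lia. apply chain_app with b; [exact IH|].
  econstructor; [apply adj_sym, Hab | constructor].
Qed.

Lemma chain_root T x : In x (nodes T) -> exists k, (k <= sz T)%nat /\ chain T k (root T) x.
Proof.
  induction T as [a ts IH] using tree_ind'; intros [<-|Hx].
  - exists 0%nat; split; [lia | constructor].
  - apply in_flat_map in Hx. destruct Hx as [t [Ht Hx]].
    destruct (IH t Ht Hx) as [k [Hk Hc]]. exists (S k); split.
    + apply in_split in Ht. destruct Ht as [l1 [l2 ->]]. unfold sz in *; simpl.
      rewrite flat_map_app, length_app; simpl; rewrite length_app; lia.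
    + econstructor; [apply adj_node; left; eauto|].
      clear -Hc Ht. induction Hc as [|k b c d Hbc Hc IHc]; [constructor|].
      econstructor; [|exact IHc]. apply adj_node; right; right; eauto.
Qed.

(** Both nodes are joined through the root, possibly with a detour; the crude length only enters the
    exponent of [M]. *)
Lemma chain_between T x y : In x (nodes T) -> In y (nodes T) ->
  exists k, (k <= 2 * sz T)%nat /\ chain T k x y.
Proof.
  intros Hx Hy. destruct (chain_root T x Hx) as [k [Hk Hc]]. destruct (chain_root T y Hy) as [l [Hl Hd]].
  exists (k + l)%nat; split; [lia|]. apply chain_app with (root T); [apply chain_rev|]; assumption.
Qed.

(** * Re-rooting a tree and cutting it at an edge *)

Definition same_tree T T' := Permutation (nodes T) (nodes T') /\ forall u v, adj T u v <-> adj T' u v.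

Lemma rotate r l1 b kb l2 :
  same_tree (Node r (l1 ++ Node b kb :: l2)) (Node b (Node r (l1 ++ l2) :: kb)).
Proof.
  split.
  - simpl. rewrite !flat_map_app. simpl. rewrite <- !app_assoc.
    rewrite (Permutation_app_comm (flat_map nodes l1) (b :: _)). simpl.
    rewrite perm_swap. constructor. rewrite <- !app_assoc.
    rewrite (Permutation_app_comm (flat_map nodes kb)). rewrite <- !app_assoc.
    constructor. rewrite (app_assoc (flat_map nodes l2)). rewrite (app_assoc (flat_map nodes l1)).
    apply Permutation_app_tail, Permutation_app_comm.
  - intros u v. rewrite !adj_node. split.
    + intros [[-> [t [Ht ->]]]|[[-> [t [Ht ->]]]|[t [Ht H]]]]; apply in_app_iff in Ht; simpl in Ht.
      * destruct Ht as [Ht|[<-|Ht]].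
        -- right; right. exists (Node r (l1 ++ l2)); split; [simpl; auto|]. apply adj_node; left; split; [reflexivity|].
           exists t; split; [apply in_app_iff; auto | reflexivity].
        -- right; left; split; [reflexivity|]. exists (Node r (l1 ++ l2)); simpl; auto.
        -- right; right. exists (Node r (l1 ++ l2)); split; [simpl; auto|]. apply adj_node; left; split; [reflexivity|].
           exists t; split; [apply in_app_iff; auto | reflexivity].
      * destruct Ht as [Ht|[<-|Ht]].
        -- right; right. exists (Node r (l1 ++ l2)); split; [simpl; auto|]. apply adj_node; right; left; split; [reflexivity|].
           exists t; split; [apply in_app_iff; auto | reflexivity].
        -- left; split; [reflexivity|]. exists (Node r (l1 ++ l2)); simpl; auto.
        -- right; right. exists (Node r (l1 ++ l2)); split; [simpl; auto|]. apply adj_node; right; left; split; [reflexivity|].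
           exists t; split; [apply in_app_iff; auto | reflexivity].
      * destruct Ht as [Ht|[<-|Ht]].
        -- right; right. exists (Node r (l1 ++ l2)); split; [simpl; auto|]. apply adj_node; right; right.
           exists t; split; [apply in_app_iff; auto | exact H].
        -- apply adj_node in H. destruct H as [[-> [t [Ht ->]]]|[[-> [t [Ht ->]]]|[t [Ht H]]]].
           ++ left; split; [reflexivity|]. exists t; simpl; auto.
           ++ right; left; split; [reflexivity|]. exists t; simpl; auto.
           ++ right; right. exists t; simpl; auto.
        -- right; right. exists (Node r (l1 ++ l2)); split; [simpl; auto|]. apply adj_node; right; right.
           exists t; split; [apply in_app_iff; auto | exact H].
    + intros [[-> [t [[<-|Ht] ->]]]|[[-> [t [[<-|Ht] ->]]]|[t [[<-|Ht] H]]]].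
      * right; left; split; [reflexivity|]. exists (Node b kb); split; [apply in_app_iff; simpl; auto | reflexivity].
      * right; right. exists (Node b kb); split; [apply in_app_iff; simpl; auto|]. apply adj_node; left; eauto.
      * left; split; [reflexivity|]. exists (Node b kb); split; [apply in_app_iff; simpl; auto | reflexivity].
      * right; right. exists (Node b kb); split; [apply in_app_iff; simpl; auto|]. apply adj_node; right; left; eauto.
      * apply adj_node in H. destruct H as [[-> [t [Ht ->]]]|[[-> [t [Ht ->]]]|[t [Ht H]]]]; apply in_app_iff in Ht.
        -- left; split; [reflexivity|]. exists t; split; [apply in_app_iff; simpl; tauto | reflexivity].
        -- right; left; split; [reflexivity|]. exists t; split; [apply in_app_iff; simpl; tauto | reflexivity].
        -- right; right. exists t; split; [apply in_app_iff; simpl; tauto | exact H].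
      * right; right. exists (Node b kb); split; [apply in_app_iff; simpl; auto|]. apply adj_node; right; right; eauto.
Qed.

Lemma same_tree_trans T T' T'' : same_tree T T' -> same_tree T' T'' -> same_tree T T''.
Proof.
  intros [H1 H2] [H3 H4]; split; [eapply Permutation_trans; eauto|].
  intros; rewrite H2; apply H4.
Qed.

(** One rotation per edge of the path down to [a]. The induction is on the size of the child that
    still contains [a], since rotation enlarges a different child. *)
Lemma reroot T a : In a (nodes T) -> exists T', root T' = a /\ same_tree T T'.
Proof.
  assert (H : forall m r l1 tk l2, (sz tk <= m)%nat -> In a (nodes tk) ->
     exists T', root T' = a /\ same_tree (Node r (l1 ++ tk :: l2)) T').
  { induction m as [|m IH]; intros r l1 [b kb] l2 Hsz Ha; [unfold sz in Hsz; simpl in Hsz; lia|].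
    destruct Ha as [<-|Ha].
    - exists (Node b (Node r (l1 ++ l2) :: kb)); split; [reflexivity | apply rotate].
    - apply in_flat_map in Ha. destruct Ha as [tj [Hj Ha]]. apply in_split in Hj. destruct Hj as [k1 [k2 ->]].
      destruct (IH b (Node r (l1 ++ l2) :: k1) tj k2) as [T' [HT' Hsame]].
      + unfold sz in *; simpl in Hsz. rewrite flat_map_app, length_app in Hsz; simpl in Hsz; rewrite length_app in Hsz; lia.
      + exact Ha.
      + exists T'; split; [exact HT'|]. eapply same_tree_trans; [apply rotate | exact Hsame]. }
  destruct T as [r ts]; intros [<-|Ha].
  - exists (Node r ts); split; [reflexivity|]. split; [reflexivity | tauto].
  - apply in_flat_map in Ha. destruct Ha as [tk [Hk Ha]]. apply in_split in Hk. destruct Hk as [l1 [l2 ->]].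
    apply (H (sz tk) r l1 tk l2); auto.
Qed.

(** Once the tree is rooted at [a], the node [b] is one of the children, and removing that child
    leaves the component of [a]. *)
Lemma split_edge T a b : NoDup (nodes T) -> adj T a b ->
  exists ta tb, root ta = a /\ root tb = b /\ Permutation (nodes T) (nodes ta ++ nodes tb) /\
    forall u v, adj T u v -> adj ta u v \/ adj tb u v \/ (u = a /\ v = b) \/ (u = b /\ v = a).
Proof.
  intros HN Hab. destruct (adj_nodes _ _ _ Hab) as [Ha _].
  destruct (reroot T a Ha) as [[a' ts] [Hr [HP Hadj]]]; simpl in Hr; subst a'.
  assert (HN' : NoDup (nodes (Node a ts))) by (eapply Permutation_NoDup; eauto).
  apply Hadj in Hab. destruct Hab as [Hab|Hab].
  2:{ exfalso; apply (edge_not_root _ _ HN' Hab). }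
  destruct (sub_edge_inv _ _ _ _ HN' (sub_refl _) Hab) as [tb [Htb ->]].
  apply in_split in Htb. destruct Htb as [l1 [l2 ->]].
  exists (Node a (l1 ++ l2)), tb; split; [reflexivity|]. split; [reflexivity|]. split.
  - rewrite HP. simpl. rewrite !flat_map_app; simpl. constructor. rewrite <- app_assoc.
    apply Permutation_app_head, Permutation_app_comm.
  - intros u v H. apply Hadj in H. apply adj_node in H.
    destruct H as [[-> [t [Ht ->]]]|[[-> [t [Ht ->]]]|[t [Ht H]]]];
      apply in_app_iff in Ht; simpl in Ht; rewrite !adj_node.
    + destruct Ht as [Ht|[<-|Ht]]; [|right; right; left; auto|];
        left; left; split; [reflexivity | exists t; split; [apply in_app_iff; auto | reflexivity] |
        reflexivity | exists t; split; [apply in_app_iff; auto | reflexivity]].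
    + destruct Ht as [Ht|[<-|Ht]]; [|right; right; right; auto|];
        left; right; left; split; [reflexivity | exists t; split; [apply in_app_iff; auto | reflexivity] |
        reflexivity | exists t; split; [apply in_app_iff; auto | reflexivity]].
    + destruct Ht as [Ht|[<-|Ht]]; [|right; left; exact H|];
        left; right; right; exists t; (split; [apply in_app_iff; auto | exact H]).
Qed.

(** * From tree-shaped graphs to rooted trees *)

Lemma tree_walk t x : NoDup (nodes t) -> In x (nodes t) ->
  exists l, hd 0%nat l = root t /\ last l 0%nat = x /\ NoDup l /\ incl l (nodes t) /\ is_walk (adj t) l /\ l <> [].
Proof.
  induction t as [a ts IH] using tree_ind'; intros HN [<-|Hx].
  - exists [a]; simpl; repeat split; [repeat constructor; simpl; tauto | intros y [<-|[]]; simpl; auto | congruence].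
  - apply in_flat_map in Hx. destruct Hx as [t [Ht Hx]].
    destruct (IH t Ht (NoDup_kid _ _ _ HN Ht) Hx) as [l [Hh [Hl [HNl [Hi [Hw Hne]]]]]].
    exists (a :: l). split; [reflexivity|]. split; [destruct l; [congruence | exact Hl]|].
    assert (Hincl : incl l (flat_map nodes ts)).
    { intros y Hy; apply in_flat_map; exists t; split; [exact Ht | auto]. }
    split; [constructor; [inversion HN; auto | exact HNl]|].
    split; [intros y [<-|Hy]; simpl; auto|]. split; [|congruence].
    destruct l as [|b l]; [congruence|]. simpl in Hh; subst b. split.
    + apply adj_node; left; eauto.
    + clear -Hw Ht. revert Hw; generalize (root t) as c; induction l as [|d l IH]; intros c Hw; [exact I|].
      destruct Hw as [H1 H2]; split; [apply adj_node; right; right; eauto | apply IH, H2].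
Qed.

Lemma crossing (E : nat -> nat -> Prop) (S : nat -> Prop) a b :
  clos_refl_trans nat E a b -> S a -> ~ S b -> exists i j, E i j /\ S i /\ ~ S j.
Proof.
  induction 1 as [x y Hxy| |x y z H1 IH1 H2 IH2]; intros Ha Hb; [eauto | contradiction|].
  destruct (classic (S y)); auto.
Qed.

(** A spanning tree is grown by one vertex at a time. A graph edge outside of it would close a cycle
    with the tree path between its ends. *)
Lemma graph_tree n E : (1 <= n)%nat -> is_tree n E ->
  exists T, Permutation (nodes T) (seq 0 n) /\ forall i j, E i j -> adj T i j.
Proof.
  intros Hn [[HE [Hsym Hirr]] [Hconn Hacyc]].
  assert (Hgrow : forall k, (1 <= k <= n)%nat -> exists T, sz T = k /\ NoDup (nodes T) /\
     (forall x, In x (nodes T) -> (x < n)%nat) /\ (forall u v, adj T u v -> E u v)).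
  { induction k as [|k IH]; intros Hk; [lia|].
    destruct (Nat.eq_dec k 0) as [->|Hk0].
    - exists (Node 0 []). repeat split; simpl.
      + repeat constructor; simpl; tauto.
      + intros x [<-|[]]; lia.
      + intros u v [[]|[]].
    - destruct IH as [T [Hsz [HN [Hlt Hadj]]]]; [lia|].
      assert (Hout : exists b, (b < n)%nat /\ ~ In b (nodes T)).
      { apply NNPP; intros Hno.
        assert (Hincl : incl (seq 0 n) (nodes T)).
        { intros b Hb. apply in_seq in Hb. apply NNPP; intros Hb'; apply Hno; exists b; split; [lia | exact Hb']. }
        apply NoDup_incl_length in Hincl; [|apply seq_NoDup]. rewrite length_seq in Hincl; unfold sz in Hsz; lia. }
      destruct Hout as [b [Hb Hbn]].
      pose proof (root_in_nodes T) as Hrt.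
      destruct (crossing E (fun x => In x (nodes T)) (root T) b) as [i [j [Hij [Hi Hj]]]]; [apply Hconn; auto | exact Hrt | exact Hbn|].
      destruct (reroot T i Hi) as [[i' ts] [Hr [HP Hadj']]]; simpl in Hr; subst i'.
      exists (Node i (Node j [] :: ts)).
      assert (HP' : Permutation (nodes (Node i (Node j [] :: ts))) (j :: nodes T)).
      { rewrite HP. simpl. apply perm_swap. }
      repeat split.
      + unfold sz in *. rewrite (Permutation_length HP'); simpl; lia.
      + apply (Permutation_NoDup (Permutation_sym HP')). constructor; assumption.
      + intros x Hx. apply (Permutation_in x HP') in Hx. destruct Hx as [<-|Hx]; [apply (HE i j Hij) | auto].
      + intros u v H. apply adj_node in H.
        destruct H as [[-> [t [[<-|Ht] ->]]]|[[-> [t [[<-|Ht] ->]]]|[t [[<-|Ht] H]]]].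
        * exact Hij.
        * apply Hadj, Hadj', adj_node; left; eauto.
        * apply Hsym, Hij.
        * apply Hadj, Hadj', adj_node; right; left; eauto.
        * destruct H as [[]|[]].
        * apply Hadj, Hadj', adj_node; right; right; eauto. }
  destruct (Hgrow n) as [T [Hsz [HN [Hlt Hadj]]]]; [lia|].
  assert (HP : Permutation (nodes T) (seq 0 n)).
  { apply NoDup_Permutation_bis; [exact HN | rewrite length_seq; unfold sz in Hsz; lia|].
    intros x Hx; apply in_seq; specialize (Hlt x Hx); lia. }
  exists T; split; [exact HP|]. intros i j Hij.
  assert (Hin : forall x, (x < n)%nat -> In x (nodes T)).
  { intros x Hx; apply (Permutation_in x (Permutation_sym HP)), in_seq; lia. }
  destruct (HE i j Hij) as [Hi Hj].
  destruct (reroot T i (Hin i Hi)) as [T' [Hr [HP' Hadj']]].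
  assert (HN' : NoDup (nodes T')) by (eapply Permutation_NoDup; eauto).
  destruct (tree_walk T' j HN') as [l [Hh [Hl [HNl [Hincl [Hw Hne]]]]]].
  { apply (Permutation_in j HP'), Hin, Hj. }
  apply Hadj'. apply NNPP; intros Hno. apply Hacyc. exists l.
  assert (Hw' : is_walk E l).
  { clear -Hw Hadj Hadj'. induction l as [|x [|y l] IH]; simpl in *; auto.
    destruct Hw as [H1 H2]; split; [apply Hadj, Hadj', H1 | apply IH, H2]. }
  repeat split; [|exact HNl | exact Hw' |].
  (* A walk of one node would give [i = j], and one of two nodes would make [(i, j)] a tree edge, so
     the cycle has length at least 3. *)
  - destruct l as [|x [|y [|z l]]]; simpl in *; [congruence | | | lia].
    + subst. exfalso; apply (Hirr (root T')); congruence.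
    + exfalso; apply Hno. subst. destruct Hw as [H1 _]; exact H1.
  - rewrite Hl, Hh, Hr. apply Hsym, Hij.
Qed.

Open Scope R_scope.

(** * The cutting game *)

(* A piece of cake is represented only by its value to every agent; a bag is a finite union of pieces. *)
Record atom := Atom { av :> nat -> R; av_nonneg : forall i, 0 <= av i }.
Definition bag := list atom.
Definition val (i : nat) (b : bag) : R := fold_right (fun (a : atom) s => a i + s) 0 b.

Lemma val_app i b b' : val i (b ++ b') = val i b + val i b'.
Proof. unfold val; induction b as [|a b IH]; simpl; [lra | rewrite IH; lra]. Qed.

Lemma val_nonneg i b : 0 <= val i b.
Proof.
  unfold val; induction b as [|a b IH]; simpl; [lra|].
  pose proof (av_nonneg a i); lra.
Qed.

Lemma val_perm i b b' : Permutation b b' -> val i b = val i b'.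
Proof. unfold val; induction 1; simpl; lra. Qed.

Lemma val_nil i : val i [] = 0.
Proof. reflexivity. Qed.

(* In the cutting game a move costs one and asks agent [i] to cut off a part worth [t] to her; the adversary
   chooses the worth of the two parts to everybody else. *)
Inductive Win (G : bag -> Prop) : nat -> bag -> Prop :=
| win_done k L : G L -> Win G k L
| win_cut k e L i t : 0 <= t <= av e i ->
    (forall y z : atom, (forall j, y j + z j = e j) -> y i = t -> Win G k (y :: z :: L)) ->
    Win G (S k) (e :: L)
| win_perm k L L' : Permutation L L' -> Win G k L -> Win G k L'.

Lemma Win_mono G k k' L : (k <= k')%nat -> Win G k L -> Win G k' L.
Proof.
  intros Hk HW; revert k' Hk; induction HW as [k L HG|k e L i t Ht _ IH|k L L' HP _ IH]; intros k' Hk.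
  - apply win_done; exact HG.
  - destruct k' as [|k']; [lia|]. apply win_cut with i t; [exact Ht|].
    intros y z Hyz Hy; apply IH; [exact Hyz | exact Hy | lia].
  - apply win_perm with L; auto.
Qed.

(* Continuation-passing style makes [reach] a Hoare triple that can be framed and composed (see [reach_on]). *)
Definition reach (c : nat) (R : bag) (Post : bag -> Prop) : Prop :=
  forall G k rest,
    (forall R', (forall j, val j R' = val j R) -> Post R' -> Win G k (R' ++ rest)) ->
    Win G (c + k) (R ++ rest).

Lemma reach_ret (P : bag -> Prop) R : P R -> reach 0 R P.
Proof. intros HP G k rest H; apply H; auto. Qed.

Lemma reach_conseq c c' R (P Q : bag -> Prop) :
  (c <= c')%nat -> reach c R P ->
  (forall R', (forall j, val j R' = val j R) -> P R' -> exists R1, Permutation R' R1 /\ Q R1) ->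
  reach c' R Q.
Proof.
  intros Hc HP HPQ G k rest H.
  apply Win_mono with (c + k)%nat; [lia|]. apply HP.
  intros R' HR' HPR'. destruct (HPQ R' HR' HPR') as [R1 [Hperm HQ]].
  apply win_perm with (R1 ++ rest).
  - apply Permutation_app_tail, Permutation_sym, Hperm.
  - apply H; [|exact HQ]. intros j; rewrite <- (HR' j); apply val_perm, Permutation_sym, Hperm.
Qed.

Lemma reach_perm c R R2 (P : bag -> Prop) : Permutation R R2 -> reach c R P -> reach c R2 P.
Proof.
  intros HR HP G k rest H. apply win_perm with (R ++ rest); [apply Permutation_app_tail, HR|].
  apply HP. intros R' HR' HPR'; apply H; [|exact HPR'].
  intros j; rewrite (HR' j); apply val_perm, HR.
Qed.

(** The frame rule: the first phase works on the part [X] and leaves [S] alone. *)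
Lemma reach_on c c2 R X S (P Q : bag -> Prop) :
  Permutation R (X ++ S) -> reach c X P ->
  (forall X', (forall j, val j X' = val j X) -> P X' -> reach c2 (X' ++ S) Q) ->
  reach (c + c2) R Q.
Proof.
  intros HR HP HQ. apply reach_perm with (X ++ S); [apply Permutation_sym, HR|].
  intros G k rest H. rewrite <- app_assoc, <- Nat.add_assoc. apply HP.
  intros X' HX' HPX'. rewrite app_assoc. apply (HQ X' HX' HPX').
  intros R' HR' HQR'; apply H; [|exact HQR'].
  intros j; rewrite (HR' j), !val_app, (HX' j); reflexivity.
Qed.

Lemma reach_bind c c2 R (P Q : bag -> Prop) :
  reach c R P ->
  (forall R', (forall j, val j R' = val j R) -> P R' -> reach c2 R' Q) ->
  reach (c + c2) R Q.
Proof.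
  intros HP HQ. apply (reach_on c c2 R R [] P Q); [rewrite app_nil_r; reflexivity | exact HP |].
  intros X' HX' HPX'; rewrite app_nil_r; auto.
Qed.

(** Whole atoms are collected until the next one would overshoot [t]; only that one is cut, so a
    scattered bag still costs a single move. *)
Lemma reach_cut i t R : 0 <= t <= val i R ->
  reach 1 R (fun R' => exists Y Z, R' = Y ++ Z /\ val i Y = t).
Proof.
  revert t; induction R as [|e R IH]; intros t Ht.
  - apply reach_conseq with 0%nat (fun R' => R' = []); [lia | apply reach_ret; reflexivity|].
    intros R' _ ->. exists []; split; [reflexivity|]. exists [], []; split; [reflexivity|].
    change (val i []) with 0 in *; lra.
  - change (val i (e :: R)) with (e i + val i R) in Ht.
    destruct (Rle_lt_dec t (e i)) as [Hle|Hlt].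
    + intros G k rest H. simpl. apply win_cut with i t; [lra|].
      intros y z Hyz Hy. apply (H (y :: z :: R)).
      * intros j; unfold val; simpl; rewrite <- (Hyz j); lra.
      * exists [y], (z :: R); split; [reflexivity|]. unfold val; simpl; lra.
    + change 1%nat with (1 + 0)%nat. apply (reach_on 1 0 (e :: R) R [e]
        (fun R' => exists Y Z, R' = Y ++ Z /\ val i Y = t - e i)).
      * apply Permutation_cons_append.
      * apply IH. lra.
      * intros X' _ [Y [Z [-> HY]]].
        apply reach_conseq with 0%nat (fun R' => R' = (Y ++ Z) ++ [e]); [lia | apply reach_ret; reflexivity|].
        intros R' _ ->. exists ((e :: Y) ++ Z); split.
        -- simpl. apply Permutation_sym, Permutation_cons_append.
        -- exists (e :: Y), Z; split; [reflexivity|]. unfold val in *; simpl; lra.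
Qed.

Lemma reach_cut_equal i m R :
  reach m R (fun R' => exists ps, R' = concat ps /\ length ps = S m /\
    forall p, In p ps -> val i p * INR (S m) = val i R).
Proof.
  revert R; induction m as [|m IH]; intros R.
  - apply reach_ret. exists [R]; simpl; split; [rewrite app_nil_r; reflexivity|].
    split; [reflexivity|]. intros p [<-|[]]; lra.
  - pose proof (val_nonneg i R) as HR. pose proof (pos_INR (S m)) as Hm.
    assert (HSm : INR (S (S m)) = INR (S m) + 1) by (rewrite (S_INR (S m)); reflexivity).
    assert (Ht : 0 <= val i R / INR (S (S m)) <= val i R).
    { split; [apply Rmult_le_pos; [lra | apply Rlt_le, Rinv_0_lt_compat; lra]|].
      apply Rmult_le_reg_r with (INR (S (S m))); [lra|].
      unfold Rdiv; rewrite Rmult_assoc, Rinv_l by lra; nra. }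
    change (S m) with (1 + m)%nat at 1.
    apply reach_bind with (1 := reach_cut i _ R Ht).
    intros R' HR' [Y [Z [-> HY]]].
    assert (HZ : val i Z * INR (S (S m)) = val i R * INR (S m)).
    { specialize (HR' i); rewrite val_app in HR'.
      assert (val i Y * INR (S (S m)) = val i R) by (rewrite HY; field; lra). nra. }
    replace m with (m + 0)%nat by lia.
    apply (reach_on m 0 (Y ++ Z) Z Y) with (2 := IH Z); [apply Permutation_app_comm|].
    intros X' _ [ps [-> [Hlen Hps]]].
    apply reach_conseq with 0%nat (fun R' => R' = concat ps ++ Y); [lia | apply reach_ret; reflexivity|].
    intros R1 _ ->. exists (concat (Y :: ps)); split; [simpl; apply Permutation_app_comm|].
    exists (Y :: ps); split; [reflexivity|]. split; [simpl; rewrite Hlen; lia|].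
    replace (m + 0)%nat with m by lia.
    intros p [<-|Hp]; [rewrite HY; field; lra|].
    specialize (Hps p Hp). apply Rmult_eq_reg_r with (INR (S m)); [|rewrite S_INR; pose proof (pos_INR m); lra].
    rewrite <- HZ, <- Hps; ring.
Qed.

(** [b] halves the current part and the half that [a] likes less is kept, so each cut loses exactly
    a factor 2 for [b] and at least a factor 2 for [a]. *)
Lemma reach_halve a b L R :
  reach L R (fun R' => exists Y Z, R' = Y ++ Z /\
    val b Y * 2 ^ L = val b R /\ val a Y * 2 ^ L <= val a R).
Proof.
  revert R; induction L as [|L IH]; intros R.
  - apply reach_ret; exists R, []; rewrite app_nil_r; simpl; repeat split; lra.
  - change (S L) with (1 + L)%nat at 1.
    assert (Ht : 0 <= val b R / 2 <= val b R) by (pose proof (val_nonneg b R); lra).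
    apply reach_bind with (1 := reach_cut b _ R Ht).
    intros R' HR' [Y [Z [-> HY]]].
    assert (HH : exists U V, Permutation (Y ++ Z) (U ++ V) /\ val b U * 2 = val b R /\ val a U * 2 <= val a R).
    { pose proof (HR' a) as Ha; pose proof (HR' b) as Hb; rewrite val_app in Ha, Hb.
      destruct (Rle_lt_dec (val a Y) (val a Z)).
      - exists Y, Z; repeat split; [reflexivity | lra | lra].
      - exists Z, Y; split; [apply Permutation_app_comm|]. lra. }
    destruct HH as [U [V [HP [HbU HaU]]]].
    replace L with (L + 0)%nat at 1 by lia.
    apply (reach_on L 0 (Y ++ Z) U V) with (2 := IH U); [exact HP|].
    intros X' _ [Y1 [Z1 [-> [Hb1 Ha1]]]]. apply reach_ret.
    exists Y1, (Z1 ++ V); split; [rewrite app_assoc; reflexivity|].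
    simpl; split; [rewrite <- HbU, <- Hb1; ring|].
    apply Rle_trans with (val a U * 2); [nra | exact HaU].
Qed.

(** * Forcing the leftover of a round *)

Definition sumf {X} (f : X -> R) (l : list X) : R := fold_right (fun x s => f x + s) 0 l.

Lemma sumf_nonneg_nth {X} (f : X -> R) l : (forall x, In x l -> 0 <= f x) ->
  forall i x, nth_error l i = Some x -> f x <= sumf f l.
Proof.
  induction l as [|y l IH]; intros Hl i x Hx; [destruct i; discriminate|].
  assert (Hs : 0 <= sumf f l).
  { clear -Hl; induction l as [|z l IH]; simpl; [lra|].
    assert (0 <= f z) by (apply Hl; simpl; auto).
    assert (0 <= sumf f l) by (apply IH; intros; apply Hl; simpl in *; tauto). lra. }
  destruct i as [|i]; simpl in *.
  - injection Hx as ->; lra.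
  - assert (0 <= f y) by auto.
    assert (f x <= sumf f l) by (apply IH with i; auto). lra.
Qed.

Lemma sumf_minus {X} (f g : X -> R) l : sumf (fun x => f x - g x) l = sumf f l - sumf g l.
Proof. induction l; simpl; lra. Qed.

Lemma extract_max {X} (f : X -> R) l : l <> [] ->
  exists p q, Permutation l (p :: q) /\ forall x, In x q -> f x <= f p.
Proof.
  induction l as [|a l IH]; [congruence|intros _].
  destruct l as [|b l].
  - exists a, []; split; [reflexivity | intros x []].
  - destruct IH as [p [q [HP Hq]]]; [congruence|].
    destruct (Rle_lt_dec (f p) (f a)) as [H|H].
    + exists a, (b :: l); split; [reflexivity|].
      intros x Hx. apply (Permutation_in x HP) in Hx. destruct Hx as [<-|Hx]; [exact H|].
      specialize (Hq x Hx); lra.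
    + exists p, (a :: q); split; [rewrite HP; apply perm_swap|].
      intros x [<-|Hx]; [lra | auto].
Qed.

Lemma max_such_that {X} (f : X -> R) (Q : X -> Prop) l : (exists x, In x l /\ Q x) ->
  exists x, In x l /\ Q x /\ forall y, In y l -> Q y -> f y <= f x.
Proof.
  induction l as [|a l IH]; intros [x [Hx HQ]]; [destruct Hx|].
  destruct (classic (exists x, In x l /\ Q x)) as [H|H].
  - destruct (IH H) as [m [Hm [HQm Hmax]]].
    destruct (classic (Q a /\ f m <= f a)) as [[HQa Ha]|Hna].
    + exists a; repeat split; [simpl; auto | exact HQa|].
      intros y [<-|Hy] HQy; [lra|]. specialize (Hmax y Hy HQy); lra.
    + exists m; repeat split; [simpl; auto | exact HQm|].
      intros y [<-|Hy] HQy; [|auto].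
      destruct (Rle_lt_dec (f a) (f m)); [assumption|]. exfalso; apply Hna; split; [assumption|lra].
  - assert (x = a) as -> by (destruct Hx as [<-|Hx]; [reflexivity | exfalso; eauto]).
    exists a; repeat split; [simpl; auto | exact HQ|].
    intros y [<-|Hy] HQy; [lra | exfalso; eauto].
Qed.

(** Slots are compared with the leftover only, never with each other: the leftover goes to the
    parent, and siblings are not adjacent in the tree. *)
Definition normal {L P} (w : L -> P -> R) (pool : list P) (sl : list L) (lam : P) (ps : list P) : Prop :=
  Permutation pool (lam :: ps) /\ Forall2 (fun u p => w u lam <= w u p) sl ps.

(** Serial dictatorship: every slot takes its favourite of what remains, and the final leftover was
    available to each of them. *)
Lemma normal_exists {L P} (w : L -> P -> R) sl : forall pool, length pool = S (length sl) ->
  exists lam ps, normal w pool sl lam ps.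
Proof.
  induction sl as [|u sl IH]; intros pool Hlen.
  - destruct pool as [|p [|? ?]]; try discriminate. exists p, []; split; [reflexivity | constructor].
  - destruct (extract_max (w u) pool) as [p [q [HP Hq]]]; [destruct pool; discriminate|].
    destruct (IH q) as [lam [ps [HP' HF]]].
    { apply Permutation_length in HP; simpl in *; lia. }
    exists lam, (p :: ps); split.
    + rewrite HP, HP'. apply perm_swap.
    + constructor; [|exact HF]. apply Hq. apply (Permutation_in lam (Permutation_sym HP')); simpl; auto.
Qed.

(* Serial dictatorship in the order of the slots; if the first slot's favourite is [tau], it is replaced by
   the runner-up [q] and [tau] stays in the pool of the others.  A normal allocation of that smaller pool
   extends to a normal allocation of the whole pool unless it leaves [tau], the desired outcome. *)
Lemma forced_leftover {L P} (w : L -> P -> R) (tau : P) (sl : list (L * R)) : forall pool,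
  In tau pool -> length pool = S (length sl) -> Forall (fun ua => 0 <= snd ua) sl ->
  (forall lam ps, normal (fun ua => w (fst ua)) pool sl lam ps ->
     Forall2 (fun ua p => w (fst ua) p - w (fst ua) lam <= snd ua) sl ps) ->
  exists ps, Permutation pool (tau :: ps) /\
     Forall2 (fun ua p => w (fst ua) tau - snd ua <= w (fst ua) p) sl ps.
Proof.
  induction sl as [|[u a] sl IH]; intros pool Htau Hlen Ha Hgain.
  - destruct pool as [|p [|? ?]]; try discriminate. destruct Htau as [<-|[]].
    exists []; split; [reflexivity | constructor].
  - inversion Ha as [|? ? Ha0 Hal]; subst; simpl in Ha0.
    destruct (extract_max (w u) pool) as [b [q0 [HP Hq0]]]; [destruct pool; discriminate|].
    assert (Hlq : length q0 = S (length sl)) by (apply Permutation_length in HP; simpl in *; lia).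
    assert (Hin : tau = b \/ In tau q0) by (apply (Permutation_in tau HP) in Htau; destruct Htau; auto).
    destruct (classic (In tau q0)) as [Hin0|Hnin0].
    + destruct (IH q0 Hin0 Hlq Hal) as [ps [HP' HF]].
      { intros lam ps [HPn HFn].
        assert (N : normal (fun ua : L * R => w (fst ua)) pool ((u, a) :: sl) lam (b :: ps)).
        { split; [rewrite HP, HPn; apply perm_swap|]. constructor; [|exact HFn]. simpl.
          apply Hq0, (Permutation_in lam (Permutation_sym HPn)); simpl; auto. }
        specialize (Hgain _ _ N); inversion Hgain; assumption. }
      exists (b :: ps); split; [rewrite HP, HP'; apply perm_swap|].
      constructor; [|exact HF]. simpl. specialize (Hq0 _ Hin0); lra.
    + destruct Hin as [<-|]; [|contradiction].
      destruct (extract_max (w u) q0) as [q [q1 [HPq Hq1]]]; [destruct q0; discriminate|].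
      assert (Hlq1 : length (tau :: q1) = S (length sl)).
      { apply Permutation_length in HPq; simpl in *; lia. }
      assert (HPpool : Permutation pool (q :: tau :: q1)).
      { rewrite HP, HPq; apply perm_swap. }
      (* Give [tau] to [u] and allocate [q0] normally. The gain bound makes [tau] at most [a] better
         for [u] than the leftover, which lies in [q0], where [q] is her best. *)
      assert (Hqu : w u tau - a <= w u q).
      { destruct (normal_exists (fun ua : L * R => w (fst ua)) sl q0 Hlq) as [lam [ps [HPn HFn]]].
        assert (Hlam : In lam q0) by (apply (Permutation_in lam (Permutation_sym HPn)); simpl; auto).
        assert (N : normal (fun ua : L * R => w (fst ua)) pool ((u, a) :: sl) lam (tau :: ps)).
        { split; [rewrite HP, HPn; apply perm_swap|]. constructor; [|exact HFn]. simpl; auto. }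
        specialize (Hgain _ _ N); inversion Hgain as [|? ? ? ? H1 H2]; subst; simpl in H1.
        apply (Permutation_in lam HPq) in Hlam. destruct Hlam as [<-|Hlam]; [lra|].
        specialize (Hq1 _ Hlam); lra. }
      destruct (classic (exists ps, normal (fun ua : L * R => w (fst ua)) (tau :: q1) sl tau ps))
        as [[ps [HPn HFn]]|Hno].
      * exists (q :: ps); split; [rewrite HPpool, HPn; apply perm_swap|].
        constructor; [exact Hqu|]. clear -HFn Hal.
        induction HFn as [|ua p sl ps H HF IHF]; constructor; inversion Hal; subst; [lra|auto].
      (* Here no normal allocation of the smaller pool leaves [tau]. So its leftover lies in [q1],
         [u] likes [q] at least as much, and giving her [q] extends the allocation, which transfers
         the gain bounds. *)
      * destruct (IH (tau :: q1)) as [ps [HP' HF]]; [simpl; auto | exact Hlq1 | exact Hal | |].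
        { intros lam ps HN. pose proof HN as [HPn HFn].
          assert (Hlam : In lam (tau :: q1)) by (apply (Permutation_in lam (Permutation_sym HPn)); simpl; auto).
          destruct Hlam as [<-|Hlam]; [exfalso; eauto|].
          assert (N : normal (fun ua : L * R => w (fst ua)) pool ((u, a) :: sl) lam (q :: ps)).
          { split; [rewrite HPpool, HPn; apply perm_swap|]. constructor; [|exact HFn]. simpl; auto. }
          specialize (Hgain _ _ N); inversion Hgain; assumption. }
        exists (q :: ps); split; [rewrite HPpool, HP'; apply perm_swap|].
        constructor; [exact Hqu | exact HF].
Qed.

(** The gain depends only on the piece of slot [i] and on the leftover, so the maximum is taken over
    the finite list of such pairs and not over allocations. *)
Lemma best_gain {L P} (w : L -> P -> R) (d : P) sl pool i u :
  length pool = S (length sl) -> nth_error sl i = Some u ->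
  exists lam ps, normal w pool sl lam ps /\
    forall lam' ps', normal w pool sl lam' ps' ->
      w u (nth i ps' d) - w u lam' <= w u (nth i ps d) - w u lam.
Proof.
  intros Hlen Hi.
  assert (Hmem : forall lam ps, normal w pool sl lam ps ->
            In (nth i ps d, lam) (list_prod pool pool)).
  { intros lam ps [HP HF]. apply in_prod; apply (Permutation_in _ (Permutation_sym HP)); simpl; auto.
    right; apply nth_In. apply Forall2_length in HF. rewrite <- HF. apply nth_error_Some; congruence. }
  destruct (max_such_that (fun pl => w u (fst pl) - w u (snd pl))
    (fun pl => exists ps, normal w pool sl (snd pl) ps /\ fst pl = nth i ps d) (list_prod pool pool))
    as [[p lam] [_ [[ps [HN Hp]] Hmax]]].
  - destruct (normal_exists w sl pool Hlen) as [lam [ps HN]].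
    exists (nth i ps d, lam); split; [auto|]. exists ps; auto.
  - simpl in *; subst p. exists lam, ps; split; [exact HN|].
    intros lam' ps' HN'. apply (Hmax (nth i ps' d, lam')); [auto|]. exists ps'; auto.
Qed.

Lemma list_choice {X Y} (Q : nat -> X -> Y -> Prop) l :
  (forall k x, nth_error l k = Some x -> exists y, Q k x y) ->
  exists r, map fst r = l /\ forall k x y, nth_error r k = Some (x, y) -> Q k x y.
Proof.
  revert Q; induction l as [|x l IH]; intros Q HQ.
  - exists []; split; [reflexivity|]. intros [|k]; discriminate.
  - destruct (HQ 0%nat x eq_refl) as [y Hy].
    destruct (IH (fun k => Q (S k))) as [r [Hr Hk]]; [intros k x' Hx; apply (HQ (S k)); exact Hx|].
    exists ((x, y) :: r); split; [simpl; congruence|].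
    intros [|k] x' y' H; simpl in H; [injection H as <- <-; exact Hy | apply Hk; exact H].
Qed.

Lemma Forall2_nth_error {X Y} (Q : X -> Y -> Prop) l l' : Forall2 Q l l' ->
  forall k x y, nth_error l k = Some x -> nth_error l' k = Some y -> Q x y.
Proof.
  induction 1 as [|a b l l' H HF IH]; intros [|k] x y; simpl; try discriminate.
  - congruence.
  - apply IH.
Qed.

(* One round can be forced to leave its target over: for every slot [i] one other round is set aside in which
   that slot gains at least its loss bound in the forced round (these rounds are found by serial dictatorship
   of the slots on the rounds themselves). *)
Lemma forced_round {L P X} (w : L -> P -> R) (d : P) (pool : X -> list P) (tgt : X -> P)
    (sl : list L) (rounds : list X) :
  length rounds = S (length sl) ->
  (forall r, In r rounds -> length (pool r) = S (length sl) /\ In (tgt r) (pool r)) ->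
  exists res : list (X * (P * list P)),
    Permutation (map fst res) rounds /\
    (forall r lam ps, In (r, (lam, ps)) res -> Permutation (pool r) (lam :: ps) /\ length ps = length sl) /\
    (exists r ps, In (r, (tgt r, ps)) res) /\
    (forall i u, nth_error sl i = Some u ->
       sumf (fun x => w u (fst (snd x))) res <= sumf (fun x => w u (nth i (snd (snd x)) d)) res).
Proof.
  intros Hlen Hr.
  (* [v] is the largest gain of slot [i] in a normal allocation of round [r]. The condition is
     vacuous for a slot or a pool of the wrong kind, so that [g] can be total. *)
  set (good := fun i (r : X) v => forall u, nth_error sl i = Some u -> length (pool r) = S (length sl) ->
     (exists lam ps, normal w (pool r) sl lam ps /\ w u (nth i ps d) - w u lam = v) /\
     (forall lam ps, normal w (pool r) sl lam ps -> w u (nth i ps d) - w u lam <= v)).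
  assert (Hg : forall i r, exists v, good i r v).
  { intros i r. destruct (classic (exists u, nth_error sl i = Some u /\ length (pool r) = S (length sl)))
      as [[u [Hu Hl]]|Hno].
    - destruct (best_gain w d sl (pool r) i u Hl Hu) as [lam [ps [HN Hmax]]].
      exists (w u (nth i ps d) - w u lam). intros u' Hu' _. rewrite Hu in Hu'; injection Hu' as <-.
      split; [exists lam, ps; auto | auto].
    - exists 0. intros u Hu Hl; exfalso; eauto. }
  set (g := fun i r => proj1_sig (constructive_indefinite_description _ (Hg i r))).
  assert (Hgood : forall i r, good i r (g i r)) by (intros; unfold g; apply proj2_sig).
  clearbody g. clear Hg.
  destruct (normal_exists g (seq 0 (length sl)) rounds) as [t0 [cs [HPr HFr]]].
  { rewrite length_seq; exact Hlen. }
  assert (Ht0 : In t0 rounds) by (apply (Permutation_in _ (Permutation_sym HPr)); simpl; auto).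
  destruct (Hr t0 Ht0) as [Hl0 Htau].
  assert (Hlcs : length cs = length sl).
  { apply Forall2_length in HFr. rewrite length_seq in HFr; auto. }
  set (gl := map (fun i => g i t0) (seq 0 (length sl))).
  assert (Hlgl : length gl = length sl) by (unfold gl; rewrite length_map, length_seq; reflexivity).
  assert (Hcomb : forall i u a, nth_error (combine sl gl) i = Some (u, a) -> nth_error sl i = Some u /\ a = g i t0).
  { unfold gl. intros i u a H.
    assert (forall (A B : Type) (l : list A) (l' : list B) k x y, nth_error (combine l l') k = Some (x, y) ->
      nth_error l k = Some x /\ nth_error l' k = Some y) as Hc.
    { induction l as [|x0 l IH]; intros [|y0 l'] [|k] x y Hk; simpl in *; try discriminate; auto.
      injection Hk; intros; subst; auto. }
    apply Hc in H; destruct H as [H1 H2]; split; [exact H1|].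
    rewrite nth_error_map in H2.
    destruct (nth_error (seq 0 (length sl)) i) as [j|] eqn:Hj; [|discriminate].
    simpl in H2. injection H2 as <-.
    pose proof (nth_error_nth _ _ 0%nat Hj) as Hj'.
    assert (i < length (seq 0 (length sl)))%nat by (apply nth_error_Some; congruence).
    rewrite length_seq in H. rewrite seq_nth in Hj' by exact H. simpl in Hj'; subst; reflexivity. }
  assert (Hmapcomb : map fst (combine sl gl) = sl).
  { clear -Hlgl; revert Hlgl; generalize gl; induction sl as [|u sl IH]; intros [|a gl'] H; simpl in *;
      try discriminate; [reflexivity|]. f_equal; apply IH; lia. }
  assert (Hto : forall lam ps, normal (fun ua : L * R => w (fst ua)) (pool t0) (combine sl gl) lam ps ->
            normal w (pool t0) sl lam ps).
  { intros lam ps [HP HF]; split; [exact HP|]. rewrite <- Hmapcomb.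
    clear -HF; induction HF; simpl; constructor; auto. }
  assert (Hpos : forall i u, nth_error sl i = Some u -> 0 <= g i t0).
  { intros i u Hu. destruct (Hgood i t0 u Hu Hl0) as [[lam [ps [[HP HF] <-]]] _].
    assert (Hnth : nth_error ps i = Some (nth i ps d)).
    { apply nth_error_nth'. apply Forall2_length in HF; rewrite <- HF. apply nth_error_Some; congruence. }
    pose proof (Forall2_nth_error _ _ _ HF _ _ _ Hu Hnth); simpl in *; lra. }
  (* No slot [i] can gain more than [g i t0] in the round [t0], so forcing the target costs it at
     most [g i t0]. As [t0] is the round that nobody chose, the round chosen by slot [i] repays
     this. *)
  destruct (forced_leftover w (tgt t0) (combine sl gl) (pool t0)) as [ps0 [HP0 HF0]].
  { exact Htau. }
  { rewrite length_combine, Hlgl, Nat.min_id; exact Hl0. }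
  { apply Forall_forall. intros [u a] Hua. apply In_nth_error in Hua. destruct Hua as [i Hi].
    destruct (Hcomb _ _ _ Hi) as [Hu ->]; simpl; eauto. }
  { intros lam ps HN. pose proof (Hto _ _ HN) as HN'. destruct HN as [_ HF].
    assert (Hall : forall i ua p, nth_error (combine sl gl) i = Some ua -> nth_error ps i = Some p ->
       w (fst ua) p - w (fst ua) lam <= snd ua).
    { intros i [u a] p Hi Hp. destruct (Hcomb _ _ _ Hi) as [Hu ->]; simpl.
      destruct (Hgood i t0 u Hu Hl0) as [_ Hmax]. specialize (Hmax _ _ HN').
      rewrite (nth_error_nth _ _ d Hp) in Hmax; exact Hmax. }
    clear -HF Hall. induction HF as [|ua p sl' ps' H HF IH]; constructor.
    - apply (Hall 0%nat); reflexivity.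
    - apply IH. intros i; apply (Hall (S i)). }
  assert (Hlps0 : length ps0 = length sl) by (apply Permutation_length in HP0; simpl in HP0; lia).
  destruct (list_choice (fun i (r : X) (x : P * list P) => forall u, nth_error sl i = Some u ->
      normal w (pool r) sl (fst x) (snd x) /\ w u (nth i (snd x) d) - w u (fst x) >= g i t0) cs) as [rs [Hrs Hk]].
  { intros i r Hi.
    assert (Hlt : (i < length sl)%nat) by (rewrite <- Hlcs; apply nth_error_Some; congruence).
    destruct (nth_error sl i) as [u|] eqn:Hu; [|apply nth_error_None in Hu; lia].
    assert (Hrin : In r rounds).
    { apply (Permutation_in _ (Permutation_sym HPr)); right. apply nth_error_In with i; exact Hi. }
    destruct (Hr r Hrin) as [Hlr _].
    destruct (Hgood i r u Hu Hlr) as [[lam [ps [HN Hv]]] _].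
    exists (lam, ps). intros u' Hu'; injection Hu' as <-. split; [exact HN|]. simpl. rewrite Hv.
    assert (Hs : nth_error (seq 0 (length sl)) i = Some i).
    { rewrite (nth_error_nth' _ 0%nat) by (rewrite length_seq; exact Hlt). rewrite seq_nth by exact Hlt; reflexivity. }
    pose proof (Forall2_nth_error _ _ _ HFr _ _ _ Hs Hi); simpl in *; lra. }
  assert (Hlrs : length rs = length sl) by (rewrite <- Hlcs, <- Hrs, length_map; reflexivity).
  assert (Hnorm : forall r lam ps, In (r, (lam, ps)) rs -> normal w (pool r) sl lam ps).
  { intros r lam ps Hin. apply In_nth_error in Hin; destruct Hin as [i Hi].
    assert (Hlt : (i < length sl)%nat) by (rewrite <- Hlrs; apply nth_error_Some; congruence).
    destruct (nth_error sl i) as [u|] eqn:Hu; [|apply nth_error_None in Hu; lia].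
    destruct (Hk _ _ _ Hi u Hu) as [HN _]; exact HN. }
  exists ((t0, (tgt t0, ps0)) :: rs). split; [|split; [|split]].
  - simpl; rewrite Hrs; apply Permutation_sym, HPr.
  - intros r lam ps [H|H].
    + injection H as <- <- <-; split; [exact HP0 | exact Hlps0].
    + destruct (Hnorm _ _ _ H) as [HP HF]; split; [exact HP|]. apply Forall2_length in HF; auto.
  - exists t0, ps0; simpl; auto.
  - intros i u Hu.
    assert (Hlt : (i < length sl)%nat) by (apply nth_error_Some; congruence).
    assert (H0 : w u (tgt t0) - g i t0 <= w u (nth i ps0 d)).
    { assert (Hc : nth_error (combine sl gl) i = Some (u, g i t0)).
      { destruct (nth_error (combine sl gl) i) as [[u' a]|] eqn:Hc.
        - destruct (Hcomb _ _ _ Hc) as [Hu' ->]. congruence.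
        - apply nth_error_None in Hc. rewrite length_combine, Hlgl, Nat.min_id in Hc; lia. }
      assert (Hp : nth_error ps0 i = Some (nth i ps0 d)) by (apply nth_error_nth'; lia).
      pose proof (Forall2_nth_error _ _ _ HF0 _ _ _ Hc Hp); simpl in *; lra. }
    (* The round chosen by slot [i] alone gains that much, and in the remaining ones, being normal,
       no slot loses. *)
    assert (H1 : g i t0 <= sumf (fun x : X * (P * list P) =>
               w u (nth i (snd (snd x)) d) - w u (fst (snd x))) rs).
    { destruct (nth_error rs i) as [[r [lam ps]]|] eqn:Hi; [|apply nth_error_None in Hi; lia].
      set (f := fun x : X * (P * list P) => w u (nth i (snd (snd x)) d) - w u (fst (snd x))).
      apply Rle_trans with (f (r, (lam, ps))).
      - unfold f; simpl. destruct (Hk _ _ _ Hi u Hu) as [_ H]; simpl in H; lra.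
      - apply (sumf_nonneg_nth f rs) with (2 := Hi).
        intros [r' [lam' ps']] Hin; unfold f; simpl. destruct (Hnorm _ _ _ Hin) as [_ HF].
        assert (Hp : nth_error ps' i = Some (nth i ps' d)).
        { apply nth_error_nth'. apply Forall2_length in HF; lia. }
        pose proof (Forall2_nth_error _ _ _ HF _ _ _ Hu Hp); simpl in *; lra. }
    rewrite sumf_minus in H1. simpl. lra.
Qed.

(** * Packets and frontiers *)

(** Rotates the blocks on the right until the first one agrees with the left and can be cancelled;
    40 steps suffice for all uses. *)
Ltac perm_rotate :=
  match goal with
  | |- Permutation ?l ?l => reflexivity
  | |- Permutation (?a ++ _) (?a ++ _) => apply Permutation_app_head
  | |- Permutation _ (?b ++ ?r) =>
      apply Permutation_trans with (r ++ b); [rewrite <- ?app_assoc | apply Permutation_app_comm]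
  end.
Ltac perm_app := rewrite ?app_nil_r; rewrite <- ?app_assoc; solve [do 40 (try perm_rotate)].

(* A packet waits at the root [y] of a subtree [t] with parent [p]: [sz t] pieces, each worth exactly [own] to [y]
   and at most [cap] to [p], so that any of them may later become the share of [y].  A frontier lists the pairs
   [(p, t)] whose subtrees have not been served. *)
Record packet := Packet { pieces : list bag; own : R; cap : R }.
Definition upd {X} (f : nat -> X) (y : nat) (q : X) : nat -> X := fun z => if Nat.eq_dec z y then q else f z.
Definition front := list (nat * tree).
Definition flat (T : tree) (A : nat -> bag) : bag := flat_map A (nodes T).
Definition fbag (Fr : front) (pk : nat -> packet) : bag :=
  flat_map (fun x => concat (pieces (pk (root (snd x))))) Fr.
Definition froots (Fr : front) : list nat := map (fun x => root (snd x)) Fr.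

Definition front_ok (T : tree) (Fr : front) : Prop :=
  (forall p t, In (p, t) Fr -> sub T t /\ In (p, root t) (edges T)) /\
  NoDup (flat_map (fun x => nodes (snd x)) Fr).

Definition packet_ok (p : nat) (t : tree) (q : packet) : Prop :=
  length (pieces q) = sz t /\ forall X, In X (pieces q) -> val (root t) X = own q /\ val p X <= cap q.

Definition packets_ok (Fr : front) (pk : nat -> packet) : Prop :=
  (forall p t, In (p, t) Fr -> packet_ok p t (pk (root t))).

(** This lets [fair] be one formula for all edges; with an empty frontier it becomes envy-freeness
    in both directions ([fair_ef]). *)
Definition zero_off (Fr : front) (pk : nat -> packet) : Prop :=
  forall y, ~ In y (froots Fr) -> own (pk y) = 0 /\ cap (pk y) = 0.

(** The invariant of a partial allocation: whichever piece of her packet [y] finally keeps, neither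
    she nor her parent will envy the other. *)
Definition fair (T : tree) (A : nat -> bag) (pk : nat -> packet) : Prop :=
  forall p y, In (p, y) (edges T) ->
    val y (A p) <= val y (A y) + own (pk y) /\ val p (A y) + cap (pk y) <= val p (A p).

(* A heavy packet has a piece that [p] values well below [cap]: leaving that piece to [y] gives [p] an advantage. *)
Definition heavy_packet (Fr : front) (pk : nat -> packet) (Rr : bag) (M : R) : Prop :=
  exists p t X, In (p, t) Fr /\ In X (pieces (pk (root t))) /\
    val p Rr <= M * (cap (pk (root t)) - val p X).

(** The packet waiting at [b] is charged at its [cap], so the advantage survives every later choice
    from it. *)
Definition advantage (T : tree) (A : nat -> bag) (pk : nat -> packet) (Rr : bag) (M : R) : Prop :=
  exists a b, In (a, b) (edges T) /\ val a Rr <= M * (val a (A a) - val a (A b) - cap (pk b)).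

(* Two neighbours value the two parts of the residue in very different ratios, which makes a trade possible. *)
Definition disagreement (T : tree) (Rr : bag) (M ka : R) : Prop :=
  exists a b rho rho' s, adj T a b /\ Permutation Rr (rho ++ rho') /\ 1 <= s <= M /\
    val a Rr <= s * val a rho /\ ka * s * val b rho <= val b Rr.

Definition outcome T Fr A pk Rr M ka : Prop :=
  heavy_packet Fr pk Rr M \/ advantage T A pk Rr M \/ disagreement T Rr M ka.

(** * Serving one agent *)

Lemma reach_trim u c ps : 0 <= c -> (forall p, In p ps -> c <= val u p) ->
  reach (length ps) (concat ps) (fun R' => exists Xs rho, R' = concat Xs ++ rho /\
    length Xs = length ps /\ (forall X, In X Xs -> val u X = c) /\
    Forall2 (fun p X => forall j, val j X <= val j p) ps Xs).
Proof.
  intros Hc; induction ps as [|p ps IH]; intros Hps.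
  - apply reach_ret. exists [], []; repeat split; [intros X [] | constructor].
  - simpl. change (S (length ps)) with (1 + length ps)%nat.
    assert (Hp : 0 <= c <= val u p) by (split; [exact Hc | apply Hps; simpl; auto]).
    apply (reach_on 1 (length ps) _ p (concat ps) _ _ (Permutation_refl _) (reach_cut u c p Hp)).
    intros X' HX' [Y [Z [-> HY]]].
    replace (length ps) with (length ps + 0)%nat at 1 by lia.
    eapply (reach_on (length ps) 0 _ (concat ps) (Y ++ Z)); [apply Permutation_app_comm | apply IH|].
    { intros q Hq; apply Hps; simpl; auto. }
    intros R1 _ [Xs [rho [-> [Hlen [HX HF]]]]].
    apply reach_conseq with 0%nat (fun R' => R' = (concat Xs ++ rho) ++ Y ++ Z); [lia | apply reach_ret; reflexivity|].
    intros R2 _ ->. exists ((Y ++ concat Xs) ++ rho ++ Z); split.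
    + rewrite (Permutation_app_comm (concat Xs ++ rho)). rewrite <- !app_assoc.
      apply Permutation_app_head. rewrite (Permutation_app_comm Z). rewrite <- app_assoc. reflexivity.
    + exists (Y :: Xs), (rho ++ Z); split; [reflexivity|]. split; [simpl; lia|]. split.
      * intros X [<-|HXin]; auto.
      * constructor; [|exact HF]. intros j. specialize (HX' j). rewrite val_app in HX'.
        pose proof (val_nonneg j Z); lra.
Qed.

(** A child chooses once for every agent of her subtree; with the piece kept by the parent this uses
    up the parent's pieces ([slots_length]). *)
Definition slots (ts : list tree) : list nat := flat_map (fun t => repeat (root t) (sz t)) ts.

Lemma slots_length a ts : sz (Node a ts) = S (length (slots ts)).
Proof.
  unfold sz, slots; simpl. f_equal. induction ts as [|t ts IH]; simpl; [reflexivity|].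
  rewrite !length_app, repeat_length, IH; reflexivity.
Qed.

Lemma upd_same {X} (f : nat -> X) y q : upd f y q y = q.
Proof. unfold upd; destruct (Nat.eq_dec y y); [reflexivity | congruence]. Qed.

Lemma upd_other {X} (f : nat -> X) y q z : z <> y -> upd f y q z = f z.
Proof. unfold upd; destruct (Nat.eq_dec z y); [congruence | reflexivity]. Qed.

Lemma fbag_ext Fr pk pk' : (forall y, In y (froots Fr) -> pk y = pk' y) -> fbag Fr pk = fbag Fr pk'.
Proof.
  intros H; unfold fbag, froots in *; induction Fr as [|x Fr IH]; simpl in *; [reflexivity|].
  rewrite H by auto. f_equal; apply IH; intros; apply H; auto.
Qed.

Lemma fbag_app Fr Fr' pk : fbag (Fr ++ Fr') pk = fbag Fr pk ++ fbag Fr' pk.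
Proof. apply flat_map_app. Qed.

Lemma froots_kids a ts : froots (map (pair a) ts) = map root ts.
Proof. unfold froots; rewrite map_map; reflexivity. Qed.

Lemma kids_nodes a ts : flat_map (fun x : nat * tree => nodes (snd x)) (map (pair a) ts) = flat_map nodes ts.
Proof. induction ts; simpl; congruence. Qed.

(** In a normal allocation a bundle is worth at least [lam] to the child who chose it, so she can
    trim it to exactly that worth. She then does not envy [lam], and to [a] the trimmed piece is
    worth at most [lam]. *)
Lemma distribute a ts lam bs : NoDup (map root ts) ->
  Forall2 (fun u b => val u lam <= val u b) (slots ts) bs ->
  (forall b, In b bs -> val a b = val a lam) ->
  reach (length bs) (concat bs) (fun R' => exists pk rho, R' = fbag (map (pair a) ts) pk ++ rho /\
    packets_ok (map (pair a) ts) pk /\ zero_off (map (pair a) ts) pk /\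
    (forall t, In t ts -> own (pk (root t)) = val (root t) lam /\ cap (pk (root t)) = val a lam)).
Proof.
  revert bs; induction ts as [|t ts IH]; intros bs HN HF Hb.
  - inversion HF; subst. apply reach_ret. exists (fun _ => Packet [] 0 0), []; repeat split; intros; simpl in *; tauto.
  - simpl in HF. apply Forall2_app_inv_l in HF. destruct HF as [b1 [b2 [HF1 [HF2 ->]]]].
    inversion HN as [|? ? Hnin HN']; subst.
    assert (Hl1 : length b1 = sz t) by (apply Forall2_length in HF1; rewrite repeat_length in HF1; auto).
    rewrite concat_app, length_app.
    assert (H1 : forall p, In p b1 -> val (root t) lam <= val (root t) p).
    { clear -HF1; revert HF1; generalize (sz t); induction b1 as [|b b1 IH]; intros [|k] HF p Hp; inversion HF; subst.
      - destruct Hp.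
      - destruct Hp as [<-|Hp]; [assumption | eapply IH; eauto]. }
    eapply (reach_on (length b1) (length b2) _ (concat b1) (concat b2)); [reflexivity | apply (reach_trim _ _ _ (val_nonneg _ _) H1)|].
    intros X' _ [Xs [rho [-> [HlX [HX HFX]]]]].
    replace (length b2) with (length b2 + 0)%nat by lia.
    eapply (reach_on (length b2) 0 _ (concat b2)); [apply Permutation_app_comm | apply (IH b2 HN' HF2)|].
    { intros b Hin; apply Hb, in_app_iff; auto. }
    intros R' _ [pk [rho' [-> [Hok [Hz Hval]]]]].
    apply reach_conseq with 0%nat (fun R' => R' = (fbag (map (pair a) ts) pk ++ rho') ++ concat Xs ++ rho);
      [lia | apply reach_ret; reflexivity|].
    intros R1 _ ->.
    set (pk' := upd pk (root t) (Packet Xs (val (root t) lam) (val a lam))).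
    assert (Hne : forall s, In s ts -> root s <> root t).
    { intros s Hs Heq; apply Hnin; rewrite <- Heq; apply in_map, Hs. }
    exists ((concat Xs ++ fbag (map (pair a) ts) pk) ++ rho ++ rho'); split.
    { rewrite (Permutation_app_comm (fbag _ _ ++ rho')). rewrite <- !app_assoc. apply Permutation_app_head.
      rewrite (Permutation_app_comm rho), <- !app_assoc. apply Permutation_app_head, Permutation_app_comm. }
    exists pk', (rho ++ rho'); split; [|split; [|split]].
    + f_equal. unfold fbag at 2; simpl. f_equal; [unfold pk'; rewrite upd_same; reflexivity|].
      apply (fbag_ext (map (pair a) ts) pk pk'). intros y Hy. rewrite froots_kids in Hy. apply in_map_iff in Hy.
      destruct Hy as [s [<- Hs]]. unfold pk'; rewrite upd_other; auto.
    + intros p s [Hs|Hs].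
      * injection Hs as <- <-. unfold pk'; rewrite upd_same. unfold packet_ok; cbn [pieces own cap]. split; [rewrite <- Hl1; exact HlX|].
        intros X HXin; split; [auto|]. apply In_nth_error in HXin. destruct HXin as [k Hk].
        destruct (nth_error b1 k) as [b|] eqn:Hbk.
        -- pose proof (Forall2_nth_error _ _ _ HFX _ _ _ Hbk Hk) as Hle. simpl in Hle.
           rewrite <- (Hb b); [apply Hle|]. apply in_app_iff; left; eapply nth_error_In; eauto.
        -- apply nth_error_None in Hbk. assert (Hlt : (k < length Xs)%nat) by (apply nth_error_Some; intros Hn; unfold bag in Hk; rewrite Hn in Hk; discriminate). rewrite HlX in Hlt; unfold bag in *; lia.
      * pose proof (Hok p s Hs) as H. apply in_map_iff in Hs. destruct Hs as [s' [Heq Hs']]. injection Heq as <- <-.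
        unfold pk'; rewrite upd_other by auto. exact H.
    + intros y Hy. unfold pk'. simpl in Hy. rewrite upd_other by auto. apply Hz. intros Hin; apply Hy; right; exact Hin.
    + intros s [<-|Hs]; [unfold pk'; rewrite upd_same; simpl; auto|].
      unfold pk'; rewrite upd_other by auto; auto.
Qed.

(** All bundles were worth [lam] to [a], so to her the trimmings are the sum of the losses of the
    [length bs] pieces, and the piece with the greatest loss accounts for at least the average.
    Without bundles nothing is trimmed. *)
Lemma kids_heavy a ts lam bs pk rho : (forall b, In b bs -> val a b = val a lam) ->
  length bs = length (slots ts) ->
  (forall j, val j (fbag (map (pair a) ts) pk ++ rho) = val j (concat bs)) ->
  packets_ok (map (pair a) ts) pk ->
  (forall j, val j rho = 0) \/
  (exists t X, In t ts /\ In X (pieces (pk (root t))) /\ val a rho <= INR (length bs) * (val a lam - val a X)).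
Proof.
  intros Hb Hlen Hval Hok.
  assert (Hcount : length (flat_map (fun t => pieces (pk (root t))) ts) = length bs).
  { rewrite Hlen; unfold slots. assert (H : forall t, In t ts -> length (pieces (pk (root t))) = sz t).
    { intros t Ht; apply (Hok a t), in_map, Ht. }
    clear -H; induction ts as [|t ts IH]; simpl; [reflexivity|].
    rewrite !length_app, repeat_length, H, IH; simpl; auto; intros; apply H; simpl; auto. }
  destruct bs as [|b bs].
  - left; intros j. specialize (Hval j). rewrite val_app in Hval. change (val j (concat [])) with 0 in Hval.
    pose proof (val_nonneg j rho); pose proof (val_nonneg j (fbag (map (pair a) ts) pk)); lra.
  - right. destruct (extract_max (fun X => - val a X) (flat_map (fun t => pieces (pk (root t))) ts)) as [X [l [HP Hmax]]].
    { intros H; rewrite H in Hcount; discriminate. }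
    assert (HX : In X (flat_map (fun t => pieces (pk (root t))) ts)).
    { apply (Permutation_in X (Permutation_sym HP)); simpl; auto. }
    apply in_flat_map in HX. destruct HX as [t [Ht HX]]. exists t, X; split; [exact Ht|]. split; [exact HX|].
    assert (Hf : forall j, val j (fbag (map (pair a) ts) pk) = val j (concat (flat_map (fun t => pieces (pk (root t))) ts))).
    { intros j; clear. unfold fbag; induction ts as [|t ts IH]; simpl; [reflexivity|].
      rewrite concat_app, !val_app, IH; reflexivity. }
    assert (Hsum : forall l0 c, (forall Y, In Y l0 -> c <= val a Y) -> INR (length l0) * c <= val a (concat l0)).
    { induction l0 as [|Y l0 IH]; intros c Hc; [change (val a (concat [])) with 0; simpl; lra|].
      change (length (Y :: l0)) with (S (length l0)); rewrite S_INR; simpl. rewrite val_app.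
      assert (c <= val a Y) by (apply Hc; simpl; auto).
      assert (INR (length l0) * c <= val a (concat l0)) by (apply IH; intros; apply Hc; simpl; auto). lra. }
    assert (Hsumb : forall l0 : list bag, (forall Y, In Y l0 -> val a Y = val a lam) -> val a (concat l0) = INR (length l0) * val a lam).
    { induction l0 as [|Y l0 IH]; intros Hc; [change (val a (concat [])) with 0; simpl; lra|].
      change (length (Y :: l0)) with (S (length l0)); rewrite S_INR; simpl. rewrite val_app.
      rewrite IH by (intros; apply Hc; simpl; auto). rewrite Hc by (simpl; auto). lra. }
    specialize (Hval a). rewrite val_app, (Hsumb _ Hb), Hf in Hval.
    assert (Hlow : INR (length (b :: bs)) * val a X <= val a (concat (flat_map (fun t => pieces (pk (root t))) ts))).
    { rewrite <- Hcount. apply Hsum. intros Y HY. apply (Permutation_in Y HP) in HY.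
      destruct HY as [<-|HY]; [lra|]. specialize (Hmax Y HY); lra. }
    lra.
Qed.

Lemma flat_upd T A a lam : NoDup (nodes T) -> In a (nodes T) ->
  Permutation (flat T (upd A a (A a ++ lam))) (flat T A ++ lam).
Proof.
  unfold flat. intros HN Ha. apply in_split in Ha. destruct Ha as [l1 [l2 Heq]]. rewrite Heq in *.
  apply NoDup_remove_2 in HN. rewrite in_app_iff in HN.
  assert (Hext : forall l, ~ In a l -> flat_map (upd A a (A a ++ lam)) l = flat_map A l).
  { induction l as [|x l IH]; simpl; intros H; [reflexivity|].
    rewrite upd_other by (intros ->; tauto). rewrite IH by tauto; reflexivity. }
  rewrite !flat_map_app; simpl. rewrite !Hext by tauto. rewrite upd_same.
  rewrite <- !app_assoc. apply Permutation_app_head, Permutation_app_head, Permutation_app_comm.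
Qed.

Lemma front_step T p a ts Fr : NoDup (nodes T) -> front_ok T ((p, Node a ts) :: Fr) ->
  front_ok T (map (pair a) ts ++ Fr) /\ NoDup (map root ts) /\
  ~ In a (froots (map (pair a) ts ++ Fr)) /\ (forall y, In y (froots Fr) -> ~ In y (map root ts)).
Proof.
  intros HN [Hin HNF].
  simpl in HNF. inversion HNF as [|? ? Hna HNF']; subst.
  assert (Hflat : flat_map (fun x : nat * tree => nodes (snd x)) (map (pair a) ts ++ Fr) =
                  flat_map nodes ts ++ flat_map (fun x => nodes (snd x)) Fr).
  { rewrite flat_map_app, kids_nodes; reflexivity. }
  assert (Hroots : forall l : front, incl (froots l) (flat_map (fun x => nodes (snd x)) l)).
  { intros l y Hy. unfold froots in Hy. apply in_map_iff in Hy. destruct Hy as [x [<- Hx]].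
    apply in_flat_map; exists x; split; [exact Hx | apply root_in_nodes]. }
  apply NoDup_app_iff in HNF'. destruct HNF' as [HN1 [HN2 HN3]].
  split; [split|split; [|split]].
  - intros q t Hqt. apply in_app_iff in Hqt. destruct Hqt as [Hqt|Hqt].
    + apply in_map_iff in Hqt. destruct Hqt as [t' [Heq Ht]]. injection Heq as <- <-.
      destruct (Hin p (Node a ts)) as [Hsub _]; [simpl; auto|]. split; [econstructor; eauto | eapply sub_edge; eauto].
    + apply Hin; simpl; auto.
  - rewrite Hflat. apply NoDup_app_iff; auto.
  - clear -HN1. induction ts as [|t ts IH]; simpl in *; constructor.
    + apply NoDup_app_iff in HN1. destruct HN1 as [_ [_ H]]. intros Hr. apply in_map_iff in Hr.
      destruct Hr as [s [Heq Hs]]. apply (H (root t) (root_in_nodes t)). apply in_flat_map; exists s; split; [exact Hs|].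
      rewrite <- Heq; apply root_in_nodes.
    + apply IH. apply NoDup_app_iff in HN1; tauto.
  - intros Ha. apply Hroots in Ha. rewrite Hflat in Ha. contradiction.
  - intros y Hy Hyt. apply (HN3 y).
    + apply in_map_iff in Hyt. destruct Hyt as [t [<- Ht]]. apply in_flat_map; exists t; split; [exact Ht | apply root_in_nodes].
    + apply Hroots, Hy.
Qed.

(** The bundles come from an arbitrary bag [B] and only [own] and [cap] of the packet at [a] matter,
    so that both a single packet and a pool of several can be served. *)
Lemma process T p a ts Fr A pk Rr B lam bs :
  NoDup (nodes T) -> front_ok T ((p, Node a ts) :: Fr) ->
  fair T A pk -> packets_ok Fr pk -> zero_off ((p, Node a ts) :: Fr) pk ->
  Permutation B (lam ++ concat bs) -> Forall2 (fun u b => val u lam <= val u b) (slots ts) bs ->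
  (forall b, In b bs -> val a b = val a lam) -> val a lam = own (pk a) -> val p lam <= cap (pk a) ->
  reach (length bs) (flat T A ++ B ++ fbag Fr pk ++ Rr) (fun R' => exists pk' rho,
    R' = flat T (upd A a (A a ++ lam)) ++ fbag (map (pair a) ts ++ Fr) pk' ++ Rr ++ rho /\
    fair T (upd A a (A a ++ lam)) pk' /\ packets_ok (map (pair a) ts ++ Fr) pk' /\
    zero_off (map (pair a) ts ++ Fr) pk' /\
    (forall y, y <> a -> ~ In y (map root ts) -> pk' y = pk y) /\
    (forall t, In t ts -> cap (pk' (root t)) = val a lam) /\
    ((forall j, val j rho = 0) \/ heavy_packet (map (pair a) ts) pk' rho (INR (length bs)))).
Proof.
  intros HN HF Hfair Hok Hz HB Hsl Hb Hown Hbound.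
  destruct (front_step _ _ _ _ _ HN HF) as [HF' [HNr [Ha HFk]]].
  destruct HF as [Hin _]. destruct (Hin p (Node a ts)) as [Hsub Hpa]; [simpl; auto|]. simpl in Hpa.
  assert (Han : In a (nodes T)) by (apply (sub_nodes _ _ Hsub); simpl; auto).
  replace (length bs) with (length bs + 0)%nat by lia.
  eapply (reach_on (length bs) 0 _ (concat bs) (flat T A ++ lam ++ fbag Fr pk ++ Rr));
    [|apply (distribute a ts lam bs HNr Hsl Hb)|].
  { rewrite HB. perm_app. }
  intros X' HX' [pk1 [rho [-> [Hok1 [Hz1 Hval1]]]]].
  apply reach_conseq with 0%nat (fun R' => R' = (fbag (map (pair a) ts) pk1 ++ rho) ++ flat T A ++ lam ++ fbag Fr pk ++ Rr);
    [lia | apply reach_ret; reflexivity|].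
  intros R1 _ ->.
  (* The served agent leaves the frontier, so her packet is reset to bounds 0 as [zero_off]
     demands. *)
  set (pk' := fun y => if in_dec Nat.eq_dec y (map root ts) then pk1 y else
                       if Nat.eq_dec y a then Packet [] 0 0 else pk y).
  assert (Hk1 : forall y, In y (map root ts) -> pk' y = pk1 y).
  { intros y Hy; unfold pk'; destruct (in_dec Nat.eq_dec y (map root ts)); tauto. }
  assert (Hk2 : forall y, y <> a -> ~ In y (map root ts) -> pk' y = pk y).
  { intros y Hy Hy'; unfold pk'; destruct (in_dec Nat.eq_dec y (map root ts)); [tauto|].
    destruct (Nat.eq_dec y a); tauto. }
  assert (Haroot : ~ In a (map root ts)).
  { intros H; apply Ha. unfold froots; rewrite map_app; apply in_app_iff; left.
    fold (froots (map (pair a) ts)); rewrite froots_kids; exact H. }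
  assert (HaFr : forall y, In y (froots Fr) -> y <> a).
  { intros y Hy ->; apply Ha. unfold froots; rewrite map_app; apply in_app_iff; right; exact Hy. }
  assert (Hka : pk' a = Packet [] 0 0).
  { unfold pk'; destruct (in_dec Nat.eq_dec a (map root ts)); [tauto|]. destruct (Nat.eq_dec a a); tauto. }
  assert (Hzero : forall t, In t ts -> own (pk (root t)) = 0 /\ cap (pk (root t)) = 0).
  { intros t Ht. apply Hz. intros [H|H]; [|apply (HFk _ H), in_map, Ht].
    simpl in H; apply Haroot; rewrite H; apply in_map, Ht. }
  exists (flat T (upd A a (A a ++ lam)) ++ fbag (map (pair a) ts ++ Fr) pk' ++ Rr ++ rho); split.
  { rewrite (flat_upd _ _ _ _ HN Han). rewrite fbag_app.
    rewrite (fbag_ext (map (pair a) ts) pk' pk1) by (intros y; rewrite froots_kids; apply Hk1).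
    rewrite (fbag_ext Fr pk' pk) by (intros y Hy; apply Hk2; [apply HaFr | apply HFk]; exact Hy).
    perm_app. }
  exists pk', rho; split; [reflexivity|]. split; [|split; [|split; [|split; [|split]]]].
  - intros q y Hqy. destruct (Hfair q y Hqy) as [H1 H2].
    destruct (Nat.eq_dec y a) as [->|Hya].
    + assert (q = p) as -> by (eapply unique_parent; eauto).
      assert (p <> a) by (intros ->; apply (edge_irrefl _ _ HN Hpa)).
      rewrite Hka, upd_same, (upd_other _ _ _ _ H), !val_app; simpl. rewrite Hown; lra.
    + destruct (Nat.eq_dec q a) as [->|Hqa].
      * destruct (sub_edge_inv _ _ _ _ HN Hsub Hqy) as [t [Ht ->]].
        rewrite upd_same, (upd_other _ _ _ _ Hya), !val_app, Hk1 by (apply in_map, Ht).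
        destruct (Hval1 t Ht) as [-> ->]. destruct (Hzero t Ht) as [Hz1' Hz2']. rewrite Hz1' in H1; rewrite Hz2' in H2. lra.
      * assert (~ In y (map root ts)).
        { intros Hyt. apply in_map_iff in Hyt. destruct Hyt as [t [<- Ht]].
          apply Hqa. eapply unique_parent; [exact HN | exact Hqy | eapply sub_edge; eauto]. }
        rewrite !upd_other, Hk2 by assumption. auto.
  - intros q t Hqt. apply in_app_iff in Hqt. destruct Hqt as [Hqt|Hqt].
    + rewrite Hk1; [apply Hok1, Hqt|]. apply in_map_iff in Hqt. destruct Hqt as [t' [Heq Ht]].
      injection Heq as <- <-; apply in_map, Ht.
    + assert (In (root t) (froots Fr)) by (apply in_map_iff; exists (q, t); auto).
      rewrite Hk2; [apply Hok, Hqt | apply HaFr | apply HFk]; assumption.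
  - intros y Hy. destruct (Nat.eq_dec y a) as [->|Hya]; [rewrite Hka; simpl; auto|].
    unfold froots in Hy; rewrite map_app, in_app_iff in Hy.
    fold (froots (map (pair a) ts)) in Hy; rewrite froots_kids in Hy.
    rewrite Hk2 by tauto. apply Hz. intros [H|H]; [simpl in H; congruence | unfold froots in H; tauto].
  - exact Hk2.
  - intros t Ht. rewrite Hk1 by (apply in_map, Ht). apply Hval1, Ht.
  - destruct (kids_heavy a ts lam bs pk1 rho) as [H|[t [X [Ht [HX H]]]]]; auto.
    + apply Forall2_length in Hsl; auto.
    + right. exists a, t, X; split; [apply in_map, Ht|]. rewrite Hk1 by (apply in_map, Ht).
      split; [exact HX|]. destruct (Hval1 t Ht) as [_ ->]. rewrite Nat.add_0_r; exact H.
Qed.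

(** * Repeated stages *)

(* Along a path the ratio of the values of [rho] and of the whole residue either jumps by a factor [ka] at some
   edge or stays bounded up to the end of the path. *)
Lemma path_dichotomy T Rr rho rho' ka : 1 <= ka -> Permutation Rr (rho ++ rho') ->
  forall k a x, chain T k a x -> forall s M, 1 <= s -> s * ka ^ k <= M -> val a Rr <= s * val a rho ->
  disagreement T Rr M ka \/ val x Rr <= M * val x rho.
Proof.
  intros Hka HP k a x Hc; induction Hc as [a|k a b c Hab Hc IH]; intros s M Hs HM Ha.
  - right. simpl in HM. pose proof (val_nonneg a rho). apply Rle_trans with (s * val a rho); [exact Ha|].
    apply Rmult_le_compat_r; lra.
  - pose proof (pow_R1_Rle ka k Hka) as Hpow. simpl in HM.
    assert (Hpow1 : 1 <= ka * ka ^ k) by nra.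
    assert (HsM : s <= M) by nra.
    destruct (Rle_lt_dec (ka * s * val b rho) (val b Rr)) as [H|H].
    + left. exists a, b, rho, rho', s; repeat split; try assumption.
    + apply (IH (ka * s) M); [nra | nra | lra].
Qed.

Definition n_of (T : tree) : R := INR (sz T).

(** The residue grows from [Rr] to [Rr ++ rho]. The demanded ratio drops from [2 * ka] to [ka]
    because a disagreement over [Rr] survives with [s] doubled. *)
Lemma outcome_after T p a ts Fr A pk pk' Rr rho lam M ka c :
  NoDup (nodes T) -> front_ok T ((p, Node a ts) :: Fr) ->
  zero_off ((p, Node a ts) :: Fr) pk -> val p lam <= cap (pk a) ->
  zero_off (map (pair a) ts ++ Fr) pk' ->
  (forall y, y <> a -> ~ In y (map root ts) -> pk' y = pk y) ->
  (forall t, In t ts -> cap (pk' (root t)) = val a lam) ->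
  ((forall j, val j rho = 0) \/ heavy_packet (map (pair a) ts) pk' rho c) ->
  1 <= ka -> 1 <= c -> 2 * ka ^ (2 * sz T) * c <= 2 * M -> 1 <= M ->
  outcome T Fr A pk Rr M (2 * ka) ->
  outcome T (map (pair a) ts ++ Fr) (upd A a (A a ++ lam)) pk' (Rr ++ rho) (2 * M) ka.
Proof.
  intros HN HF Hz Hbound Hz' Hother Hkids Hheavy Hka Hc HM HM1 Hout.
  destruct (front_step _ _ _ _ _ HN HF) as [HF' [HNr [Ha HFk]]].
  destruct HF as [Hin _]. destruct (Hin p (Node a ts)) as [Hsub Hpa]; [simpl; auto|]. simpl in Hpa.
  assert (Haroot : ~ In a (map root ts)).
  { intros H; apply Ha. unfold froots; rewrite map_app; apply in_app_iff; left.
    fold (froots (map (pair a) ts)); rewrite froots_kids; exact H. }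
  assert (Han : In a (nodes T)) by (apply (sub_nodes _ _ Hsub); simpl; auto).
  (* On the edge above [a] the new piece [lam] replaces a [cap] that is at least as large; on the
     edges below, [lam] pays for the new [cap]. *)
  assert (Hslack : forall b1 b2, In (b1, b2) (edges T) ->
    val b1 (A b1) - val b1 (A b2) - cap (pk b2) <=
    val b1 (upd A a (A a ++ lam) b1) - val b1 (upd A a (A a ++ lam) b2) - cap (pk' b2)).
  { intros b1 b2 Hb. destruct (Nat.eq_dec b2 a) as [->|Hb2].
    - assert (b1 = p) as -> by (eapply unique_parent; eauto).
      assert (p <> a) by (intros ->; apply (edge_irrefl _ _ HN Hpa)).
      destruct (Hz' a Ha) as [_ ->]. rewrite upd_same, upd_other, val_app by assumption. lra.
    - destruct (Nat.eq_dec b1 a) as [->|Hb1].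
      + destruct (sub_edge_inv _ _ _ _ HN Hsub Hb) as [t [Ht ->]].
        rewrite upd_same, upd_other, val_app, (Hkids t Ht) by assumption.
        destruct (Hz (root t)) as [_ ->]; [|lra].
        intros [H|H]; [simpl in H; congruence | apply (HFk _ H), in_map, Ht].
      + assert (~ In b2 (map root ts)).
        { intros Hyt. apply in_map_iff in Hyt. destruct Hyt as [t [<- Ht]].
          apply Hb1. eapply unique_parent; [exact HN | exact Hb | eapply sub_edge; eauto]. }
        rewrite !upd_other, Hother by assumption. lra. }
  (* Otherwise [rho] is more than half of the residue for [b], so the path from [b] to [a] starts
     with [s = 2]. It either meets a disagreement or bounds the residue at [a] by a multiple of
     [rho], for which a packet of her children is heavy. *)
  assert (Hcase : forall b, In b (nodes T) -> val b rho <= val b Rr \/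
     outcome T (map (pair a) ts ++ Fr) (upd A a (A a ++ lam)) pk' (Rr ++ rho) (2 * M) ka).
  { intros b Hb. destruct (Rle_lt_dec (val b rho) (val b Rr)) as [H|H]; [auto|right].
    destruct Hheavy as [H0|[q [t [X [Hqt [HX HhX]]]]]].
    { rewrite H0 in H. pose proof (val_nonneg b Rr); lra. }
    apply in_map_iff in Hqt. destruct Hqt as [t' [Heq Ht]]. injection Heq as <- <-.
    destruct (chain_between T b a Hb Han) as [k [Hk Hch]].
    pose proof (pow_R1_Rle ka (2 * sz T) Hka) as Hp1.
    assert (Hpk : ka ^ k <= ka ^ (2 * sz T)) by (apply Rle_pow; [exact Hka | exact Hk]).
    destruct (path_dichotomy T (Rr ++ rho) rho Rr ka Hka (Permutation_app_comm _ _) k b a Hch 2 (2 * ka ^ (2 * sz T)))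
      as [H1|H1]; [lra | lra | rewrite val_app; lra | |].
    - right; right. destruct H1 as [u [v [r1 [r2 [s [H2 [H3 [H4 [H5 H6]]]]]]]]].
      exists u, v, r1, r2, s; repeat split; try assumption; [lra|]. nra.
    - left. exists a, t', X; split; [apply in_app_iff; left; apply in_map, Ht|]. split; [exact HX|].
      assert (HcM : 2 * ka ^ (2 * sz T) * val a rho <=
                    2 * ka ^ (2 * sz T) * (c * (cap (pk' (root t')) - val a X))).
      { apply Rmult_le_compat_l; lra. }
      pose proof (val_nonneg a rho) as Hrho.
      assert (0 <= cap (pk' (root t')) - val a X) by nra. nra. }
  destruct Hout as [[q [t [X [Hqt [HX HhX]]]]]|[[b1 [b2 [Hb Hadv]]]|[u [v [r1 [r2 [s [H2 [H3 [H4 [H5 H6]]]]]]]]]]].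
  - destruct (Hin q t) as [_ Hedge]; [simpl; auto|].
    destruct (Hcase q) as [Hlight|]; [apply (adj_nodes T q (root t)); left; exact Hedge | | assumption].
    left. exists q, t, X; split; [apply in_app_iff; auto|].
    assert (Hr : In (root t) (froots Fr)) by (apply in_map_iff; exists (q, t); auto).
    rewrite Hother; [|intros Heq|apply HFk, Hr].
    + split; [exact HX|]. rewrite val_app; lra.
    + apply Ha. unfold froots; rewrite map_app; apply in_app_iff; right. rewrite <- Heq; exact Hr.
  - destruct (Hcase b1) as [Hlight|]; [apply (adj_nodes T b1 b2); left; exact Hb | | assumption].
    right; left. exists b1, b2; split; [exact Hb|]. specialize (Hslack _ _ Hb). rewrite val_app.
    apply Rle_trans with (2 * (M * (val b1 (A b1) - val b1 (A b2) - cap (pk b2)))); [lra|]. nra.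
  - destruct (Hcase u) as [Hlight|]; [apply (adj_nodes T u v); exact H2 | | assumption].
    right; right. exists u, v, r1, (r2 ++ rho), (2 * s); repeat split; [exact H2 | | lra | lra | |].
    + rewrite H3. perm_app.
    + rewrite val_app; lra.
    + rewrite val_app. pose proof (val_nonneg v rho). lra.
Qed.

(** * Pooling the packets of repeated stages *)

Definition zipapp (l l' : list bag) : list bag := map (fun xy => fst xy ++ snd xy) (combine l l').
(** Pieces are joined by index; any pairing would do, since all pieces of a packet obey the same
    [own] and [cap]. *)
Definition merge (q q' : packet) : packet :=
  Packet (zipapp (pieces q) (pieces q')) (own q + own q') (cap q + cap q').

Lemma zipapp_concat l : forall l', length l = length l' ->
  Permutation (concat (zipapp l l')) (concat l ++ concat l').
Proof.
  induction l as [|x l IH]; intros [|y l'] H; try discriminate; [reflexivity|].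
  unfold zipapp in *; simpl. rewrite IH by (simpl in H; lia). perm_app.
Qed.

Lemma merge_ok p t q q' : packet_ok p t q -> packet_ok p t q' -> packet_ok p t (merge q q').
Proof.
  intros [H1 H2] [H3 H4]; split; simpl.
  - unfold zipapp. rewrite length_map, length_combine, H1, H3. apply Nat.min_id.
  - intros X HX. unfold zipapp in HX. apply in_map_iff in HX. destruct HX as [[x y] [<- Hxy]]; simpl.
    pose proof (in_combine_l _ _ _ _ Hxy) as Hx. pose proof (in_combine_r _ _ _ _ Hxy) as Hy.
    rewrite !val_app. destruct (H2 x Hx), (H4 y Hy). split; lra.
Qed.

Lemma fbag_merge Fr pk pk' : packets_ok Fr pk -> packets_ok Fr pk' ->
  Permutation (fbag Fr (fun y => merge (pk y) (pk' y))) (fbag Fr pk ++ fbag Fr pk').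
Proof.
  intros H H'; induction Fr as [|[p t] Fr IH]; [reflexivity|].
  unfold fbag in *; simpl. rewrite IH; [|intros q s Hs; apply H; simpl; auto|intros q s Hs; apply H'; simpl; auto].
  rewrite zipapp_concat; [perm_app|].
  destruct (H p t) as [-> _]; [simpl; auto|]. destruct (H' p t) as [-> _]; [simpl; auto|]. reflexivity.
Qed.

Lemma flat_app T A B : Permutation (flat T (fun i => A i ++ B i)) (flat T A ++ flat T B).
Proof.
  unfold flat; induction (nodes T) as [|x l IH]; simpl; [reflexivity|]. rewrite IH. perm_app.
Qed.

Lemma fair_add T A pk A' pk' : fair T A pk -> fair T A' pk' ->
  fair T (fun i => A i ++ A' i) (fun y => merge (pk y) (pk' y)).
Proof.
  intros H H' p y Hpy. destruct (H p y Hpy), (H' p y Hpy). rewrite !val_app; simpl; lra.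
Qed.

Lemma zero_add Fr pk pk' : zero_off Fr pk -> zero_off Fr pk' -> zero_off Fr (fun y => merge (pk y) (pk' y)).
Proof. intros H H' y Hy; simpl. destruct (H y Hy), (H' y Hy); lra. Qed.

Definition staged T Fr (out : (nat -> bag) -> (nat -> packet) -> bag -> Prop) (R' : bag) : Prop :=
  exists A pk Rr, R' = flat T A ++ fbag Fr pk ++ Rr /\ fair T A pk /\ packets_ok Fr pk /\ zero_off Fr pk /\
    out A pk Rr.

(* [M] bounds the residue in terms of the advantage, [ka] is the ratio demanded of a disagreement. *)
Definition stage T Fr N M ka : Prop :=
  forall R, reach N R (staged T Fr (fun A pk Rr => outcome T Fr A pk Rr M ka)).

Definition merge_all (s : nat) (cs : list (packet * bag)) : packet :=
  fold_right (fun c q => merge (fst c) q) (Packet (repeat [] s) 0 0) cs.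

Definition pool_bag (cs : list (packet * bag)) : bag := flat_map (fun c => concat (pieces (fst c))) cs.

Lemma empty_packet_ok p t : packet_ok p t (Packet (repeat [] (sz t)) 0 0).
Proof.
  split; simpl; [apply repeat_length|]. intros X HX. apply repeat_spec in HX; subst.
  unfold val; simpl; lra.
Qed.

Lemma merge_all_ok p t cs : (forall c, In c cs -> packet_ok p t (fst c)) -> packet_ok p t (merge_all (sz t) cs).
Proof.
  induction cs as [|c cs IH]; intros H; simpl; [apply empty_packet_ok|].
  apply merge_ok; [apply H; simpl; auto | apply IH; intros; apply H; simpl; auto].
Qed.

Lemma merge_all_bag p t cs : (forall c, In c cs -> packet_ok p t (fst c)) ->
  Permutation (concat (pieces (merge_all (sz t) cs))) (pool_bag cs).
Proof.
  induction cs as [|c cs IH]; intros H; simpl.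
  - assert (forall k, concat (repeat (@nil atom) k) = []) as -> by (induction k; simpl; auto). reflexivity.
  - assert (Hcs : forall c, In c cs -> packet_ok p t (fst c)) by (intros; apply H; simpl; auto).
    rewrite zipapp_concat; [apply Permutation_app_head, (IH Hcs)|].
    destruct (H c) as [-> _]; [simpl; auto|].
    destruct (merge_all_ok p t cs Hcs) as [-> _]; reflexivity.
Qed.

Lemma merge_all_sums s cs : own (merge_all s cs) = sumf (fun c => own (fst c)) cs /\
  cap (merge_all s cs) = sumf (fun c => cap (fst c)) cs.
Proof. induction cs as [|c cs [IH1 IH2]]; simpl; [auto|]. rewrite IH1, IH2; auto. Qed.

(** The second component of a pair is the light piece of its packet, the target of the later
    forcing. *)
Definition collected p t M (cs : list (packet * bag)) (Rr : bag) : Prop :=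
  forall c, In c cs -> packet_ok p t (fst c) /\ In (snd c) (pieces (fst c)) /\
    val p Rr <= M * (cap (fst c) - val p (snd c)).

(** The packets gathered at [t] stay apart in [pool_bag], because forcing still has to choose within
    each of them; their merger [pk (root t)] is only the account that [fair] needs. *)
Definition pooled T p t Fr M (cs : list (packet * bag)) (R' : bag) : Prop :=
  exists A pk Rr, R' = flat T A ++ pool_bag cs ++ fbag Fr pk ++ Rr /\ fair T A pk /\ packets_ok Fr pk /\
    zero_off ((p, t) :: Fr) pk /\ pk (root t) = merge_all (sz t) cs /\ collected p t M cs Rr.

(** Packets of empty pieces have the right length and bounds 0: the state before the first
    repetition. *)
Lemma empty_front Fr : NoDup (froots Fr) -> exists pk, packets_ok Fr pk /\ fbag Fr pk = [] /\
  (forall y, own (pk y) = 0 /\ cap (pk y) = 0) /\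
  (forall q t, In (q, t) Fr -> pk (root t) = Packet (repeat [] (sz t)) 0 0).
Proof.
  induction Fr as [|[p t] Fr IH]; intros HN.
  - exists (fun _ => Packet [] 0 0); repeat split; simpl in *; tauto.
  - inversion HN as [|? ? Hnin HN']; subst. destruct (IH HN') as [pk [Hok [Hbag [Hz Hval]]]].
    set (pk' := upd pk (root t) (Packet (repeat [] (sz t)) 0 0)).
    assert (Hval' : forall q s, In (q, s) ((p, t) :: Fr) -> pk' (root s) = Packet (repeat [] (sz s)) 0 0).
    { intros q s [Hs|Hs]; [injection Hs as <- <-; apply upd_same|].
      unfold pk'; rewrite upd_other; [eauto|]. intros Heq; apply Hnin. simpl; rewrite <- Heq.
      apply in_map_iff; exists (q, s); auto. }
    exists pk'; split; [|split; [|split; [|exact Hval']]].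
    + intros q s Hs; rewrite (Hval' q s Hs); apply empty_packet_ok.
    + unfold fbag in *; simpl. rewrite (Hval' p t) by (simpl; auto). simpl.
      assert (forall k, concat (repeat (@nil atom) k) = []) as -> by (induction k; simpl; auto). simpl.
      rewrite <- Hbag. apply (fbag_ext Fr pk' pk). intros y Hy. unfold pk'; apply upd_other.
      intros ->; apply Hnin; exact Hy.
    + intros y; unfold pk', upd. destruct (Nat.eq_dec y (root t)); simpl; auto.
Qed.

Lemma front_roots_NoDup T Fr : front_ok T Fr -> NoDup (froots Fr).
Proof.
  intros [_ HN]. unfold froots. induction Fr as [|x Fr IH]; simpl in *; constructor.
  - apply NoDup_app_iff in HN. destruct HN as [_ [_ H]]. intros Hr. apply in_map_iff in Hr.
    destruct Hr as [y [Heq Hy]]. apply (H (root (snd x)) (root_in_nodes _)).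
    apply in_flat_map; exists y; split; [exact Hy|]. rewrite <- Heq; apply root_in_nodes.
  - apply IH. apply NoDup_app_iff in HN; tauto.
Qed.

Lemma flat_nil T : flat T (fun _ => []) = [].
Proof. unfold flat; induction (nodes T); simpl; auto. Qed.

(* Either [j] repetitions of the stage all produce a heavy packet at [(p, t)], or one of them ends otherwise. *)
Lemma collect_loop T p t Fr N M ka : front_ok T ((p, t) :: Fr) -> 0 <= M -> stage T ((p, t) :: Fr) N M ka ->
  forall j R, reach (j * N) R (fun R' => (exists cs, length cs = j /\ pooled T p t Fr M cs R') \/
    staged T ((p, t) :: Fr) (fun A pk Rr => outcome T Fr A pk Rr M ka) R').
Proof.
  intros HF HM Hst; induction j as [|j IH]; intros R.
  - apply reach_ret. left. exists []; split; [reflexivity|].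
    destruct (empty_front ((p, t) :: Fr)) as [pk [Hok [Hbag [Hz Hval]]]]; [eapply front_roots_NoDup; eauto|].
    assert (Hbag' : fbag Fr pk = []).
    { unfold fbag in *; simpl in Hbag. apply app_eq_nil in Hbag; tauto. }
    exists (fun _ => []), pk, R. rewrite flat_nil, Hbag'. split; [reflexivity|]. split; [|split; [|split; [|split]]].
    + intros q y _. destruct (Hz y) as [-> ->]. rewrite !val_nil. lra.
    + intros q s Hs; apply Hok; simpl; auto.
    + intros y _; apply Hz.
    + rewrite (Hval p t) by (simpl; auto). reflexivity.
    + intros c [].
  - replace (S j * N)%nat with (j * N + N)%nat by lia. eapply reach_bind; [apply IH|].
    intros R' _ [[cs [Hlen [A [pk [Rr [-> [Hfair [Hok [Hz [Hpk Hcs]]]]]]]]]]|Hexit].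
    2:{ apply reach_conseq with 0%nat (fun R1 => R1 = R'); [lia | apply reach_ret; reflexivity|].
        intros R1 _ ->. exists R'; auto. }
    replace N with (N + 0)%nat by lia.
    eapply (reach_on N 0 _ Rr (flat T A ++ pool_bag cs ++ fbag Fr pk)); [perm_app | apply (Hst Rr)|].
    intros X' HX' [A2 [pk2 [R2 [-> [Hfair2 [Hok2 [Hz2 Hout]]]]]]].
    set (A3 := fun i => A2 i ++ A i). set (pk3 := fun y => merge (pk2 y) (pk y)).
    assert (Hcok : forall c, In c cs -> packet_ok p t (fst c)) by (intros c Hc; apply Hcs, Hc).
    assert (HokF : packets_ok ((p, t) :: Fr) pk).
    { intros q s [Hs|Hs]; [injection Hs as <- <-; rewrite Hpk; apply merge_all_ok, Hcok | apply Hok, Hs]. }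
    assert (Hok2F : packets_ok Fr pk2) by (intros q s Hs; apply Hok2; simpl; auto).
    assert (Hok3 : packets_ok ((p, t) :: Fr) pk3).
    { intros q s Hs; apply merge_ok; [apply Hok2, Hs | apply HokF, Hs]. }
    assert (Hfair3 : fair T A3 pk3) by (apply fair_add; assumption).
    assert (Hz3 : zero_off ((p, t) :: Fr) pk3) by (apply zero_add; assumption).
    (* The next stage is played on the residue of the previous ones, so a gap found earlier stays
       large against what is left. *)
    assert (HRr : val p R2 <= val p Rr).
    { rewrite <- (HX' p), !val_app. pose proof (val_nonneg p (flat T A2)).
      pose proof (val_nonneg p (fbag ((p, t) :: Fr) pk2)). lra. }
    destruct (classic (exists tau, In tau (pieces (pk2 (root t))) /\
      val p R2 <= M * (cap (pk2 (root t)) - val p tau))) as [[tau [Htau Hflag]]|Hno].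
    + apply reach_conseq with 0%nat (fun R1 => R1 = (flat T A2 ++ fbag ((p, t) :: Fr) pk2 ++ R2) ++
        flat T A ++ pool_bag cs ++ fbag Fr pk); [lia | apply reach_ret; reflexivity|].
      intros R1 _ ->.
      exists (flat T A3 ++ pool_bag ((pk2 (root t), tau) :: cs) ++ fbag Fr pk3 ++ R2); split.
      * unfold A3, pk3. rewrite flat_app, fbag_merge by assumption. unfold fbag at 1; simpl. fold (fbag Fr pk2).
        fold (pool_bag cs). perm_app.
      * left. exists ((pk2 (root t), tau) :: cs); split; [simpl; congruence|].
        exists A3, pk3, R2; split; [reflexivity|]. split; [exact Hfair3|].
        split; [intros q s Hs; apply Hok3; simpl; auto|]. split; [exact Hz3|].
        split; [unfold pk3; rewrite Hpk; reflexivity|].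
        intros c [<-|Hc]; simpl.
        -- split; [apply Hok2; simpl; auto | auto].
        -- destruct (Hcs c Hc) as [H1 [H2 H3]]; split; [exact H1|]. split; [exact H2 | lra].
    + apply reach_conseq with 0%nat (fun R1 => R1 = (flat T A2 ++ fbag ((p, t) :: Fr) pk2 ++ R2) ++
        flat T A ++ pool_bag cs ++ fbag Fr pk); [lia | apply reach_ret; reflexivity|].
      intros R1 _ ->.
      exists (flat T A3 ++ fbag ((p, t) :: Fr) pk3 ++ R2); split.
      * unfold A3, pk3. rewrite flat_app, fbag_merge by assumption.
        assert (Hb : Permutation (fbag ((p, t) :: Fr) pk) (pool_bag cs ++ fbag Fr pk)).
        { unfold fbag; simpl. rewrite Hpk. apply Permutation_app_tail. apply (merge_all_bag p), Hcok. }
        rewrite Hb. perm_app.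
      * right. exists A3, pk3, R2; split; [reflexivity|]. split; [exact Hfair3|]. split; [exact Hok3|]. split; [exact Hz3|].
        destruct Hout as [[q [s [X [[Hs|Hs] [HX HhX]]]]]|[[b1 [b2 [Hb Hadv]]]|Hdis]].
        -- injection Hs as <- <-. exfalso; eauto.
        -- left. exists q, s. destruct (Hok q s Hs) as [Hl Hv]. destruct (Hok2F q s Hs) as [Hl2 _].
           apply In_nth_error in HX. destruct HX as [k Hk].
           destruct (nth_error (pieces (pk (root s))) k) as [Y|] eqn:HY.
           2:{ apply nth_error_None in HY.
               assert (Hlt : (k < length (pieces (pk2 (root s))))%nat) by (apply nth_error_Some; intros Hn; rewrite Hn in Hk; discriminate).
               unfold bag in *; lia. }
           (* The light piece is merged with an old piece worth at most the old [cap], so the gap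
              does not shrink. *)
           exists (X ++ Y); split; [exact Hs|]. split.
           ++ unfold pk3, merge, zipapp; simpl. apply in_map_iff. exists (X, Y); split; [reflexivity|].
              clear -Hk HY. revert Hk HY. generalize (pieces (pk2 (root s))), (pieces (pk (root s))).
              revert k. induction k as [|k IH]; intros [|x l] [|y l'] H H'; simpl in *; try discriminate.
              ** left; congruence.
              ** right; apply IH; assumption.
           ++ unfold pk3, merge; simpl. rewrite val_app. destruct (Hv Y) as [_ HYb]; [eapply nth_error_In; eauto|].
              apply Rle_trans with (1 := HhX). apply Rmult_le_compat_l; lra.
        -- right; left. exists b1, b2; split; [exact Hb|]. destruct (Hfair b1 b2 Hb) as [_ Hs].
           unfold A3, pk3, merge; simpl. rewrite !val_app. apply Rle_trans with (1 := Hadv). apply Rmult_le_compat_l; lra.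
        -- right; right; exact Hdis.
Qed.

Lemma concat_perm {X} (l l' : list (list X)) : Permutation l l' -> Permutation (concat l) (concat l').
Proof.
  induction 1; simpl; [reflexivity | apply Permutation_app_head; assumption | | etransitivity; eauto].
  rewrite !app_assoc; apply Permutation_app_tail, Permutation_app_comm.
Qed.

Lemma select_bundles p a ts q : packet_ok p (Node a ts) q ->
  exists lam bs, Permutation (concat (pieces q)) (lam ++ concat bs) /\
    Forall2 (fun u b => val u lam <= val u b) (slots ts) bs /\
    (forall b, In b bs -> val a b = val a lam) /\ val a lam = own q /\ val p lam <= cap q.
Proof.
  intros [Hlen Hq]. rewrite slots_length in Hlen.
  destruct (normal_exists val (slots ts) (pieces q) Hlen) as [lam [bs [HP HF]]].
  assert (Hlam : In lam (pieces q)) by (apply (Permutation_in lam (Permutation_sym HP)); simpl; auto).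
  destruct (Hq lam Hlam) as [H1 H2]; simpl in H1.
  exists lam, bs; split; [apply (concat_perm _ _ HP)|]. split; [exact HF|]. split; [|auto].
  intros b Hb. destruct (Hq b) as [H3 _]; [apply (Permutation_in b (Permutation_sym HP)); simpl; auto|].
  simpl in H3; lra.
Qed.

Lemma concat_map_app {X Y} (g h : X -> list Y) l :
  Permutation (concat (map (fun i => g i ++ h i) l)) (concat (map g l) ++ concat (map h l)).
Proof.
  induction l as [|i l IHl]; simpl; [reflexivity|].
  rewrite IHl. rewrite <- !app_assoc. apply Permutation_app_head.
  rewrite !app_assoc. apply Permutation_app_tail, Permutation_app_comm.
Qed.

Lemma transpose_perm {X Y} (f : X -> list (list Y)) m res : (forall x, In x res -> length (f x) = m) ->
  Permutation (concat (map (fun i => concat (map (fun x => nth i (f x) []) res)) (seq 0 m)))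
              (concat (map (fun x => concat (f x)) res)).
Proof.
  induction res as [|x res IH]; intros H; simpl.
  - induction (seq 0 m); simpl; auto.
  - rewrite <- IH by (intros; apply H; simpl; auto).
    assert (Hx : concat (f x) = concat (map (fun i => nth i (f x) []) (seq 0 m))).
    { rewrite <- (H x) by (simpl; auto). f_equal. clear. induction (f x) as [|y l IHl]; simpl; [reflexivity|].
      f_equal. rewrite <- seq_shift, map_map. exact IHl. }
    rewrite Hx. apply concat_map_app.
Qed.

Lemma val_concat_sumf {X} j (f : X -> bag) l : val j (concat (map f l)) = sumf (fun x => val j (f x)) l.
Proof. induction l as [|x l IH]; simpl; [reflexivity|]. rewrite val_app, IH; reflexivity. Qed.

Lemma sumf_perm {X} (f : X -> R) l l' : Permutation l l' -> sumf f l = sumf f l'.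
Proof. induction 1; simpl; lra. Qed.

Lemma sumf_map {X Y} (f : Y -> R) (g : X -> Y) l : sumf f (map g l) = sumf (fun x => f (g x)) l.
Proof. induction l; simpl; congruence. Qed.

Lemma sumf_ext {X} (f g : X -> R) l : (forall x, In x l -> f x = g x) -> sumf f l = sumf g l.
Proof.
  induction l as [|x l IH]; intros H; simpl; [reflexivity|].
  rewrite H, IH; simpl; auto; intros; apply H; simpl; auto.
Qed.

Lemma Forall2_map_seq {X Y} (Q : X -> Y -> Prop) l : forall f : nat -> Y,
  (forall i u, nth_error l i = Some u -> Q u (f i)) -> Forall2 Q l (map f (seq 0 (length l))).
Proof.
  induction l as [|u l IH]; intros f H; simpl; constructor.
  - apply (H 0%nat); reflexivity.
  - rewrite <- seq_shift, map_map. apply IH. intros i v Hv; apply (H (S i)); exact Hv.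
Qed.

(** A bundle takes one piece from every round. Within a round all pieces are equal to [a], so the
    bundles are equal to her however each round is allocated. For [p] each leftover is worth at most
    its [cap], and the forced round saves its gap. *)
Lemma force_bundles p a ts (cs : list (packet * bag)) : length cs = sz (Node a ts) ->
  (forall c, In c cs -> packet_ok p (Node a ts) (fst c) /\ In (snd c) (pieces (fst c))) ->
  exists lam bs, Permutation (pool_bag cs) (lam ++ concat bs) /\
    Forall2 (fun u b => val u lam <= val u b) (slots ts) bs /\
    (forall b, In b bs -> val a b = val a lam) /\ val a lam = sumf (fun c => own (fst c)) cs /\
    exists c, In c cs /\ val p lam <= sumf (fun c => cap (fst c)) cs - (cap (fst c) - val p (snd c)).
Proof.
  intros Hlen Hcs. rewrite slots_length in Hlen.
  destruct (forced_round val [] (fun c => pieces (fst c)) snd (slots ts) cs Hlen) as [res [HP [Hres [[c0 [ps0 Hc0]] Hsum]]]].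
  { intros c Hc. destruct (Hcs c Hc) as [[H1 _] H2]. rewrite slots_length in H1; auto. }
  assert (Hrcs : forall x, In x res -> In (fst x) cs).
  { intros x Hx. apply (Permutation_in _ HP), in_map, Hx. }
  assert (Hpc : forall x P, In x res -> In P (fst (snd x) :: snd (snd x)) ->
            val a P = own (fst (fst x)) /\ val p P <= cap (fst (fst x))).
  { intros [c [lam ps]] P Hx HPin; simpl in *. destruct (Hres _ _ _ Hx) as [HPp _].
    destruct (Hcs c (Hrcs _ Hx)) as [[_ Hq] _]. apply Hq, (Permutation_in P (Permutation_sym HPp)), HPin. }
  exists (concat (map (fun x => fst (snd x)) res)),
    (map (fun i => concat (map (fun x => nth i (snd (snd x)) []) res)) (seq 0 (length (slots ts)))).
  split; [|split; [|split; [|split]]].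
  - rewrite transpose_perm.
    2:{ intros [c [lam ps]] Hx. apply (Hres _ _ _ Hx). }
    unfold pool_bag. rewrite <- (Permutation_flat_map _ HP).
    clear -Hres. induction res as [|[c [lam ps]] res IH]; simpl; [reflexivity|].
    destruct (Hres c lam ps) as [HPp _]; [simpl; auto|].
    rewrite IH by (intros; eapply Hres; simpl; eauto).
    rewrite (concat_perm _ _ HPp). simpl. rewrite <- !app_assoc. apply Permutation_app_head.
    rewrite !app_assoc. apply Permutation_app_tail, Permutation_app_comm.
  - assert (H : forall i u, nth_error (slots ts) i = Some u -> val u (concat (map (fun x => fst (snd x)) res)) <=
       val u (concat (map (fun x => nth i (snd (snd x)) []) res))).
    { intros i u Hu. rewrite !val_concat_sumf. apply (Hsum i u Hu). }
    apply Forall2_map_seq; exact H.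
  - intros b Hb. apply in_map_iff in Hb. destruct Hb as [i [<- Hi]]. apply in_seq in Hi.
    rewrite !val_concat_sumf. apply sumf_ext. intros [c [lam ps]] Hx; simpl.
    destruct (Hres _ _ _ Hx) as [_ Hl].
    destruct (Hpc _ lam Hx) as [-> _]; [simpl; auto|].
    destruct (Hpc _ (nth i ps []) Hx) as [-> _]; [right; apply nth_In; unfold bag in *; simpl in *; lia | reflexivity].
  - rewrite val_concat_sumf, <- (sumf_perm _ _ _ HP), sumf_map. apply sumf_ext.
    intros x Hx. apply Hpc; [exact Hx | left; reflexivity].
  - exists c0. split; [apply (Hrcs _ Hc0)|].
    rewrite val_concat_sumf, <- (sumf_perm _ _ _ HP), sumf_map.
    assert (H : cap (fst c0) - val p (snd c0) <= sumf (fun x => cap (fst (fst x)) - val p (fst (snd x))) res).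
    { apply In_nth_error in Hc0. destruct Hc0 as [k Hk].
      apply (sumf_nonneg_nth (fun x : packet * bag * (bag * list bag) => cap (fst (fst x)) - val p (fst (snd x))) res) with (2 := Hk).
      intros x Hx. destruct (Hpc x (fst (snd x)) Hx) as [_ H]; [left; reflexivity | lra]. }
    rewrite sumf_minus in H. lra.
Qed.

Lemma process_outcome T p a ts Fr A pk Rr B lam bs M ka :
  NoDup (nodes T) -> front_ok T ((p, Node a ts) :: Fr) ->
  fair T A pk -> packets_ok Fr pk -> zero_off ((p, Node a ts) :: Fr) pk ->
  Permutation B (lam ++ concat bs) -> Forall2 (fun u b => val u lam <= val u b) (slots ts) bs ->
  (forall b, In b bs -> val a b = val a lam) -> val a lam = own (pk a) -> val p lam <= cap (pk a) ->
  1 <= ka -> ka ^ (2 * sz T) * n_of T <= M -> outcome T Fr A pk Rr M (2 * ka) ->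
  reach (sz (Node a ts) - 1) (flat T A ++ B ++ fbag Fr pk ++ Rr)
    (staged T (map (pair a) ts ++ Fr) (fun A pk Rr => outcome T (map (pair a) ts ++ Fr) A pk Rr (2 * M) ka)).
Proof.
  intros HN HF Hfair Hok Hz HB Hsl Hb Hown Hcap Hka HM Hout.
  assert (Hlen : length bs = (sz (Node a ts) - 1)%nat).
  { rewrite slots_length. apply Forall2_length in Hsl. unfold bag in *; lia. }
  rewrite <- Hlen.
  assert (Hn1 : 1 <= n_of T) by (unfold n_of; apply (le_INR 1), sz_pos).
  pose proof (pow_R1_Rle ka (2 * sz T) Hka) as Hp1.
  assert (Hlen' : INR (length bs) <= n_of T).
  { unfold n_of; apply le_INR. destruct HF as [Hin _]. destruct (Hin p (Node a ts)) as [Hsub _]; [simpl; auto|].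
    pose proof (sz_pos (Node a ts)).
    pose proof (sub_sz T _ HN Hsub). lia. }
  eapply reach_conseq; [apply Nat.le_refl | eapply (process T p a ts Fr A pk Rr B lam bs); eassumption|].
  intros R' _ [pk' [rho [-> [H1 [H2 [H3 [H4 [H5 H6]]]]]]]].
  exists (flat T (upd A a (A a ++ lam)) ++ fbag (map (pair a) ts ++ Fr) pk' ++ Rr ++ rho); split; [reflexivity|].
  exists (upd A a (A a ++ lam)), pk', (Rr ++ rho); split; [reflexivity|]. repeat (split; [assumption|]).
  apply (outcome_after T p a ts Fr A pk pk' Rr rho lam M ka (n_of T)); try assumption; try nra.
  destruct H6 as [H6|[q [t [X [Hqt [HX HhX]]]]]]; [auto|right].
  exists q, t, X; split; [exact Hqt|]. split; [exact HX|].
  destruct (H2 q t) as [_ Hq]; [apply in_app_iff; auto|]. destruct (Hq X HX) as [_ Hle].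
  apply Rle_trans with (1 := HhX). apply Rmult_le_compat_r; lra.
Qed.

(** The [sz t] repetitions are one round to be forced and one compensating round for each slot. If
    the repetitions stop early, an outcome other than a heavy packet at [t] is at hand, and the
    subtree is served in the ordinary way. *)
Lemma stage_step T p t Fr N M ka : NoDup (nodes T) -> front_ok T ((p, t) :: Fr) ->
  1 <= ka -> ka ^ (2 * sz T) * n_of T <= M -> stage T ((p, t) :: Fr) N M (2 * ka) ->
  match t with Node a ts => stage T (map (pair a) ts ++ Fr) (sz t * N + (sz t - 1)) (2 * M) ka end.
Proof.
  destruct t as [a ts]. intros HN HF Hka HM Hst R.
  assert (Hn1 : 1 <= n_of T) by (unfold n_of; apply (le_INR 1), sz_pos).
  pose proof (pow_R1_Rle ka (2 * sz T) Hka) as Hp1.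
  assert (HM1 : 1 <= M) by nra.
  eapply reach_bind; [apply (collect_loop T p (Node a ts) Fr N M (2 * ka) HF ltac:(lra) Hst (sz (Node a ts)) R)|].
  intros R' _ [[cs [Hlen [A [pk [Rr [-> [Hfair [Hok [Hz [Hpk Hcs]]]]]]]]]]|[A [pk [Rr [-> [Hfair [Hok [Hz Hout]]]]]]]].
  - destruct (force_bundles p a ts cs Hlen) as [lam [bs [HP [Hsl [Hb [Hown [c [Hc Hcap]]]]]]]].
    { intros c Hc; destruct (Hcs c Hc) as [H1 [H2 _]]; auto. }
    destruct (merge_all_sums (sz (Node a ts)) cs) as [Ho Hca]. simpl root in Hpk.
    (* Lowering [cap] to the true worth of [lam] turns the saved gap into an [advantage] of [p] over
       [a]. *)
    set (pk2 := upd pk a (Packet [] (own (pk a)) (val p lam))).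
    destruct (Hcs c Hc) as [[_ Hcq] [Hcin Hflag]]. destruct (Hcq (snd c) Hcin) as [_ Hcle].
    assert (Hle : val p lam <= cap (pk a)) by (rewrite Hpk, Hca; lra).
    destruct HF as [HFin HFN] eqn:HFe; clear HFe.
    destruct (HFin p (Node a ts)) as [_ Hpa]; [simpl; auto|]. simpl in Hpa.
    assert (Haf : forall y, In y (froots Fr) -> y <> a).
    { pose proof (front_roots_NoDup T _ (conj HFin HFN)) as Hnd. inversion Hnd; subst. intros y Hy ->; contradiction. }
    rewrite (fbag_ext Fr pk pk2) by (intros y Hy; unfold pk2; rewrite upd_other; auto).
    apply (process_outcome T p a ts Fr A pk2 Rr (pool_bag cs) lam bs M ka); try assumption; try (split; assumption).
    + intros q y Hqy. destruct (Hfair q y Hqy) as [H1 H2]. unfold pk2.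
      destruct (Nat.eq_dec y a) as [->|Hya]; [|rewrite upd_other; auto].
      assert (q = p) as -> by (eapply unique_parent; eauto).
      rewrite upd_same; simpl. split; [exact H1 | lra].
    + intros q s Hs. unfold pk2; rewrite upd_other; [apply Hok, Hs|]. apply Haf, in_map_iff; exists (q, s); auto.
    + intros y Hy. unfold pk2; rewrite upd_other; [apply Hz, Hy|]. intros ->; apply Hy; simpl; auto.
    + unfold pk2; rewrite upd_same; simpl. rewrite Hown, Hpk, Ho; reflexivity.
    + unfold pk2; rewrite upd_same; simpl; lra.
    + right; left. exists p, a; split; [exact Hpa|]. unfold pk2; rewrite upd_same; simpl.
      destruct (Hfair p a Hpa) as [_ H2]. rewrite Hpk, Hca in H2.
      apply Rle_trans with (1 := Hflag). apply Rmult_le_compat_l; lra.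
  - destruct (select_bundles p a ts (pk a)) as [lam [bs [HP [Hsl [Hb [Hown Hcap]]]]]].
    { apply (Hok p (Node a ts)); simpl; auto. }
    change (fbag ((p, Node a ts) :: Fr) pk) with (concat (pieces (pk a)) ++ fbag Fr pk).
    rewrite <- app_assoc.
    apply (process_outcome T p a ts Fr A pk Rr (concat (pieces (pk a))) lam bs M ka); try assumption.
    intros q s Hs; apply Hok; simpl; auto.
Qed.

(** * The first round and the chain of all stages *)

Lemma kids_front a ts : NoDup (nodes (Node a ts)) ->
  front_ok (Node a ts) (map (pair a) ts) /\ NoDup (map root ts) /\ ~ In a (map root ts) /\
  length (flat_map (fun x => nodes (snd x)) (map (pair a) ts)) = (sz (Node a ts) - 1)%nat.
Proof.
  intros HN. pose proof (kids_nodes a ts) as Hflat.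
  assert (HF : front_ok (Node a ts) (map (pair a) ts)).
  { split.
    - intros p t Ht. apply in_map_iff in Ht. destruct Ht as [t' [Heq Ht]]. injection Heq as <- <-.
      split; [econstructor; [constructor | exact Ht] | apply sub_edge with ts; [constructor | exact Ht]].
    - rewrite Hflat. inversion HN; assumption. }
  split; [exact HF|]. split; [|split].
  - rewrite <- (froots_kids a). eapply front_roots_NoDup; exact HF.
  - intros Ha. apply in_map_iff in Ha. destruct Ha as [t [Heq Ht]]. inversion HN as [|? ? Hnin]; subst.
    apply Hnin, in_flat_map. exists t; split; [exact Ht | apply root_in_nodes].
  - rewrite Hflat. unfold sz; simpl; lia.
Qed.

Lemma flat_single T r lam : NoDup (nodes T) -> In r (nodes T) -> Permutation (flat T (upd (fun _ => []) r lam)) lam.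
Proof. intros HN Hr. pose proof (flat_upd T (fun _ => []) r lam HN Hr) as H. rewrite flat_nil in H; exact H. Qed.

Definition start (T : tree) (R : bag) (A : nat -> bag) (pk : nat -> packet) (Rr : bag) : Prop :=
  match T with Node r ts =>
    val r (A r) * n_of T = val r R /\
    ((forall j, val j Rr = 0) \/ heavy_packet (map (pair r) ts) pk Rr (n_of T)) /\
    (forall t, In t ts -> val r (A r) - val r (A (root t)) - cap (pk (root t)) = 0)
  end.

Lemma root_round r ts R : let T := Node r ts in NoDup (nodes T) ->
  reach (2 * (sz T - 1)) R (staged T (map (pair r) ts) (start T R)).
Proof.
  intros T HN. destruct (kids_front r ts HN) as [HF [HNr [Hr _]]].
  assert (Hsz : sz T = S (length (slots ts))) by apply slots_length.
  replace (2 * (sz T - 1))%nat with (length (slots ts) + (length (slots ts) + 0))%nat by lia.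
  eapply reach_bind; [apply (reach_cut_equal r)|].
  intros R' HR' [ps [-> [Hlen Hps]]].
  destruct (normal_exists val (slots ts) ps Hlen) as [lam [bs [HP HFb]]].
  assert (Hn : 0 < n_of T) by (apply (lt_INR 0), sz_pos).
  assert (Heq : forall p, In p ps -> val r p * n_of T = val r R).
  { intros p Hp. unfold n_of; rewrite Hsz; auto. }
  assert (Hb : forall b, In b bs -> val r b = val r lam).
  { intros b Hb. apply Rmult_eq_reg_r with (n_of T); [|lra].
    rewrite !Heq; auto; apply (Permutation_in _ (Permutation_sym HP)); simpl; auto. }
  pose proof (Forall2_length HFb) as Hl. rewrite Hl at 1.
  eapply (reach_on (length bs) 0 _ (concat bs) lam).
  { rewrite (concat_perm _ _ HP). simpl. apply Permutation_app_comm. }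
  { apply (distribute r ts lam bs HNr HFb Hb). }
  intros X' HX' [pk [rho [-> [Hok [Hz Hval]]]]].
  apply reach_conseq with 0%nat (fun R1 => R1 = (fbag (map (pair r) ts) pk ++ rho) ++ lam);
    [lia | apply reach_ret; reflexivity|].
  intros R1 _ ->. set (A := upd (fun _ => []) r lam : nat -> bag).
  assert (HAr : A r = lam) by apply upd_same.
  assert (HAo : forall y, y <> r -> A y = []) by (intros y Hy; unfold A; rewrite upd_other; auto).
  assert (Hkr : forall t, In t ts -> root t <> r).
  { intros t Ht Heq'; apply Hr; rewrite <- Heq'; apply in_map, Ht. }
  exists (flat T A ++ fbag (map (pair r) ts) pk ++ rho); split.
  { unfold A. rewrite (flat_single T r lam HN) by (simpl; auto). apply Permutation_app_comm. }
  exists A, pk, rho. split; [reflexivity|]. split; [|split; [exact Hok|split; [exact Hz|]]].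
  - intros p y Hpy. assert (Hyr : y <> r) by (intros ->; apply (edge_not_root T p HN Hpy)).
    rewrite (HAo y Hyr), !val_nil. destruct (Nat.eq_dec p r) as [->|Hp].
    + destruct (sub_edge_inv T r ts y HN (sub_refl T) Hpy) as [t [Ht ->]].
      destruct (Hval t Ht) as [-> ->]. rewrite HAr. lra.
    + rewrite (HAo p Hp), !val_nil. destruct (Hz y) as [-> ->]; [|lra].
      rewrite froots_kids; intros Hy. apply in_map_iff in Hy. destruct Hy as [t [<- Ht]].
      apply Hp. eapply unique_parent; [exact HN | exact Hpy | eapply sub_edge; [constructor | exact Ht]].
  - simpl. rewrite HAr. split; [apply Heq, (Permutation_in _ (Permutation_sym HP)); simpl; auto|]. split.
    + destruct (kids_heavy r ts lam bs pk rho Hb) as [H|[t [X [Ht [HX H]]]]]; auto.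
      right. exists r, t, X. split; [apply in_map, Ht|]. split; [exact HX|].
      destruct (Hval t Ht) as [_ ->]. apply Rle_trans with (1 := H).
      destruct (Hok r t (in_map _ _ _ Ht)) as [_ Hq]. destruct (Hq X HX) as [_ Hle].
      destruct (Hval t Ht) as [_ Hc]; rewrite Hc in Hle.
      apply Rmult_le_compat_r; [lra|]. apply le_INR. fold T. lia.
    + intros t Ht. rewrite (HAo _ (Hkr t Ht)), val_nil. destruct (Hval t Ht) as [_ ->]. lra.
Qed.

Lemma stage_start r ts M ka : let T := Node r ts in NoDup (nodes T) -> ts <> [] -> n_of T <= M ->
  stage T (map (pair r) ts) (2 * (sz T - 1)) M ka.
Proof.
  intros T HN Hts HM R. eapply reach_conseq; [apply Nat.le_refl | apply (root_round r ts R HN)|].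
  intros R' _ [A [pk [Rr [-> [Hfair [Hok [Hz [_ [Hheavy Hedge]]]]]]]]].
  exists (flat T A ++ fbag (map (pair r) ts) pk ++ Rr); split; [reflexivity|].
  exists A, pk, Rr. repeat (split; [assumption || reflexivity|]).
  destruct Hheavy as [H0|[p [t [X [Hpt [HX H]]]]]].
  (* The residue is worthless to everybody, so an advantage of 0 over any child is enough; this
     requires a child. *)
  - right; left. destruct ts as [|t ts]; [congruence|]. exists r, (root t); split; [simpl; auto|].
    rewrite H0, (Hedge t) by (simpl; auto). lra.
  - left. exists p, t, X; split; [exact Hpt|]. split; [exact HX|]. apply Rle_trans with (1 := H).
    destruct (Hok p t Hpt) as [_ Hq]. destruct (Hq X HX) as [_ Hle]. apply Rmult_le_compat_r; [lra | exact HM].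
Qed.

(** Here [m] counts the agents still to be served, and each step serves one. A step with a subtree
    of [s <= m] agents turns [N + 1] into [s * N + (s - 1) + 1 = s * (N + 1)], whence the factorial.
    The [m] halvings of the ratio and doublings of [M] account for the powers of 2. *)
Lemma stage_all T : NoDup (nodes T) -> forall m Fr N M ka, front_ok T Fr ->
  length (flat_map (fun x => nodes (snd x)) Fr) = m -> 1 <= ka -> (2 ^ m * ka) ^ (2 * sz T) * n_of T <= M ->
  stage T Fr N M (2 ^ m * ka) -> exists N', (N' + 1 <= fact m * (N + 1))%nat /\ stage T [] N' (2 ^ m * M) ka.
Proof.
  intros HN; induction m as [|m IH]; intros Fr N M ka HF Hm Hka HM Hst.
  - destruct Fr as [|[p [a ts]] Fr]; [|discriminate]. exists N; split; [simpl; lia|].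
    simpl in *. rewrite !Rmult_1_l in *. exact Hst.
  - destruct Fr as [|[p [a ts]] Fr]; [discriminate|].
    assert (H2m : 1 <= 2 ^ m) by (apply pow_R1_Rle; lra).
    assert (Hka' : 1 <= 2 ^ m * ka) by nra.
    assert (Hn0 : 0 <= n_of T) by apply pos_INR.
    assert (HM' : (2 ^ m * ka) ^ (2 * sz T) * n_of T <= M).
    { apply Rle_trans with (2 := HM). apply Rmult_le_compat_r; [exact Hn0|].
      apply pow_incr. simpl; split; nra. }
    assert (HM0 : 0 <= M).
    { apply Rle_trans with (2 := HM'). apply Rmult_le_pos; [apply pow_le; lra | exact Hn0]. }
    destruct (front_step _ _ _ _ _ HN HF) as [HF' _].
    pose proof (stage_step T p (Node a ts) Fr N M (2 ^ m * ka) HN HF Hka' HM') as Hs.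
    replace (2 * (2 ^ m * ka)) with (2 ^ S m * ka) in Hs by (simpl; ring). specialize (Hs Hst); cbv beta iota in Hs.
    destruct (IH (map (pair a) ts ++ Fr) (sz (Node a ts) * N + (sz (Node a ts) - 1))%nat (2 * M) ka HF') with (4 := Hs) as [N' [HN' HS']]; [|exact Hka|lra|].
    { simpl in Hm. rewrite flat_map_app, kids_nodes. injection Hm as <-. rewrite !length_app. reflexivity. }
    exists N'; split; [|replace (2 ^ S m * M) with (2 ^ m * (2 * M)) by (simpl; ring); exact HS'].
    apply Nat.le_trans with (1 := HN'). change (fact (S m)) with (S m * fact m)%nat.
    assert (Hsz : (sz (Node a ts) <= S m)%nat).
    { rewrite <- Hm. unfold sz; simpl. rewrite length_app; lia. }
    pose proof (sz_pos (Node a ts)).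
    replace (sz (Node a ts) * N + (sz (Node a ts) - 1) + 1)%nat with (sz (Node a ts) * (N + 1))%nat by nia.
    rewrite (Nat.mul_comm (S m)), <- Nat.mul_assoc. apply Nat.mul_le_mono_l, Nat.mul_le_mono_r, Hsz.
Qed.

(** * Polynomial rounds that shrink the residue *)

Definition ef (T : tree) (A : nat -> bag) : Prop := forall u v, adj T u v -> val u (A v) <= val u (A u).

Lemma fair_ef T A pk : fair T A pk -> zero_off [] pk -> ef T A.
Proof.
  intros Hf Hz u v [H|H]; destruct (Hf _ _ H) as [H1 H2]; destruct (Hz v) as [Ho Hc]; try (intros []);
    destruct (Hz u) as [Ho' Hc']; try (intros []); lra.
Qed.

Lemma ef_add T A B : ef T A -> ef T B -> ef T (fun i => A i ++ B i).
Proof. intros HA HB u v H. specialize (HA u v H); specialize (HB u v H). rewrite !val_app; lra. Qed.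

Lemma val_flat_ge T A i j : In i (nodes T) -> val j (A i) <= val j (flat T A).
Proof.
  unfold flat; induction (nodes T) as [|x l IH]; intros [].
  - subst x; simpl. rewrite val_app. pose proof (val_nonneg j (flat_map A l)); lra.
  - simpl. rewrite val_app. pose proof (val_nonneg j (A x)). specialize (IH H). lra.
Qed.

(** Without repeated stages no outcome is tracked and everybody is served with polynomially many
    cuts; the trimmings are simply left over. *)
Lemma process_all T : NoDup (nodes T) -> forall m Fr A pk Rr, front_ok T Fr ->
  length (flat_map (fun x => nodes (snd x)) Fr) = m -> fair T A pk -> packets_ok Fr pk -> zero_off Fr pk ->
  reach (m * sz T) (flat T A ++ fbag Fr pk ++ Rr) (fun R' => exists A' Rr', R' = flat T A' ++ Rr' /\ ef T A' /\
    forall i j, val j (A i) <= val j (A' i)).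
Proof.
  intros HN; induction m as [|m IH]; intros Fr A pk Rr HF Hm Hf Hok Hz.
  - destruct Fr as [|[p [a ts]] Fr]; [|discriminate]. apply reach_ret. exists A, Rr; split; [reflexivity|].
    split; [eapply fair_ef; eauto | intros; lra].
  - destruct Fr as [|[p [a ts]] Fr]; [discriminate|].
    destruct (select_bundles p a ts (pk a)) as [lam [bs [HP [Hsl [Hb [Hown Hcap]]]]]].
    { apply (Hok p (Node a ts)); simpl; auto. }
    change (fbag ((p, Node a ts) :: Fr) pk) with (concat (pieces (pk a)) ++ fbag Fr pk). rewrite <- (app_assoc (concat _)).
    assert (Hlen : (length bs <= sz T)%nat).
    { pose proof (slots_length a ts). apply Forall2_length in Hsl. unfold bag in *.
      destruct HF as [Hin _]. destruct (Hin p (Node a ts)) as [Hsub _]; [simpl; auto|].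
      pose proof (sub_sz T _ HN Hsub). lia. }
    replace (S m * sz T)%nat with (sz T + m * sz T)%nat by lia.
    eapply reach_bind.
    { eapply reach_conseq; [exact Hlen|..].
      - apply (process T p a ts Fr A pk Rr (concat (pieces (pk a))) lam bs); try assumption.
        intros q s Hs; apply Hok; simpl; auto.
      - intros R' _ H; exists R'; split; [reflexivity | exact H]. }
    intros R' _ [pk' [rho [-> [Hf' [Hok' [Hz' _]]]]]].
    destruct (front_step _ _ _ _ _ HN HF) as [HF' _].
    eapply reach_conseq; [apply Nat.le_refl | apply (IH (map (pair a) ts ++ Fr) (upd A a (A a ++ lam)) pk' (Rr ++ rho) HF')|];
      try assumption.
    { simpl in Hm. rewrite flat_map_app, kids_nodes. injection Hm as <-. rewrite !length_app. reflexivity. }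
    intros R' _ [A' [Rr' [-> [H1 H2]]]]. exists (flat T A' ++ Rr'); split; [reflexivity|].
    exists A', Rr'; split; [reflexivity|]. split; [exact H1|]. intros i j. apply Rle_trans with (2 := H2 i j).
    unfold upd. destruct (Nat.eq_dec i a) as [->|]; [|lra]. rewrite val_app. pose proof (val_nonneg j lam); lra.
Qed.

Definition round_cost (n : nat) : nat := (n * n + n)%nat.

Lemma round T R : NoDup (nodes T) -> reach (round_cost (sz T)) R (fun R' => exists A Rr, R' = flat T A ++ Rr /\
  ef T A /\ val (root T) R <= n_of T * val (root T) (A (root T))).
Proof.
  destruct T as [r ts]; intros HN. set (T := Node r ts) in *.
  apply reach_conseq with (2 * (sz T - 1) + (sz T - 1) * sz T)%nat (fun R' => exists A Rr, R' = flat T A ++ Rr /\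
    ef T A /\ val r R <= n_of T * val r (A r)).
  - unfold round_cost. pose proof (sz_pos T). nia.
  - destruct (kids_front r ts HN) as [HF [_ [_ Hlen]]]. eapply reach_bind; [apply (root_round r ts R HN)|].
    intros R' _ [A [pk [Rr [-> [Hf [Hok [Hz [Hval _]]]]]]]].
    eapply reach_conseq; [apply Nat.le_refl | apply (process_all T HN _ (map (pair r) ts) A pk Rr HF Hlen Hf Hok Hz)|].
    intros R' _ [A' [Rr' [-> [H1 H2]]]]. exists (flat T A' ++ Rr'); split; [reflexivity|].
    exists A', Rr'; split; [reflexivity|]. split; [exact H1|].
    fold T in Hval. rewrite <- Hval, Rmult_comm. apply Rmult_le_compat_l; [apply pos_INR | apply H2].
  - intros R' _ H; exists R'; split; [reflexivity | exact H].
Qed.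

Lemma flat_same T T' A : same_tree T T' -> Permutation (flat T A) (flat T' A).
Proof. intros [H _]. apply Permutation_flat_map, H. Qed.

(** With [a] as root she gets at least 1/n, which leaves (n-1)/n; the weaker factor n/(n+1) is the
    one that iterates well. *)
Lemma round_for T a R : NoDup (nodes T) -> In a (nodes T) ->
  reach (round_cost (sz T)) R (fun R' => exists A Rr, R' = flat T A ++ Rr /\ ef T A /\
    (n_of T + 1) * val a Rr <= n_of T * val a R).
Proof.
  intros HN Ha. destruct (reroot T a Ha) as [T' [Hr Hs]].
  assert (HN' : NoDup (nodes T')) by (eapply Permutation_NoDup; [apply Hs | exact HN]).
  assert (Hsz : sz T' = sz T) by (symmetry; apply Permutation_length, Hs).
  rewrite <- Hsz. eapply reach_conseq; [apply Nat.le_refl | apply (round T' R HN')|].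
  intros R' HR' [A [Rr [-> [H1 H2]]]]. exists (flat T A ++ Rr); split.
  { apply Permutation_app_tail, Permutation_sym, flat_same, Hs. }
  exists A, Rr; split; [reflexivity|]. split; [intros u v Huv; apply H1, Hs, Huv|].
  specialize (HR' a). rewrite val_app in HR'. rewrite Hr in H2. unfold n_of in *; rewrite Hsz in H2.
  assert (Hge : val a (A a) <= val a (flat T' A)) by (apply val_flat_ge; rewrite <- Hr; apply root_in_nodes).
  pose proof (pos_INR (sz T)). pose proof (val_nonneg a Rr).
  assert (INR (sz T) * val a (A a) <= INR (sz T) * val a (flat T' A)) by (apply Rmult_le_compat_l; lra).
  pose proof (val_nonneg a (A a)). nra.
Qed.

(** By Bernoulli's inequality (1 + 1/n)^k is at least 1 + k/n. In particular [n] rounds halve the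
    residue for [a]. *)
Lemma rounds T a : NoDup (nodes T) -> In a (nodes T) -> forall k R,
  reach (k * round_cost (sz T)) R (fun R' => exists A Rr, R' = flat T A ++ Rr /\ ef T A /\
    (n_of T + INR k) * val a Rr <= n_of T * val a R).
Proof.
  intros HN Ha; induction k as [|k IH]; intros R.
  - apply reach_ret. exists (fun _ => []), R. rewrite flat_nil. split; [reflexivity|]. split.
    + intros u v _; rewrite !val_nil; lra.
    + simpl; lra.
  - replace (S k * round_cost (sz T))%nat with (k * round_cost (sz T) + (round_cost (sz T) + 0))%nat by lia.
    eapply reach_bind; [apply IH|]. intros R' _ [A [Rr [-> [H1 H2]]]].
    eapply (reach_on _ 0 _ Rr (flat T A)); [apply Permutation_app_comm | apply (round_for T a Rr HN Ha)|].
    intros X' _ [B [Rr' [-> [H3 H4]]]].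
    apply reach_conseq with 0%nat (fun R1 => R1 = (flat T B ++ Rr') ++ flat T A); [lia | apply reach_ret; reflexivity|].
    intros R1 _ ->. exists (flat T (fun i => A i ++ B i) ++ Rr'); split; [rewrite flat_app; perm_app|].
    exists (fun i => A i ++ B i), Rr'; split; [reflexivity|]. split; [apply ef_add; assumption|].
    rewrite S_INR. assert (Hn : 0 < n_of T) by (apply (lt_INR 0), sz_pos).
    pose proof (pos_INR k). pose proof (val_nonneg a Rr').
    apply Rmult_le_reg_l with (n_of T); [exact Hn|].
    assert ((n_of T + INR k) * ((n_of T + 1) * val a Rr') <= (n_of T + INR k) * (n_of T * val a Rr))
      by (apply Rmult_le_compat_l; lra). nra.
Qed.

Definition shrink_cost (n e : nat) : nat := (e * (n * round_cost n))%nat.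

Lemma shrink T a e R : NoDup (nodes T) -> In a (nodes T) ->
  reach (shrink_cost (sz T) e) R (fun R' => exists A Rr, R' = flat T A ++ Rr /\ ef T A /\
    2 ^ e * val a Rr <= val a R).
Proof.
  intros HN Ha; revert R; unfold shrink_cost; induction e as [|e IH]; intros R.
  - apply reach_ret. exists (fun _ => []), R. rewrite flat_nil. split; [reflexivity|]. split.
    + intros u v _; rewrite !val_nil; lra.
    + simpl; lra.
  - replace (S e * (sz T * round_cost (sz T)))%nat
      with (e * (sz T * round_cost (sz T)) + (sz T * round_cost (sz T) + 0))%nat by lia.
    eapply reach_bind; [apply IH|]. intros R' _ [A [Rr [-> [H1 H2]]]].
    eapply (reach_on _ 0 _ Rr (flat T A)); [apply Permutation_app_comm | apply (rounds T a HN Ha)|].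
    intros X' _ [B [Rr' [-> [H3 H4]]]].
    apply reach_conseq with 0%nat (fun R1 => R1 = (flat T B ++ Rr') ++ flat T A); [lia | apply reach_ret; reflexivity|].
    intros R1 _ ->. exists (flat T (fun i => A i ++ B i) ++ Rr'); split; [rewrite flat_app; perm_app|].
    exists (fun i => A i ++ B i), Rr'; split; [reflexivity|]. split; [apply ef_add; assumption|].
    fold (n_of T) in H4. assert (Hn : 0 < n_of T) by (apply (lt_INR 0), sz_pos).
    assert (H5 : 2 * val a Rr' <= val a Rr) by (apply Rmult_le_reg_l with (n_of T); [exact Hn | lra]).
    apply Rle_trans with (2 := H2). simpl. assert (0 <= 2 ^ e) by (apply pow_le; lra). nra.
Qed.

(** * Trading and absorbing the residue *)

Lemma dyadic B x : 1 <= x <= 2 ^ B -> exists L, (L <= B)%nat /\ x <= 2 ^ L <= 2 * x.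
Proof.
  induction B as [|B IH]; intros Hx.
  - exists 0%nat; simpl in *; split; [lia | lra].
  - destruct (Rle_lt_dec x (2 ^ B)) as [H|H].
    + destruct IH as [L [HL H']]; [lra|]. exists L; split; [lia | exact H'].
    + exists (S B); simpl in *; split; [lia | lra].
Qed.

Lemma INR_lt_pow2 n : INR n + 1 <= 2 ^ n.
Proof. induction n as [|n IH]; [simpl; lra|]. rewrite S_INR. simpl. pose proof (pos_INR n). lra. Qed.

Definition glue (t : tree) (A B : nat -> bag) : nat -> bag :=
  fun i => if in_dec Nat.eq_dec i (nodes t) then A i else B i.

Lemma glue_in t A B i : In i (nodes t) -> glue t A B i = A i.
Proof. unfold glue; destruct (in_dec Nat.eq_dec i (nodes t)); tauto. Qed.

Lemma glue_out t A B i : ~ In i (nodes t) -> glue t A B i = B i.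
Proof. unfold glue; destruct (in_dec Nat.eq_dec i (nodes t)); tauto. Qed.

Lemma flat_map_ext_in {X Y} (f g : X -> list Y) l : (forall x, In x l -> f x = g x) -> flat_map f l = flat_map g l.
Proof. induction l as [|x l IH]; intros H; simpl; [reflexivity|]. rewrite H, IH; simpl; auto; intros; apply H; simpl; auto. Qed.

Lemma flat_glue T ta tb A B : NoDup (nodes T) -> Permutation (nodes T) (nodes ta ++ nodes tb) ->
  Permutation (flat T (glue ta A B)) (flat ta A ++ flat tb B).
Proof.
  intros HN HP. unfold flat. rewrite (Permutation_flat_map _ HP), flat_map_app.
  apply (Permutation_NoDup HP) in HN. apply NoDup_app_iff in HN. destruct HN as [_ [_ Hd]].
  rewrite (flat_map_ext_in _ A (nodes ta)), (flat_map_ext_in _ B (nodes tb)); [reflexivity|..]; intros x Hx.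
  - apply glue_out. intros Hx'; apply (Hd x Hx' Hx).
  - apply glue_in, Hx.
Qed.

(** The guarantee for the root belongs to the induction hypothesis: in a trade the ends of the
    removed edge are the roots of the two components and need a definite share. *)
Definition divisible (T : tree) (c : nat) : Prop :=
  forall R, reach c R (fun R' => exists A, R' = flat T A /\ ef T A /\ val (root T) R <= n_of T * val (root T) (A (root T))).

Definition leaning (T : tree) (e : nat) (R' : bag) : Prop :=
  exists A Rr a b, R' = flat T A ++ Rr /\ ef T A /\ adj T a b /\ val a Rr <= 2 ^ e * (val a (A a) - val a (A b)).

(* Agent [a]'s component divides [rho]; [b]'s component divides a part of [rho'] that is negligible to [a] but
   still worth more to [b] than [rho]. *)
Lemma trade T Rr d c : NoDup (nodes T) ->
  (forall t, NoDup (nodes t) -> (sz t < sz T)%nat -> divisible t c) ->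
  disagreement T Rr (2 ^ d) (2 ^ (2 * sz T + 2)) ->
  reach ((d + sz T + 1) + 2 * c) Rr (leaning T (d + sz T + 1)).
Proof.
  intros HN Hdiv [a [b [rho [rho' [s [Hab [HP [[Hs1 Hs2] [Ha Hb]]]]]]]]].
  destruct (split_edge T a b HN Hab) as [ta [tb [Hra [Hrb [HPt Hedges]]]]].
  pose proof (Permutation_NoDup HPt HN) as HN'. apply NoDup_app_iff in HN'. destruct HN' as [HNa [HNb Hdisj]].
  assert (Hsz : (sz T = sz ta + sz tb)%nat).
  { unfold sz. rewrite (Permutation_length HPt), length_app; reflexivity. }
  pose proof (sz_pos ta) as Hpa. pose proof (sz_pos tb) as Hpb.
  assert (Hna : n_of ta <= n_of T) by (apply le_INR; lia).
  assert (Hnb : n_of tb <= n_of T) by (apply le_INR; lia).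
  assert (Hn1 : 1 <= n_of T) by (apply (le_INR 1); lia).
  set (n := n_of T) in *.
  pose proof (INR_lt_pow2 (sz T)) as Hpow. fold (n_of T) in Hpow; fold n in Hpow.
  (* From [2 * n * s <= 2 ^ L] the part [Y] is worth to [a] at most 1/(2n) of [rho], half of her
     guaranteed share. From [2 ^ L <= 4 * n * s] it keeps enough worth for [b]. *)
  destruct (dyadic (d + sz T + 1) (2 * n * s)) as [L [HL [HL1 HL2]]].
  { split; [nra|]. rewrite !pow_add. simpl. assert (n * s <= 2 ^ sz T * 2 ^ d) by (apply Rmult_le_compat; lra). nra. }
  assert (Hia : In a (nodes ta)) by (rewrite <- Hra; apply root_in_nodes).
  assert (Hib : In b (nodes tb)) by (rewrite <- Hrb; apply root_in_nodes).
  apply reach_conseq with (L + (c + (c + 0)))%nat (leaning T (d + sz T + 1));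
    [lia| |intros R' _ H; exists R'; split; [reflexivity | exact H]].
  apply (reach_on L _ Rr rho' rho _ _ (Permutation_trans HP (Permutation_app_comm _ _)) (reach_halve a b L rho')).
  intros X' HX' [Y [Z [-> [HYb HYa]]]].
  eapply (reach_on c _ _ rho (Y ++ Z)); [apply Permutation_app_comm | apply (Hdiv ta HNa ltac:(lia))|].
  intros X1 HX1 [A1 [-> [Hef1 Hpr1]]].
  eapply (reach_on c 0 _ Y (flat ta A1 ++ Z)); [perm_app | apply (Hdiv tb HNb ltac:(lia))|].
  intros X2 HX2 [A2 [-> [Hef2 Hpr2]]].
  apply reach_conseq with 0%nat (fun R1 => R1 = flat tb A2 ++ flat ta A1 ++ Z); [lia | apply reach_ret; reflexivity|].
  intros R1 _ ->. exists (flat T (glue ta A1 A2) ++ Z); split.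
  { rewrite (flat_glue T ta tb A1 A2 HN HPt). perm_app. }
  rewrite Hra in Hpr1; rewrite Hrb in Hpr2.
  assert (Hga : glue ta A1 A2 a = A1 a) by (apply glue_in, Hia).
  assert (Hgb : glue ta A1 A2 b = A2 b) by (apply glue_out; intros H; apply (Hdisj b H Hib)).
  pose proof (val_perm a _ _ HP) as HPa. pose proof (val_perm b _ _ HP) as HPb. rewrite val_app in HPa, HPb.
  pose proof (val_nonneg a rho) as P1. pose proof (val_nonneg a rho') as P2.
  pose proof (val_nonneg b rho) as P3. pose proof (val_nonneg b rho') as P4.
  pose proof (val_nonneg a Y) as P5. pose proof (val_nonneg b Y) as P6. pose proof (val_nonneg a Z) as P7.
  pose proof (val_nonneg a (A1 a)) as P8. pose proof (val_nonneg b (A2 b)) as P9.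
  assert (HA2a : val a (A2 b) <= val a Y) by (rewrite <- (HX2 a); apply val_flat_ge, Hib).
  assert (HA1b : val b (A1 a) <= val b rho) by (rewrite <- (HX1 b); apply val_flat_ge, Hia).
  assert (HZa : val a Z <= val a rho') by (rewrite <- (HX' a), val_app; lra).
  assert (H2L : 1 <= 2 ^ L) by (apply pow_R1_Rle; lra).
  assert (Hown : val a rho <= n * val a (A1 a)).
  { apply Rle_trans with (1 := Hpr1), Rmult_le_compat_r; assumption. }
  assert (HYs : 2 * n * val a Y <= val a rho).
  { apply Rmult_le_reg_l with s; [lra|].
    assert (val a Y * (2 * n * s) <= val a Y * 2 ^ L) by (apply Rmult_le_compat_l; lra). lra. }
  assert (Hslack : val a rho <= 2 * n * (val a (A1 a) - val a (A2 b))) by nra.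
  assert (Hs0 : 0 <= val a (A1 a) - val a (A2 b)) by nra.
  exists (glue ta A1 A2), Z, a, b; split; [reflexivity|]. split; [|split; [exact Hab|]].
  - intros u v Huv. destruct (Hedges u v Huv) as [H|[H|[[-> ->]|[-> ->]]]].
    + destruct (adj_nodes _ _ _ H) as [Hu Hv]. rewrite !glue_in by assumption. apply Hef1, H.
    + destruct (adj_nodes _ _ _ H) as [Hu Hv]. rewrite !glue_out by (intros H'; eapply Hdisj; eauto). apply Hef2, H.
    + rewrite Hga, Hgb. lra.
    + rewrite Hga, Hgb. apply Rle_trans with (1 := HA1b).
      (* [b] receives at least 1/(4 n^2 s) of [rho'], so to cover [rho] she needs [rho'] to be worth
         4 n^2 s times as much; the additional 1 allows for [rho] itself being part of [Rr]. *)
      assert (Hk : 4 * (n * n) + 1 <= 2 ^ (2 * sz T + 2)).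
      { replace (2 ^ (2 * sz T + 2)) with (4 * (2 ^ sz T * 2 ^ sz T))
          by (rewrite pow_add, pow_mult; simpl; rewrite Rmult_1_r, Rpow_mult_distr; ring).
        assert ((n + 1) * (n + 1) <= 2 ^ sz T * 2 ^ sz T) by (apply Rmult_le_compat; lra). nra. }
      assert (Hown2 : val b Y <= n * val b (A2 b)).
      { apply Rle_trans with (1 := Hpr2), Rmult_le_compat_r; assumption. }
      assert (Hr1 : (4 * (n * n) + 1) * s * val b rho <= val b rho + val b rho').
      { rewrite <- HPb. apply Rle_trans with (2 := Hb). apply Rmult_le_compat_r; [exact P3|]. apply Rmult_le_compat_r; lra. }
      assert (Hr2 : val b rho' <= n * val b (A2 b) * (4 * n * s)).
      { rewrite <- HYb. apply Rmult_le_compat; [exact P6 | lra | exact Hown2 | lra]. }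
      apply Rmult_le_reg_l with (4 * n * n * s); [|].
      { repeat apply Rmult_lt_0_compat; lra. }
      assert (val b rho <= s * val b rho) by nra. lra.
  - rewrite Hga, Hgb. apply Rle_trans with (s * val a rho); [lra|].
    apply Rle_trans with (s * (2 * n * (val a (A1 a) - val a (A2 b)))); [apply Rmult_le_compat_l; lra|].
    apply Rle_trans with (2 ^ L * (val a (A1 a) - val a (A2 b))).
    + replace (s * (2 * n * (val a (A1 a) - val a (A2 b)))) with (2 * n * s * (val a (A1 a) - val a (A2 b))) by ring.
      apply Rmult_le_compat_r; assumption.
    + apply Rmult_le_compat_r; [exact Hs0|]. apply Rle_pow; [lra | exact HL].
Qed.

(** The n-1 services start from the ratio 2^(n-1) 2^(2n+2), whose power 2n, times [n], is at most
    2^(2n(3n+2)+n). Doubling this n-1 times stays below 2^(6 n^2 + 6n). *)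
Definition stage_exp (n : nat) : nat := (6 * (n * n) + 6 * n)%nat.

Lemma settle T R : NoDup (nodes T) -> (2 <= sz T)%nat -> reach (2 * fact (sz T)) R (fun R' =>
  exists A Rr, R' = flat T A ++ Rr /\ ef T A /\
    (leaning T (stage_exp (sz T)) R' \/ disagreement T Rr (2 ^ stage_exp (sz T)) (2 ^ (2 * sz T + 2)))).
Proof.
  destruct T as [r ts]; intros HN Hsz. set (T := Node r ts) in *.
  destruct (kids_front r ts HN) as [HF [_ [_ Hlen]]]. fold T in HF, Hlen.
  assert (Hts : ts <> []) by (intros H; unfold T in Hsz; rewrite H in Hsz; unfold sz in Hsz; simpl in Hsz; lia).
  set (n := sz T) in *. set (M := 2 ^ (2 * n * (3 * n + 2) + n)).
  assert (Hn2 : n_of T <= 2 ^ n) by (pose proof (INR_lt_pow2 n); unfold n_of; fold n; lra).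
  assert (HnM : n_of T <= M) by (apply Rle_trans with (1 := Hn2), Rle_pow; [lra | lia]).
  assert (Hka : 1 <= 2 ^ (2 * n + 2)) by (apply pow_R1_Rle; lra).
  destruct (stage_all T HN (n - 1) (map (pair r) ts) (2 * (n - 1)) M (2 ^ (2 * n + 2)) HF Hlen Hka) as [N [HN1 Hst]].
  - unfold M. rewrite <- pow_add, <- pow_mult, pow_add. fold n. apply Rmult_le_compat; [apply pow_le; lra | apply pos_INR | | exact Hn2].
    apply Rle_pow; [lra | nia].
  - apply (stage_start r ts M _ HN Hts HnM).
  - assert (HNf : (N <= 2 * fact n)%nat).
    { clear -HN1 Hsz. destruct n as [|m]; [lia|]. replace (S m - 1)%nat with m in HN1 by lia.
      change (fact (S m)) with (S m * fact m)%nat. nia. }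
    assert (HM : 2 ^ (n - 1) * M <= 2 ^ stage_exp n).
    { unfold M, stage_exp. rewrite <- pow_add. apply Rle_pow; [lra | nia]. }
    assert (HM0 : 1 <= 2 ^ (n - 1) * M) by (unfold M; rewrite <- pow_add; apply pow_R1_Rle; lra).
    eapply reach_conseq; [exact HNf | apply (Hst R)|].
    intros R' _ [A [pk [Rr [-> [Hf [_ [Hz Hout]]]]]]]. exists (flat T A ++ Rr); split; [reflexivity|].
    pose proof (fair_ef _ _ _ Hf Hz) as Hef.
    exists A, Rr; split; [reflexivity|]. split; [exact Hef|].
    destruct Hout as [[p [t [X [[] _]]]]|[[a [b [Hab Hadv]]]|[a [b [rho [rho' [s [H1 [H2 [[H3 H4] H5]]]]]]]]]].
    + left. exists A, Rr, a, b; split; [reflexivity|]. split; [exact Hef|]. split; [left; exact Hab|].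
      destruct (Hz b) as [_ Hc]; [intros []|]. rewrite Hc, Rminus_0_r in Hadv.
      apply Rle_trans with (1 := Hadv), Rmult_le_compat_r; [|exact HM].
      specialize (Hef a b (or_introl Hab)); lra.
    + right. exists a, b, rho, rho', s; repeat split; try tauto; lra.
Qed.

(** The addition [n + 1] pays for the factor [2 * n] lost in a trade. *)
Definition lean_exp (n : nat) : nat := (stage_exp n + n + 1)%nat.

Lemma settle_lean T R c : NoDup (nodes T) -> (2 <= sz T)%nat ->
  (forall t, NoDup (nodes t) -> (sz t < sz T)%nat -> divisible t c) ->
  reach (2 * fact (sz T) + (lean_exp (sz T) + 2 * c)) R (leaning T (lean_exp (sz T))).
Proof.
  intros HN Hsz Hdiv. eapply reach_bind; [apply (settle T R HN Hsz)|].
  intros R' _ [A [Rr [-> [Hef [Hl|Hd]]]]].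
  - apply reach_conseq with 0%nat (fun R1 => R1 = flat T A ++ Rr); [lia | apply reach_ret; reflexivity|].
    intros R1 _ ->. destruct Hl as [B [Rr' [a [b [Heq [H1 [H2 H3]]]]]]].
    exists (flat T A ++ Rr); split; [reflexivity|]. exists B, Rr', a, b; repeat (split; [assumption|]).
    apply Rle_trans with (1 := H3), Rmult_le_compat_r; [specialize (H1 a b H2); lra|].
    apply Rle_pow; [lra | unfold lean_exp; lia].
  - replace (lean_exp (sz T) + 2 * c)%nat with (lean_exp (sz T) + 2 * c + 0)%nat by lia.
    eapply (reach_on _ 0 _ Rr (flat T A)); [apply Permutation_app_comm | apply (trade T Rr _ c HN Hdiv Hd)|].
    intros X' _ [B [Rr' [a [b [-> [H1 [H2 H3]]]]]]].
    apply reach_conseq with 0%nat (fun R1 => R1 = (flat T B ++ Rr') ++ flat T A); [lia | apply reach_ret; reflexivity|].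
    intros R1 _ ->. exists (flat T (fun i => A i ++ B i) ++ Rr'); split; [rewrite flat_app; perm_app|].
    exists (fun i => A i ++ B i), Rr', a, b; split; [reflexivity|]. split; [apply ef_add; assumption|].
    split; [exact H2|]. apply Rle_trans with (1 := H3). rewrite !val_app. specialize (Hef a b H2).
    apply Rmult_le_compat_l; [apply pow_le; lra | lra].
Qed.

(* Once the residue is worth less to [a] than her advantage over [b], the component of [b] can have all of it. *)
Lemma absorb T c R' : NoDup (nodes T) ->
  (forall t, NoDup (nodes t) -> (sz t < sz T)%nat -> divisible t c) -> leaning T (lean_exp (sz T)) R' ->
  reach (shrink_cost (sz T) (lean_exp (sz T)) + c) R' (fun R1 => exists A, R1 = flat T A /\ ef T A).
Proof.
  intros HN Hdiv [A [Rr [a [b [-> [Hef [Hab Hl]]]]]]]. set (e := lean_exp (sz T)) in *.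
  destruct (adj_nodes _ _ _ Hab) as [Hia Hib].
  eapply (reach_on _ c _ Rr (flat T A)); [apply Permutation_app_comm | apply (shrink T a e Rr HN Hia)|].
  intros X' _ [B [Rr' [-> [HefB HB]]]].
  destruct (split_edge T a b HN Hab) as [ta [tb [Hra [Hrb [HPt Hedges]]]]].
  pose proof (Permutation_NoDup HPt HN) as HN'. apply NoDup_app_iff in HN'. destruct HN' as [HNa [HNb Hdisj]].
  assert (Hsz : (sz T = sz ta + sz tb)%nat).
  { unfold sz. rewrite (Permutation_length HPt), length_app; reflexivity. }
  pose proof (sz_pos ta) as Hpa.
  replace c with (c + 0)%nat by lia.
  eapply (reach_on c 0 _ Rr' (flat T B ++ flat T A)); [perm_app | apply (Hdiv tb HNb ltac:(lia))|].
  intros X1 HX1 [A2 [-> [Hef2 _]]].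
  apply reach_conseq with 0%nat (fun R1 => R1 = flat tb A2 ++ flat T B ++ flat T A); [lia | apply reach_ret; reflexivity|].
  intros R1 _ ->.
  assert (Hina : In a (nodes ta)) by (rewrite <- Hra; apply root_in_nodes).
  assert (Hinb : In b (nodes tb)) by (rewrite <- Hrb; apply root_in_nodes).
  set (G := glue ta (fun _ => []) A2).
  assert (HGa : forall u, In u (nodes ta) -> G u = []) by (intros; unfold G; apply glue_in; assumption).
  assert (HGb : forall u, In u (nodes tb) -> G u = A2 u).
  { intros u Hu; unfold G; apply glue_out; intros H; apply (Hdisj u H Hu). }
  assert (HG : Permutation (flat T G) (flat tb A2)).
  { unfold G. rewrite (flat_glue T ta tb _ _ HN HPt), flat_nil. reflexivity. }
  exists (flat T (fun i => (A i ++ B i) ++ G i)); split; [rewrite !flat_app, HG; perm_app|].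
  exists (fun i => (A i ++ B i) ++ G i); split; [reflexivity|].
  intros u v Huv. pose proof (Hef u v Huv) as HA. pose proof (HefB u v Huv) as HBuv. rewrite !val_app.
  destruct (Hedges u v Huv) as [H|[H|[[-> ->]|[-> ->]]]].
  - destruct (adj_nodes _ _ _ H) as [Hu Hv]. rewrite !HGa by assumption. lra.
  - destruct (adj_nodes _ _ _ H) as [Hu Hv]. rewrite !HGb by assumption. specialize (Hef2 u v H). lra.
  - rewrite (HGa a Hina), (HGb b Hinb), val_nil.
    assert (val a (A2 b) <= val a Rr') by (rewrite <- (HX1 a); apply val_flat_ge, Hinb).
    assert (H2e : 0 < 2 ^ e) by (apply pow_lt; lra).
    assert (val a Rr' <= val a (A a) - val a (A b)).
    { apply Rmult_le_reg_l with (2 ^ e); [exact H2e | lra]. }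
    lra.
  - rewrite (HGa a Hina), (HGb b Hinb), val_nil. pose proof (val_nonneg b (A2 b)). lra.
Qed.

(** * The recursion and its cost *)

(** Of the three recursive divisions two belong to a trade, one for each component, and one to the
    absorption. *)
Fixpoint comp_cost (n : nat) : nat :=
  match n with
  | O => 0
  | S m => 3 * comp_cost m + (2 * fact n + (round_cost n + lean_exp n + shrink_cost n (lean_exp n)))
  end.

Lemma comp_exists n : forall T, NoDup (nodes T) -> (sz T <= n)%nat -> divisible T (comp_cost n).
Proof.
  induction n as [|n IH]; intros T HN Hsz; [pose proof (sz_pos T); lia|].
  destruct (Nat.eq_dec (sz T) (S n)) as [Heq|Hne].
  2:{ intros R. eapply reach_conseq; [|apply (IH T HN ltac:(lia) R)|].
      - change (comp_cost (S n)) with (3 * comp_cost n + (2 * fact (S n) +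
          (round_cost (S n) + lean_exp (S n) + shrink_cost (S n) (lean_exp (S n)))))%nat. lia.
      - intros R' _ H; exists R'; split; [reflexivity | exact H]. }
  destruct n as [|n].
  - intros R. destruct T as [r [|t ts]].
    2:{ exfalso. unfold sz in Heq; simpl in Heq. rewrite length_app in Heq. pose proof (sz_pos t). unfold sz in *; lia. }
    apply reach_conseq with 0%nat (fun R' => R' = R); [lia | apply reach_ret; reflexivity|].
    intros R' _ ->. exists R; split; [reflexivity|]. exists (fun _ => R). split; [unfold flat; simpl; rewrite app_nil_r; reflexivity|].
    split; [intros u v [[]|[]]|]. unfold n_of, sz; simpl. lra.
  - assert (Hdiv : forall t, NoDup (nodes t) -> (sz t < sz T)%nat -> divisible t (comp_cost (S n))).
    { intros t Ht Hlt; apply IH; [exact Ht | lia]. }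
    intros R. set (c := comp_cost (S n)) in *. set (m := S (S n)) in *.
    apply reach_conseq with (round_cost m + ((2 * fact m + (lean_exp m + 2 * c)) + ((shrink_cost m (lean_exp m) + c) + 0)))%nat
      (fun R' => exists A, R' = flat T A /\ ef T A /\ val (root T) R <= n_of T * val (root T) (A (root T)));
      [|rewrite <- Heq|intros R' _ H; exists R'; split; [reflexivity | exact H]].
    { change (comp_cost m) with (3 * c + (2 * fact m + (round_cost m + lean_exp m + shrink_cost m (lean_exp m))))%nat. lia. }
    (* This round already secures the share of the root; everything after it only has to be
       envy-free. *)
    eapply reach_bind; [apply (round T R HN)|]. intros R' _ [A [Rr [-> [Hef Hpr]]]].
    eapply (reach_on _ _ _ Rr (flat T A)); [apply Permutation_app_comm | apply (settle_lean T Rr c HN ltac:(lia) Hdiv)|].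
    intros X Hx Hl.
    eapply (reach_on _ 0 _ X (flat T A)); [reflexivity | apply (absorb T c X HN Hdiv Hl)|].
    intros X' _ [B [-> HefB]].
    apply reach_conseq with 0%nat (fun R1 => R1 = flat T B ++ flat T A); [lia | apply reach_ret; reflexivity|].
    intros R1 _ ->. exists (flat T (fun i => A i ++ B i)); split; [rewrite flat_app; apply Permutation_app_comm|].
    exists (fun i => A i ++ B i); split; [reflexivity|]. split; [apply ef_add; assumption|].
    apply Rle_trans with (1 := Hpr), Rmult_le_compat_l; [apply pos_INR|]. rewrite val_app.
    pose proof (val_nonneg (root T) (B (root T))); lra.
Qed.

(** * From the game to Robertson-Webb protocols *)

Lemma succeeds_mono n E vs P k k' : (k <= k')%nat -> succeeds n E vs P k -> succeeds n E vs P k'.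
Proof.
  intros Hk HP; revert k' Hk; induction HP as [A k H1 H2|i x t f k H1 H2 H3 _ IH|i x y f k H1 H2 H3 H4 _ IH]; intros k' Hk.
  - apply succ_output; assumption.
  - destruct k' as [|k']; [lia|]. apply succ_cut; [assumption..|]. intros y Hy Hv; apply IH; [exact Hy | exact Hv | lia].
  - destruct k' as [|k']; [lia|]. apply succ_eval; [assumption..|]. apply IH; lia.
Qed.

Fixpoint evals (js : list nat) (x m : R) (f : list R -> protocol) : protocol :=
  match js with
  | [] => f []
  | j :: js => EvalQ j x m (fun w => evals js x m (fun ws => f (w :: ws)))
  end.

Lemma evals_succeeds n E vs k x m : 0 <= x -> x <= m -> m <= 1 -> forall js f,
  (forall j, In j js -> (j < n)%nat) -> succeeds n E vs (f (map (fun j => vs j x m) js)) k ->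
  succeeds n E vs (evals js x m f) (length js + k).
Proof.
  intros H0 Hm H1; induction js as [|j js IH]; intros f Hj Hf; simpl; [exact Hf|].
  apply succ_eval; [apply Hj; simpl; auto | assumption..|].
  apply (IH (fun ws => f (vs j x m :: ws))); [intros; apply Hj; simpl; auto | exact Hf].
Qed.

Record tile := Tile { lo : R; hi : R; worth : atom }.

Fixpoint tiles (x : R) (l : list tile) : Prop :=
  match l with [] => x = 1 | s :: l => lo s = x /\ lo s <= hi s /\ tiles (hi s) l end.
(** The game permutes its bag freely, so the tiles are listed in any order and only some
    rearrangement of them runs from 0 to 1. *)
Definition tiling (l : list tile) : Prop := exists l', Permutation l l' /\ tiles 0 l'.
Definition measures (n : nat) (vs : nat -> R -> R -> R) (l : list tile) : Prop :=
  forall s, In s l -> forall i, (i < n)%nat -> av (worth s) i = vs i (lo s) (hi s).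
(** Atoms have a worth for every natural number; making it 0 beyond the [n] agents renders moves of
    nonexistent agents trivial. *)
Definition supported (n : nat) (l : list tile) : Prop :=
  forall s, In s l -> forall i, (n <= i)%nat -> av (worth s) i = 0.

Lemma tiles_le x l : tiles x l -> x <= 1.
Proof. revert x; induction l as [|s l IH]; simpl; intros x H; [lra|]. destruct H as [H1 [H2 H3]]. specialize (IH _ H3); lra. Qed.

Lemma tiles_bounds x l s : tiles x l -> In s l -> x <= lo s /\ lo s <= hi s /\ hi s <= 1.
Proof.
  revert x; induction l as [|s' l IH]; intros x H Hs; [destruct Hs|]. destruct H as [H1 [H2 H3]].
  destruct Hs as [<-|Hs].
  - pose proof (tiles_le _ _ H3). lra.
  - specialize (IH _ H3 Hs). lra.
Qed.

Lemma tiling_bounds l s : tiling l -> In s l -> 0 <= lo s /\ lo s <= hi s /\ hi s <= 1.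
Proof. intros [l' [HP Ht]] Hs. apply (tiles_bounds 0 l' s Ht), (Permutation_in s HP Hs). Qed.

Lemma tiles_split x l1 s l2 m e1 e2 : lo s <= m <= hi s -> tiles x (l1 ++ s :: l2) ->
  tiles x (l1 ++ Tile (lo s) m e1 :: Tile m (hi s) e2 :: l2).
Proof.
  intros Hm; revert x; induction l1 as [|s' l1 IH]; simpl; intros x H.
  - destruct H as [H1 [H2 H3]]. repeat split; try lra; try assumption.
  - destruct H as [H1 [H2 H3]]. auto.
Qed.

Lemma tiling_split s l m e1 e2 : lo s <= m <= hi s -> tiling (s :: l) ->
  tiling (Tile (lo s) m e1 :: Tile m (hi s) e2 :: l).
Proof.
  intros Hm [l' [HP Ht]].
  assert (Hin : In s l') by (apply (Permutation_in s HP); simpl; auto).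
  apply in_split in Hin. destruct Hin as [l1 [l2 ->]].
  exists (l1 ++ Tile (lo s) m e1 :: Tile m (hi s) e2 :: l2); split; [|apply tiles_split; assumption].
  apply Permutation_cons_app_inv in HP. rewrite HP.
  apply Permutation_cons_app, Permutation_cons_app. reflexivity.
Qed.

Definition share (i j : nat) (own : list (atom * nat)) : R :=
  sumf (fun p => if Nat.eqb (snd p) j then av (fst p) i else 0) own.

Definition envy_free (n : nat) (E : nat -> nat -> Prop) (L : bag) : Prop :=
  exists own, map fst own = L /\ (forall p, In p own -> (snd p < n)%nat) /\
    forall i j, E i j -> share i j own <= share i i own.

Definition output (l : list (tile * nat)) : alloc :=
  mkAlloc (0 :: map (fun p => hi (fst p)) l) (map snd l).

Lemma output_valid n l : tiles 0 (map fst l) -> (forall p, In p l -> (snd p < n)%nat) -> valid_alloc n (output l).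
Proof.
  unfold output, valid_alloc; simpl. rewrite !length_map. intros Ht Hn.
  split; [reflexivity|]. split; [reflexivity|]. split; [|split].
  - revert Ht. generalize 0 at 1 2. clear. induction l as [|p l IH]; simpl; intros x Ht; [exact Ht|].
    destruct Ht as [_ [_ Ht]]. apply IH in Ht. clear IH. destruct l; simpl in *; exact Ht.
  - revert Ht. generalize 0 at 1 2. clear. induction l as [|p l IH]; simpl; intros x Ht k Hk; [lia|].
    destruct Ht as [H1 [H2 H3]]. destruct k as [|k]; [simpl; lra|]. apply (IH (hi (fst p)) H3 k). lia.
  - intros k Hk. assert (Hin : In (nth k (map snd l) 0%nat) (map snd l)) by (apply nth_In; rewrite length_map; exact Hk).
    apply in_map_iff in Hin. destruct Hin as [p [<- Hp]]. apply Hn, Hp.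
Qed.

Lemma output_value v l j : tiles 0 (map fst l) ->
  piece_value v (output l) j = sumf (fun p => if Nat.eqb (snd p) j then v (lo (fst p)) (hi (fst p)) else 0) l.
Proof.
  unfold piece_value, output; simpl. rewrite length_map. generalize 0 at 1 3.
  induction l as [|p l IH]; simpl; intros x Ht; [reflexivity|]. destruct Ht as [<- [_ Ht]]. f_equal.
  rewrite <- seq_shift, map_map. rewrite <- (IH _ Ht). reflexivity.
Qed.

Lemma diagonal_zero v x : valuation v -> 0 <= x <= 1 -> v x x = 0.
Proof. intros [_ [Hadd _]] Hx. assert (v x x = v x x + v x x) by (apply Hadd; lra). lra. Qed.

Lemma measures_perm n vs l l' : Permutation l l' -> measures n vs l -> measures n vs l'.
Proof. intros HP H s Hs; apply H, (Permutation_in s (Permutation_sym HP) Hs). Qed.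

(** One protocol for all profiles that agree with the known worths of the tiles. A move costs
    [n + 1] queries: the cut and one evaluation per agent. *)
Definition plays n E (l : list tile) (k : nat) (P : protocol) : Prop :=
  forall vs, valuation_profile n vs -> tiling l -> measures n vs l -> succeeds n E vs P (k * (n + 1)).

Lemma plays_output n E l : (forall i j, E i j -> (i < n)%nat /\ (j < n)%nat) -> envy_free n E (map worth l) ->
  exists P, forall k, plays n E l k P.
Proof.
  intros HE [own [Hown [Hn Hef]]].
  destruct (classic (tiling l)) as [[l' [HP Ht]]|Hno].
  2:{ exists (Output (mkAlloc [] [])). intros k vs _ H; contradiction. }
  assert (Hz : map fst (combine l (map snd own)) = l /\ map (fun p => (worth (fst p), snd p)) (combine l (map snd own)) = own).
  { clear -Hown. revert own Hown; induction l as [|s l IH]; intros [|[e o] own] H; simpl in *; try discriminate; [auto|].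
    injection H as -> H. destruct (IH own H) as [-> ->]; auto. }
  destruct Hz as [Hz1 Hz2]. set (z := combine l (map snd own)) in *.
  assert (HP' : Permutation l' (map fst z)) by (rewrite Hz1; apply Permutation_sym, HP).
  apply Permutation_map_inv in HP'. destruct HP' as [z' [-> HPz]].
  exists (Output (output z')). intros k vs Hvs _ Hmeas. apply succ_output.
  - apply output_valid; [exact Ht|]. intros p Hp. apply (Permutation_in p (Permutation_sym HPz)) in Hp.
    apply (Hn (worth (fst p), snd p)). rewrite <- Hz2. apply in_map_iff; exists p; auto.
  - intros i j Hi Hj Hij. rewrite !output_value by exact Ht.
    assert (Hsh : forall o, sumf (fun p => if Nat.eqb (snd p) o then vs i (lo (fst p)) (hi (fst p)) else 0) z' = share i o own).
    { intros o. rewrite <- (sumf_perm _ _ _ HPz). unfold share. rewrite <- Hz2, sumf_map. apply sumf_ext.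
      intros p Hp; simpl. rewrite (Hmeas (fst p)); [reflexivity | | exact Hi].
      rewrite <- Hz1. apply in_map, Hp. }
    rewrite !Hsh. apply Hef, Hij.
Qed.

(** The continuation may depend on the answers only. The cut point and the evaluations determine the
    worths of both parts, so it is chosen as a function of these answers, with a dummy output where
    no profile could have given them. *)
Lemma plays_cut n E s l i t k : (i < n)%nat -> 0 <= t <= av (worth s) i -> supported n (s :: l) ->
  (forall y z : atom, (forall j, y j + z j = worth s j) -> y i = t ->
     forall m, supported n (Tile (lo s) m y :: Tile m (hi s) z :: l) ->
     exists P, plays n E (Tile (lo s) m y :: Tile m (hi s) z :: l) k P) ->
  exists P, plays n E (s :: l) (S k) P.
Proof.
  intros Hi Ht Hsup IH.
  set (good := fun m ws P => forall vs, valuation_profile n vs -> tiling (s :: l) -> measures n vs (s :: l) ->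
    lo s <= m <= hi s -> vs i (lo s) m = t -> ws = map (fun j => vs j (lo s) m) (seq 0 n) ->
    succeeds n E vs P (k * (n + 1))).
  assert (Hgood : forall m ws, exists P, good m ws P).
  { intros m ws. destruct (classic (exists vs, valuation_profile n vs /\ tiling (s :: l) /\ measures n vs (s :: l) /\
      lo s <= m <= hi s /\ vs i (lo s) m = t /\ ws = map (fun j => vs j (lo s) m) (seq 0 n)))
      as [[vs [Hvs [Htil [Hmeas [Hm [Hvt Hws]]]]]]|Hno].
    2:{ exists (Output (mkAlloc [] [])). intros vs H1 H2 H3 H4 H5 H6; exfalso; apply Hno; exists vs; auto 10. }
    assert (Hnth : forall vs', ws = map (fun j => vs' j (lo s) m) (seq 0 n) -> forall j, (j < n)%nat -> nth j ws 0 = vs' j (lo s) m).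
    { intros vs' -> j Hj. rewrite (nth_indep _ 0 ((fun j => vs' j (lo s) m) 0%nat)) by (rewrite length_map, length_seq; exact Hj).
      rewrite (map_nth (fun j => vs' j (lo s) m)), seq_nth by exact Hj. reflexivity. }
    destruct (tiling_bounds _ s Htil) as [B1 [B2 B3]]; [simpl; auto|].
    (* Built from the answers, hence the same for every profile consistent with them; the profile at
       hand only shows that both parts are non-negative. *)
    set (yv := fun j => if lt_dec j n then nth j ws 0 else 0).
    assert (Hy0 : forall j, 0 <= yv j /\ 0 <= worth s j - yv j).
    { intros j. pose proof (av_nonneg (worth s) j). unfold yv; destruct (lt_dec j n) as [Hj|]; [|lra].
      rewrite (Hnth vs Hws j Hj), (Hmeas s (or_introl eq_refl) j Hj).
      destruct (Hvs j Hj) as [Hnn [Hadd _]]. rewrite (Hadd (lo s) m (hi s)) by lra.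
      assert (0 <= vs j (lo s) m) by (apply Hnn; lra). assert (0 <= vs j m (hi s)) by (apply Hnn; lra). lra. }
    set (y := Atom yv (fun j => proj1 (Hy0 j))). set (z := Atom (fun j => worth s j - yv j) (fun j => proj2 (Hy0 j))).
    destruct (IH y z) with (m := m) as [P HP].
    - intros j; unfold y, z; simpl; lra.
    - unfold y, yv; simpl. destruct (lt_dec i n); [|contradiction]. rewrite (Hnth vs Hws i Hi); exact Hvt.
    - intros s' [<-|[<-|Hs']] j Hj; simpl.
      + unfold yv; destruct (lt_dec j n); [lia | reflexivity].
      + unfold yv; destruct (lt_dec j n); [lia|]. rewrite (Hsup s) by (simpl; auto). lra.
      + apply Hsup; simpl; auto.
    - exists P. intros vs' Hvs' _ Hmeas' _ _ Hws'. apply HP; [exact Hvs' | apply tiling_split; assumption|].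
      intros s' [<-|[<-|Hs']] j Hj; simpl.
      + unfold yv; destruct (lt_dec j n); [|contradiction]. apply (Hnth vs' Hws' j Hj).
      + unfold yv; destruct (lt_dec j n); [|contradiction]. rewrite (Hnth vs' Hws' j Hj), (Hmeas' s (or_introl eq_refl) j Hj).
        destruct (Hvs' j Hj) as [_ [Hadd _]]. rewrite (Hadd (lo s) m (hi s)) by lra. lra.
      + apply Hmeas'; simpl; auto. }
  set (cont := fun m ws => proj1_sig (constructive_indefinite_description _ (Hgood m ws))).
  assert (Hcont : forall m ws, good m ws (cont m ws)) by (intros; unfold cont; apply proj2_sig).
  clearbody cont.
  (* The answer may overshoot the tile across a stretch worthless to agent [i], hence the truncation. *)
  exists (CutQ i (lo s) t (fun m => evals (seq 0 n) (lo s) (Rmin m (hi s)) (cont (Rmin m (hi s))))).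
  intros vs Hvs Htil Hmeas.
  destruct (tiling_bounds _ s Htil) as [B1 [B2 B3]]; [simpl; auto|].
  destruct (Hvs i Hi) as [Hnn [Hadd _]].
  pose proof (Hmeas s (or_introl eq_refl) i Hi) as Hworth.
  replace (S k * (n + 1))%nat with (S (n + k * (n + 1))) by lia.
  apply succ_cut; [exact Hi | lra | |].
  { assert (vs i (lo s) 1 = vs i (lo s) (hi s) + vs i (hi s) 1) by (apply Hadd; lra).
    assert (0 <= vs i (hi s) 1) by (apply Hnn; lra). lra. }
  intros m Hm Hvm. set (m' := Rmin m (hi s)).
  assert (Hm' : lo s <= m' <= hi s) by (unfold m'; split; [apply Rmin_glb; lra | apply Rmin_r]).
  assert (Hvm' : vs i (lo s) m' = t).
  { unfold m', Rmin. destruct (Rle_dec m (hi s)) as [|Hgt]; [exact Hvm|].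
    assert (vs i (lo s) m = vs i (lo s) (hi s) + vs i (hi s) m) by (apply Hadd; lra).
    assert (0 <= vs i (hi s) m) by (apply Hnn; lra). lra. }
  replace (n + k * (n + 1))%nat with (length (seq 0 n) + k * (n + 1))%nat by (rewrite length_seq; reflexivity).
  apply evals_succeeds; [lra | lra | lra | intros j Hj; apply in_seq in Hj; lia|].
  apply (Hcont m' _ vs Hvs Htil Hmeas Hm' Hvm' eq_refl).
Qed.

Lemma win_protocol n E k L : (forall i j, E i j -> (i < n)%nat /\ (j < n)%nat) ->
  Win (envy_free n E) k L -> forall l, map worth l = L -> supported n l -> exists P, plays n E l k P.
Proof.
  intros HE HW; induction HW as [k L HG|k e L i t Ht _ IH|k L L' HP _ IH]; intros l Hl Hsup.
  - subst L. destruct (plays_output n E l HE HG) as [P HP]. exists P; apply HP.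
  - destruct l as [|s l]; [discriminate|]. injection Hl as <- <-.
    destruct (lt_dec i n) as [Hi|Hi].
    + apply (plays_cut n E s l i t k Hi Ht Hsup). intros y z Hyz Hy m Hsup'.
      apply (IH y z Hyz Hy); [reflexivity | exact Hsup'].
    (* [i] is not an agent, so [t] is 0: a tile of length 0 plays the part cut off and no query is
       issued. *)
    + set (o := Atom (fun _ => 0) (fun _ => Rle_refl 0)).
      pose proof (Hsup s (or_introl eq_refl) i ltac:(lia)) as H0.
      destruct (IH o (worth s)) with (l := Tile (lo s) (lo s) o :: Tile (lo s) (hi s) (worth s) :: l) as [P HP].
      * intros j; simpl; lra.
      * simpl; lra.
      * reflexivity.
      * intros s' [<-|[<-|Hs']] j Hj; simpl; [reflexivity | apply (Hsup s); [left; reflexivity | exact Hj] | apply Hsup; [right; exact Hs' | exact Hj]].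
      * exists P. intros vs Hvs Htil Hmeas. destruct (tiling_bounds _ s Htil) as [B1 [B2 B3]]; [simpl; auto|].
        apply succeeds_mono with (k * (n + 1))%nat; [lia|]. apply HP; [exact Hvs | apply tiling_split; [lra | exact Htil]|].
        intros s' [<-|[<-|Hs']] j Hj; simpl.
        -- symmetry; apply diagonal_zero; [apply Hvs, Hj | lra].
        -- apply (Hmeas s); [left; reflexivity | exact Hj].
        -- apply Hmeas; [right; exact Hs' | exact Hj].
  - rewrite <- Hl in HP. apply Permutation_map_inv in HP. destruct HP as [l' [-> HPl]].
    destruct (IH l' eq_refl) as [P HP'].
    { intros s Hs; apply Hsup, (Permutation_in s (Permutation_sym HPl) Hs). }
    exists P. intros vs Hvs [l0 [HP0 Ht]] Hmeas. apply HP'; [exact Hvs | | apply (measures_perm _ _ _ _ HPl Hmeas)].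
    exists l0; split; [rewrite <- HPl; exact HP0 | exact Ht].
Qed.

Lemma share_flat i j A ns : NoDup ns -> In j ns ->
  share i j (flat_map (fun o => map (fun e => (e, o)) (A o)) ns) = val i (A j).
Proof.
  assert (Hone : forall o, share i j (map (fun e : atom => (e, o)) (A o)) = if Nat.eqb o j then val i (A o) else 0).
  { intros o; unfold share; rewrite sumf_map; simpl. destruct (Nat.eqb o j).
    - unfold val, sumf; reflexivity.
    - induction (A o); simpl; lra. }
  assert (Happ : forall l l', share i j (l ++ l') = share i j l + share i j l').
  { unfold share; induction l as [|x l IH]; intros l'; simpl; [lra|]. rewrite IH; lra. }
  assert (Hnone : forall ns, ~ In j ns -> share i j (flat_map (fun o => map (fun e => (e, o)) (A o)) ns) = 0).
  { induction ns0 as [|o l IH]; intros H; simpl; [reflexivity|]. simpl in H. rewrite Happ, IH, Hone by tauto.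
    destruct (Nat.eqb_spec o j); [tauto | lra]. }
  induction ns as [|o ns IH]; intros HN Hj; [destruct Hj|]. inversion HN; subst. simpl. rewrite Happ, Hone.
  destruct (Nat.eqb_spec o j) as [->|Hne].
  - rewrite Hnone by assumption. lra.
  - destruct Hj as [Hj|Hj]; [contradiction|]. rewrite IH by assumption. lra.
Qed.

Lemma ef_envy_free n E T A : Permutation (nodes T) (seq 0 n) -> (forall i j, E i j -> adj T i j) -> ef T A ->
  envy_free n E (flat T A).
Proof.
  intros HP HE Hef. assert (HN : NoDup (nodes T)) by (apply (Permutation_NoDup (Permutation_sym HP)), seq_NoDup).
  exists (flat_map (fun o => map (fun e => (e, o)) (A o)) (nodes T)). split; [|split].
  - unfold flat. clear. induction (nodes T) as [|o l IH]; simpl; [reflexivity|].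
    rewrite map_app, IH, map_map. f_equal. simpl. apply map_id.
  - intros p Hp. apply in_flat_map in Hp. destruct Hp as [o [Ho Hp]]. apply in_map_iff in Hp. destruct Hp as [e [<- _]].
    simpl. apply (Permutation_in o HP), in_seq in Ho. lia.
  - intros i j Hij. apply HE in Hij. destruct (adj_nodes _ _ _ Hij) as [Hi Hj].
    rewrite !share_flat by assumption. apply Hef, Hij.
Qed.

Lemma tree_protocol n E : (1 <= n)%nat -> is_tree n E ->
  exists P, forall vs, valuation_profile n vs -> succeeds n E vs P (comp_cost n * (n + 1)).
Proof.
  intros Hn HE. destruct (graph_tree n E Hn HE) as [T [HP Hadj]].
  destruct HE as [[HE _] _].
  assert (HN : NoDup (nodes T)) by (apply (Permutation_NoDup (Permutation_sym HP)), seq_NoDup).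
  assert (Hsz : sz T = n) by (unfold sz; rewrite (Permutation_length HP), length_seq; reflexivity).
  assert (Hunit : forall i, 0 <= if lt_dec i n then 1 else 0) by (intros i; destruct (lt_dec i n); lra).
  set (u := Atom _ Hunit).
  assert (HW : Win (envy_free n E) (comp_cost n) [u]).
  { pose proof (comp_exists n T HN ltac:(lia) [u] (envy_free n E) 0%nat []) as H.
    rewrite Nat.add_0_r in H. apply H. intros R' _ [A [-> [Hef _]]]. rewrite app_nil_r.
    apply win_done, (ef_envy_free n E T A HP Hadj Hef). }
  destruct (win_protocol n E _ _ HE HW [Tile 0 1 u] eq_refl) as [P Hplay].
  { intros s [<-|[]] i Hi; simpl. destruct (lt_dec i n); [lia | reflexivity]. }
  exists P. intros vs Hvs. apply Hplay; [exact Hvs | |].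
  - exists [Tile 0 1 u]; split; [reflexivity|]. simpl; repeat split; lra.
  - intros s [<-|[]] i Hi; simpl. destruct (lt_dec i n); [|contradiction]. symmetry; apply (Hvs i Hi).
Qed.

(** * Counting queries *)

(** The overhead is a polynomial of degree 5 whose coefficients sum to 44, and 1408 is 44 times
    2^5. *)
Lemma overhead_bound n : (1 <= n)%nat ->
  INR (round_cost n + lean_exp n + shrink_cost n (lean_exp n)) <= 1408 ^ n.
Proof.
  intros Hn. assert (H1 : 1 <= INR n) by (apply (le_INR 1), Hn).
  set (x := INR n) in *. set (p := 2 ^ n).
  assert (Hx : x <= p) by (unfold p; pose proof (INR_lt_pow2 n); fold x in H; lra).
  apply Rle_trans with (44 * x ^ 5).
  - unfold round_cost, lean_exp, stage_exp, shrink_cost, round_cost.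
    rewrite !plus_INR, !mult_INR, !plus_INR, !mult_INR. fold x. simpl INR.
    assert (x <= x ^ 2) by nra. assert (H3 : x ^ 2 <= x ^ 3) by nra. assert (H4 : x ^ 3 <= x ^ 4) by nra.
    assert (H5 : x ^ 4 <= x ^ 5) by nra. nra.
  - apply Rle_trans with (44 ^ n * p ^ 5).
    + apply Rmult_le_compat; [lra | apply pow_le; lra | | apply pow_incr; lra].
      rewrite <- (pow_1 44) at 1. apply Rle_pow; [lra | exact Hn].
    + unfold p. rewrite <- pow_mult, Nat.mul_comm, pow_mult, <- Rpow_mult_distr. right; f_equal; lra.
Qed.

(** 1413 = 1408 + 3 + 2 collects the overhead, the recursive calls and the factorial term of one
    step. *)
Lemma comp_cost_bound n : INR (comp_cost n) <= 1413 ^ n * INR (fact n).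
Proof.
  induction n as [|n IH]; [simpl; lra|].
  change (comp_cost (S n)) with (3 * comp_cost n + (2 * fact (S n) +
          (round_cost (S n) + lean_exp (S n) + shrink_cost (S n) (lean_exp (S n)))))%nat.
  rewrite plus_INR, plus_INR, !mult_INR. pose proof (overhead_bound (S n) ltac:(lia)) as Hp.
  set (p := INR (round_cost (S n) + lean_exp (S n) + shrink_cost (S n) (lean_exp (S n)))) in *. clearbody p.
  assert (Hf : INR (fact n) <= INR (fact (S n))) by (apply le_INR, fact_le; lia).
  assert (Hf0 : 1 <= INR (fact n)) by (apply (le_INR 1), lt_O_fact).
  assert (Hq : 1 <= 1413 ^ n) by (apply pow_R1_Rle; lra).
  assert (Hpq : 1408 ^ n <= 1413 ^ n) by (apply pow_incr; lra).
  simpl (_ ^ S n) in *. set (q := 1413 ^ n) in *. set (f := INR (fact n)) in *. set (g := INR (fact (S n))) in *.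
  clearbody q f g. replace (INR 3) with 3 by (simpl; lra). replace (INR 2) with 2 by (simpl; lra).
  assert (q * f <= q * g) by nra. assert (1 * q <= g * q) by nra. assert (g <= q * g) by nra. lra.
Qed.

Lemma fact_le_pow n : (fact n <= n ^ n)%nat.
Proof.
  induction n as [|n IH]; [simpl; lia|]. change (fact (S n)) with (S n * fact n)%nat. rewrite Nat.pow_succ_r'.
  apply Nat.mul_le_mono_l. apply Nat.le_trans with (1 := IH), Nat.pow_le_mono_l. lia.
Qed.

(** 2826 is twice 1413, the factor 2^n absorbing the [n + 1] queries per move. *)
Lemma total_cost_bound n : INR (comp_cost n * (n + 1)) <= 2826 ^ n * INR n ^ n.
Proof.
  rewrite mult_INR, plus_INR. change (INR 1) with 1. pose proof (comp_cost_bound n) as H1. pose proof (INR_lt_pow2 n) as H2.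
  pose proof (pos_INR n). pose proof (pos_INR (comp_cost n)).
  apply Rle_trans with (1413 ^ n * INR (fact n) * 2 ^ n); [apply Rmult_le_compat; lra|].
  replace 2826 with (1413 * 2) by lra. rewrite Rpow_mult_distr.
  assert (INR (fact n) <= INR n ^ n) by (rewrite <- pow_INR; apply le_INR, fact_le_pow).
  assert (0 <= 1413 ^ n * 2 ^ n) by (apply Rmult_le_pos; apply pow_le; lra). nra.
Qed.

Lemma inverse_log_cv c : 0 < c -> Un_cv (fun n => c / ln (INR n)) 0.
Proof.
  intros Hc e He. destruct (INR_unbounded (exp (c / e))) as [N HN]. exists N; intros n Hn.
  assert (Hlt : exp (c / e) < INR n) by (apply Rlt_le_trans with (1 := HN), le_INR, Hn).
  assert (Hpos : 0 < c / e) by (apply Rdiv_lt_0_compat; lra).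
  apply ln_increasing in Hlt; [|apply exp_pos]. rewrite ln_exp in Hlt.
  unfold R_dist. rewrite Rminus_0_r, Rabs_right; [|apply Rle_ge, Rlt_le, Rdiv_lt_0_compat; lra].
  apply Rmult_lt_reg_r with (ln (INR n)); [lra|]. unfold Rdiv at 1. rewrite Rmult_assoc, Rinv_l, Rmult_1_r by lra.
  apply Rmult_lt_reg_r with (/ e); [apply Rinv_0_lt_compat, He|].
  replace (e * ln (INR n) * / e) with (ln (INR n)) by (field; lra). exact Hlt.
Qed.

Lemma pow_as_Rpower n D : (2 <= n)%nat -> 0 < D ->
  D ^ n * INR n ^ n = Rpower (INR n) ((1 + ln D / ln (INR n)) * INR n).
Proof.
  intros Hn HD. assert (H2 : 2 <= INR n) by (apply (le_INR 2), Hn).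
  assert (Hln : 0 < ln (INR n)) by (rewrite <- ln_1; apply ln_increasing; lra).
  rewrite <- (Rpower_pow n D HD), <- (Rpower_pow n (INR n)) by lra.
  unfold Rpower. rewrite <- exp_plus. f_equal. field. lra.
Qed.

Theorem theorem2 :
  exists eps : nat -> R, Un_cv eps 0 /\
  forall (n : nat) (E : nat -> nat -> Prop),
    (1 <= n)%nat -> is_tree n E ->
    exists (P : protocol) (k : nat),
      INR k <= Rpower (INR n) ((1 + eps n) * INR n) /\
      forall vs : nat -> R -> R -> R,
        valuation_profile n vs -> succeeds n E vs P k.
Proof.
  exists (fun n => ln 2826 / ln (INR n)). split.
  { apply inverse_log_cv. rewrite <- ln_1. apply ln_increasing; lra. }
  intros n E Hn HE. destruct (Nat.eq_dec n 1) as [->|Hn1].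
  (* For one agent [ln (INR n)] is 0 and the exponent says nothing; she gets the whole cake without
     a query, and any positive bound will do. *)
  - exists (Output (mkAlloc [0; 1] [0%nat])), 0%nat. split; [simpl; apply Rlt_le, exp_pos|].
    intros vs _. destruct HE as [[_ [_ Hirr]] _]. apply succ_output.
    + repeat split; simpl; intros [|k] Hk; try lia; lra.
    + intros i j Hi Hj Hij. exfalso. apply (Hirr i). replace i with j at 2 by lia. exact Hij.
  - destruct (tree_protocol n E Hn HE) as [P HP]. exists P, (comp_cost n * (n + 1))%nat.
    split; [|exact HP]. rewrite <- pow_as_Rpower by (lia || lra). apply total_cost_bound.
Qed.
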